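(* Let $N=2$ or $N\ge 5$, and $1\le\alpha,\beta\le N$ with $\alpha\neq\beta$. Then for any real numbers $0\le a\le b$, \[ \lim_{n\to\infty} \frac{\sum_{c\in\mathbb{N}_0,\ a\le n^{-1/4}c\le b} \operatorname{pb}_{\alpha,\beta;N}(\mathcal D(n), c)}{d_{\alpha,\beta;N;0}(n) - d_{\beta,\alpha;N;0}(n)} = \frac{\pi N}{2\sqrt{3}} \int_a^b x\, e^{-\frac{\pi N x^2}{4\sqrt{3}}}\, dx. \]
   Context: $\mathcal D(n)$ denotes the set of partitions of $n$ into distinct parts $\lambda=(\lambda_1,\dots,\lambda_l)$. For $1\le\alpha,\beta\le N$, $\alpha\ne\beta$, $\operatorname{pd}_{\alpha,\beta;N}(\lambda):=\#\{i:\lambda_i\equiv\alpha \pmod N\}-\#\{i:\lambda_i\equiv\beta\pmod N\}$. For $c\in\mathbb{R}$, $d_{\alpha,\beta;N;c}(n):=\#\{\lambda\in\mathcal D(n):\operatorname{pd}_{\alpha,\beta;N}(\lambda)\ge c\}$. For $c\in\mathbb{N}_0$, the parity bias is $\operatorname{pb}_{\alpha,\beta;N}(\mathcal D(n),c):=\#\{\lambda\in\mathcal D(n):\operatorname{pd}_{\alpha,\beta;N}(\lambda)=c\}-\#\{\lambda\in\mathcal D(n):\operatorname{pd}_{\beta,\alpha;N}(\lambda)=c\}$. *)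

(* Defs.v *)
From mathcomp Require Import all_boot all_order all_algebra.
From mathcomp Require Import all_classical all_reals all_analysis.

Set Implicit Arguments.
Unset Strict Implicit.
Unset Printing Implicit Defensive.

Import Order.TTheory GRing.Theory Num.Theory.

Local Open Scope ring_scope.

(* A partition of n into distinct parts is determined by its set of parts,
   a set of positive integers with sum n.  All parts are at most n, so this is
   a subset of 'I_n.+1 = {0, ..., n} not containing 0; the empty set is the
   empty partition of 0. *)
Definition distinct_partitions (n : nat) : {set {set 'I_n.+1}} :=
  [set l : {set 'I_n.+1} |
    (ord0 \notin l) && ((\sum_(i in l) (i : nat))%N == n)]%SET.

Definition parts_congr (N r n : nat) (l : {set 'I_n.+1}) : nat :=
  #|[set i in l | ((i : nat) == r %[mod N])%N]%SET|.

(* The difference is taken in int: it may be negative. *)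
Definition pd (alpha beta N n : nat) (l : {set 'I_n.+1}) : int :=
  (parts_congr N alpha l)%:Z - (parts_congr N beta l)%:Z.

Definition dcount (R : realType) (alpha beta N : nat) (c : R) (n : nat) : nat :=
  #|[set l in distinct_partitions n | c <= (pd alpha beta N l)%:~R]%SET|.

Definition pb (alpha beta N n c : nat) : int :=
  #|[set l in distinct_partitions n | pd alpha beta N l == c%:Z]%SET|%:Z
  - #|[set l in distinct_partitions n | pd beta alpha N l == c%:Z]%SET|%:Z.

(* Main.v *)
Require Import Defs.
From HB Require Import structures.
From mathcomp Require Import all_boot all_order all_algebra.
From mathcomp Require Import all_classical all_reals all_analysis.
From mathcomp Require Import complex.
From mathcomp Require Import ring lra zify.
Import Order.TTheory GRing.Theory Num.Theory.
Import numFieldNormedType.Exports.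
Local Open Scope classical_set_scope.
Local Open Scope ring_scope.

(** Let [p(n, c)] be the number of partitions of [n] into distinct parts whose
    parity difference is [c].  Two exact symmetries of the generating function
    replace its modular properties: exchanging the residue classes gives
    [p(n, -c) = p(n - (beta - alpha) c, c)], and multiplying the variable that
    marks the parity difference by [q ^ N] gives a recurrence between
    [p(., c - 1)], [p(., c)] and [p(., c + 1)].  Give [(n, c)] the Boltzmann
    mass [P(n, c)] proportional to [p(n, c) exp (- t n)], with [t] such that the
    expected size is [n].  Fourier inversion, with an elementary minor arc bound,
    shows that [P(n, 0)] has order [1 / n] and that the discrete derivatives of
    [P] are smaller by the expected powers of [n].  The recurrence then becomes
    [P(c - 1) - P(c + 1) = 2 t N c P(c) + error], so [P] is close to the Gaussian
    [P(0) exp (- t N c ^ 2 / 2)], and the reflection turns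
    [2 N (P(c) - P(- c))] into [(beta - alpha) (P(c - 1) - P(c + 1)) + error].
    The parity biases therefore telescope to values of the Gaussian, and
    [t sqrt n --> pi / (2 sqrt 3)] because [sum (-1) ^ (k - 1) / k ^ 2 = pi ^ 2 / 12]. *)

(** The bias is a first-order effect: at [c] of order [n ^ (1/4)] the difference [P(c) - P(- c)] is
    smaller than [P(c)] by a factor of order [n ^ (-1/4)], so a plain Gaussian approximation of [P]
    would lose it. The exact symmetries turn the bias into differences of [P] before anything is
    approximated; after telescoping, a crude error relative to [P(0)] suffices. The condition on [N]
    excludes a law of (size, parity difference) carried by a proper sublattice: for [N = 3] and
    classes 1, 2 the parity difference is congruent to [n] modulo 3, for [N = 4] and classes 1, 3
    modulo 2, and the transform then has several peaks. No asymptotics of the number of partitions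
    enters: numerator and denominator carry the same factor, and only a lower bound of the right
    order for [P(n, 0)] is used. The denominator is the sum over all [c >= 0], where the Gaussian
    difference is 1. The natural scales of the angles dual to size and to parity difference are
    [n ^ (-3/4)] and [n ^ (-1/4)]. Errors are tracked in powers of [u = n ^ (-1/80)]; fixed losses
    [1 / u] are affordable because every error finally gains at least one [u]. *)

Section WeightedConvolution.
Context {R : comNzRingType} {G : zmodType}.
Implicit Types (a b : G -> R) (x v : G) (f : G -> R) (l : seq G).

(** Multiplication of a generating function, seen as a function of the exponent, by
    [a x + b x X ^ x]. Weights [1, 1] count partitions and weights [1 - p, p] give the law of a sum
    of independent steps, so both share the lemmas on [wconv]. *)
Definition binop a b x f v := a x * f v + b x * f (v - x).

Definition wconv a b l f := foldr (binop a b) f l.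

Definition conv := wconv (fun=> 1) (fun=> 1).

Definition delta v : R := (v == 0)%:R.

Lemma wconv_cons a b x l f : wconv a b (x :: l) f = binop a b x (wconv a b l f).
Proof. by []. Qed.

Lemma wconv_cat a b l1 l2 f :
  wconv a b (l1 ++ l2) f = wconv a b l1 (wconv a b l2 f).
Proof. by rewrite /wconv foldr_cat. Qed.

Lemma binopC a b x y f : binop a b x (binop a b y f) = binop a b y (binop a b x f).
Proof.
apply/funext => v; rewrite /binop.
have -> : v - y - x = v - x - y by rewrite -!addrA [- y - x]addrC.
by ring.
Qed.

Lemma binop_wconv a b x l f :
  binop a b x (wconv a b l f) = wconv a b l (binop a b x f).
Proof. by elim: l => //= y l IH; rewrite binopC IH. Qed.

Lemma wconvC a b l1 l2 f :
  wconv a b l1 (wconv a b l2 f) = wconv a b l2 (wconv a b l1 f).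
Proof. by elim: l1 => //= x l1 ->; rewrite binop_wconv. Qed.

Lemma wconv_perm a b l1 l2 f : perm_eq l1 l2 -> wconv a b l1 f = wconv a b l2 f.
Proof.
move=> p; symmetry; pose P l := wconv a b l f = wconv a b l1 f.
rewrite -/(P l2); apply: (catCA_perm_ind _ p); last by [].
by move=> s1 s2 s3; rewrite /P !wconv_cat wconvC.
Qed.

Lemma conv_perm l1 l2 f : perm_eq l1 l2 -> conv l1 f = conv l2 f.
Proof. exact: wconv_perm. Qed.

Lemma conv_cons x l f v : conv (x :: l) f v = conv l f v + conv l f (v - x).
Proof. by rewrite /conv wconv_cons /binop !mul1r. Qed.

(** A linear substitution in the monomials of a product acts on its factors; both symmetries of the
    generating function are transported through this. *)
Lemma conv_map (phi : {additive G -> G}) (psi : G -> G) l f :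
  cancel psi phi -> conv (map psi l) (f \o phi) = conv l f \o phi.
Proof.
move=> psiK; elim: l => //= x l ->.
by apply/funext => v; rewrite /binop /= raddfB psiK.
Qed.

End WeightedConvolution.

(** Expanding the product amounts to choosing the set of factors from which the monomial is taken;
    the induction splits the subsets of [x :: r] by whether they contain [x]. *)
Lemma conv_subsets (R : comNzRingType) (G : zmodType) (T : finType)
    (g : T -> G) (r : seq T) (f : G -> R) (v : G) : uniq r ->
  conv (map g r) f v
  = \sum_(B : {set T} | B \subset r) f (v - \sum_(i in B) g i).
Proof.
elim: r v => [|x r IH] v /=.
  move=> _; rewrite (big_pred1 finset.set0); last first.
    move=> B; rewrite /= -finset.subset0; by apply: eq_subset_r => y; rewrite !inE.
  by rewrite finset.big_set0 subr0.
case/andP=> xr ur; rewrite /binop !mul1r !IH//.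
rewrite [RHS](bigID (fun B : {set T} => x \notin B)) /=; congr +%R.
  apply: eq_bigl => B; apply/idP/andP.
    move=> sB; split; last by apply: contra xr => /(fintype.subsetP sB).
    by apply: (fintype.subset_trans sB); apply/fintype.subsetP => y yr; rewrite inE yr orbT.
  case=> sB xB; apply/fintype.subsetP => y yB; have := fintype.subsetP sB _ yB.
  by rewrite inE => /orP[/eqP yx|//]; rewrite yx (negbTE xB) in yB.
(* Subsets containing [x] correspond to subsets of [r] through adding and removing [x]. *)
symmetry; rewrite (reindex_onto (fun B => x |: B) (fun B => B :\ x)) /=; last first.
  by move=> B; rewrite negbK => /andP[_ xB]; rewrite finset.setD1K.
apply: eq_big => B.
  rewrite negbK setU11 andbT; apply/andP/idP.
    case=> /fintype.subsetP sB /eqP BE; apply/fintype.subsetP => y yB.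
    have xB : x \notin B by rewrite -BE !inE eqxx.
    have := sB y; rewrite !inE yB orbT => /(_ isT) /orP[/eqP yx|//].
    by rewrite -yx yB in xB.
  move=> /fintype.subsetP sB; have xB : x \notin B by apply: contra xr => /sB.
  split; last by rewrite finset.setU1K.
  apply/fintype.subsetP => y; rewrite !inE => /orP[->//|/sB ->]; exact: orbT.
rewrite negbK => /andP[/andP[/fintype.subsetP sB _] /eqP BE].
have xB : x \notin B by rewrite -BE !inE eqxx.
by rewrite big_setU1//= opprD addrA.
Qed.

Lemma eqn_mod_period (N T r s : nat) : (1 <= r <= N)%N -> (1 <= s <= N)%N ->
  (N * T + r == s %[mod N])%N = (r == s).
Proof.
move=> hr hs; rewrite [(N * T)%N]mulnC modnMDl.
have [->|rs] := eqVneq r s; first by rewrite eqxx.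
apply/negbTE; apply: contra rs.
wlog : r s hr hs / (r <= s)%N.
  move=> H; case/orP: (leq_total r s) => h; first exact: H.
  by rewrite eq_sym [r == s]eq_sym; exact: H.
move=> rs; rewrite eq_sym eqn_mod_dvd// => /dvdnP[k hk]; apply/eqP.
by case: k hk => [|k]; lia.
Qed.

(** * Parts as lattice vectors and the two symmetries of their multiset *)

Section Parts.
Variables (N alpha beta : nat).

Definition eps (m : nat) : int :=
  ((m == alpha %[mod N])%N : nat)%:Z - ((m == beta %[mod N])%N : nat)%:Z.

(** The part [m] becomes the vector (size, contribution to the parity difference), so a partition is
    a sum of distinct vectors and both statistics are read off one convolution. *)
Definition parts (M : nat) : seq (int * int)%type :=
  [seq (m%:Z, eps m) | m <- iota 1 M].

Lemma partsD M k :
  parts (M + k) = parts M ++ [seq (m%:Z, eps m) | m <- iota (1 + M) k].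
Proof. by rewrite /parts iotaD map_cat. Qed.

Hypotheses (hN : (1 < N)%N) (ha : (1 <= alpha <= N)%N) (hb : (1 <= beta <= N)%N).
Hypothesis hneq : alpha <> beta.

Definition block (T : nat) : seq (int * int)%type :=
  [seq (m%:Z, eps m) | m <- iota (1 + T) N].

(** [N] consecutive parts meet each residue class once; only two of them move under the maps below,
    which fix every vector with second coordinate 0. The symmetries are therefore checked block by
    block. *)
Lemma block_split (J : nat) : exists2 rest : seq (int * int)%type,
  perm_eq (block (N * J))
    [:: ((N * J + alpha)%N%:Z, 1%:Z), ((N * J + beta)%N%:Z, -1) & rest]
  & all (fun x => x.2 == 0) rest.
Proof.
pose rest := [seq r <- iota 1 N | (r != alpha) && (r != beta)].
have pr : perm_eq (iota 1 N) [:: alpha, beta & rest].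
  apply: uniq_perm; first exact: iota_uniq.
    rewrite /= !inE !mem_filter !eqxx /= andbF filter_uniq ?iota_uniq// !andbT orbF.
    exact/eqP.
  move=> r; rewrite !inE mem_filter mem_iota.
  have [->|] := eqVneq r alpha; first by lia.
  by have [->|] := eqVneq r beta; first by lia.
exists [seq ((N * J + r)%N%:Z, eps (N * J + r)%N) | r <- rest].
  have -> : block (N * J) = [seq ((N * J + r)%N%:Z, eps (N * J + r)%N) | r <- iota 1 N].
    by rewrite /block addnC iotaDl -map_comp.
  have := perm_map (fun r => ((N * J + r)%N%:Z, eps (N * J + r)%N)) pr.
  rewrite /= /eps !eqn_mod_period// !eqxx.
  have /eqP/negbTE ab := hneq; rewrite ab eq_sym ab /=.
  by rewrite subr0 sub0r.
rewrite all_map; apply/allP => r; rewrite mem_filter mem_iota /= => /andP[/andP[ra rb] hr].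
by rewrite /eps !eqn_mod_period ?(negbTE ra) ?(negbTE rb)//; lia.
Qed.

Definition reflect (x : int * int) : int * int :=
  (x.1 + (beta%:Z - alpha%:Z) * x.2, - x.2).

(** In each block the map exchanges the part of class [alpha] with the part of class [beta] and
    fixes all others. The cutoff has to be a multiple of [N] for the blocks to be complete. *)
Lemma parts_reflect (J : nat) :
  perm_eq (map reflect (parts (N * J))) (parts (N * J)).
Proof.
elim: J => [|J IH]; first by rewrite muln0.
rewrite mulnSr partsD map_cat; apply: perm_cat => //.
have [rest pr /allP hr] := block_split J.
rewrite -/(block (N * J)); have := perm_map reflect pr.
rewrite /= (_ : map reflect rest = rest) => [p|]; last first.
  rewrite -[RHS]map_id; apply/seq.eq_in_map => -[w e] /hr /= /eqP ->.
  by rewrite /reflect /= mulr0 addr0 oppr0.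
apply: (perm_trans p); rewrite perm_sym; apply: (perm_trans pr).
rewrite /reflect /= mulr1 mulrN1 opprK.
have -> : (N * J + alpha)%:Z + (beta%:Z - alpha%:Z) = (N * J + beta)%:Z by lia.
have -> : (N * J + beta)%:Z - (beta%:Z - alpha%:Z) = (N * J + alpha)%:Z by lia.
by rewrite (perm_catCA [:: _] [:: _] rest).
Qed.

Definition shear (x : int * int) : int * int := (x.1 + N%:Z * x.2, x.2).

(* Encodes [F(z q^N) (1 + z q^alpha) (1 + z^-1 q^((J-1)N+beta))
   = F(z) (1 + z q^(JN+alpha)) (1 + z^-1 q^(beta-N))], where F is the
   generating function of the parts up to NJ. *)
Lemma parts_shear (J : nat) :
  perm_eq [:: (alpha%:Z, 1%:Z), ((N * J + beta)%:Z - N%:Z, -1)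
            & map shear (parts (N * J))]
          [:: ((N * J + alpha)%:Z, 1%:Z), (beta%:Z - N%:Z, -1) & parts (N * J)].
Proof.
elim: J => [|J IH]; first by rewrite muln0 !add0n.
rewrite mulnSr partsD map_cat -/(block (N * J)).
have [rest pr /allP hr] := block_split J.
have ps := perm_map shear pr.
have {}ps : perm_eq (map shear (block (N * J)))
    [:: ((N * J + N + alpha)%:Z, 1%:Z), ((N * J + beta)%:Z - N%:Z, -1) & rest].
  apply: (perm_trans ps); rewrite /= (_ : map shear rest = rest); last first.
    rewrite -[RHS]map_id; apply/seq.eq_in_map => -[w e] /hr /= /eqP ->.
    by rewrite /shear /= mulr0 addr0.
  rewrite /shear /= mulr1 mulrN1.
  have -> : (N * J + alpha)%:Z + N%:Z = (N * J + N + alpha)%:Z by lia.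
  exact: perm_refl.
(* Multiset equality is tested by counting any predicate, so the induction hypothesis and the two
   descriptions of the new block combine by linear arithmetic. *)
apply/seq.permP => P; move/seq.permP/(_ P): IH; move/seq.permP/(_ P): pr.
move/seq.permP/(_ P): ps; rewrite /= !count_cat.
have -> : (N * J + N + beta)%:Z - N%:Z = (N * J + beta)%:Z by lia.
lia.
Qed.

End Parts.

Lemma conv_lt0 (R : comNzRingType) (l : seq (int * int)%type) (v : int * int) :
  all (fun x => 0 <= x.1) l -> v.1 < 0 -> conv l (@delta R _) v = 0.
Proof.
elim: l v => [|x l IH] v /=.
  by move=> _ hv; rewrite /delta; case: eqP => // v0; rewrite v0 in hv.
by case/andP=> hx hl hv; rewrite /binop !IH// ?mulr0 ?addr0//=; lia.
Qed.

Lemma conv_cat_gt (R : comNzRingType) (l1 l2 : seq (int * int)%type) (v : int * int) :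
  all (fun x => 0 <= x.1) l1 -> all (fun x => 0 <= x.1) l2 ->
  all (fun x => v.1 < x.1) l2 ->
  conv (l1 ++ l2) (@delta R _) v = conv l1 (@delta R _) v.
Proof.
move=> h1 h2 h3; rewrite (conv_perm _ _ _ (permEl (perm_catC l1 l2))).
elim: l2 h2 h3 => // x l2 IH /andP[x0 h2] /andP[xv h3].
rewrite cat_cons conv_cons IH// [X in _ + X]conv_lt0; last by rewrite /= subr_lt0.
  by rewrite addr0.
by rewrite all_cat; apply/andP.
Qed.

(** * Coefficients of the generating function and their exact identities *)

Section Coefficients.
Context {R : comNzRingType}.
Variables (N alpha beta : nat).
Hypotheses (hN : (1 < N)%N) (ha : (1 <= alpha <= N)%N) (hb : (1 <= beta <= N)%N).
Hypothesis hneq : alpha <> beta.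

Lemma parts_ge0 M : all (fun x => 0 <= x.1) (parts N alpha beta M).
Proof. by apply/allP => x /mapP[m _ ->]. Qed.

Definition coef M (v : int * int) : R := conv (parts N alpha beta M) (@delta R _) v.

Lemma coef_lt0 M v : v.1 < 0 -> coef M v = 0.
Proof. by apply: conv_lt0; exact: parts_ge0. Qed.

(** Parts larger than the size cannot occur. This links the cutoff [n] of the counting problem with
    the multiples of [N] at which the symmetries hold. *)
Lemma coef_stable M k v : v.1 <= M%:Z -> coef (M + k) v = coef M v.
Proof.
move=> hv; rewrite /coef partsD conv_cat_gt//; first exact: parts_ge0.
  by apply/allP => x /mapP[m _ ->].
apply/allP => x /mapP[m + ->] /=; rewrite mem_iota => /andP[h _].
by apply: (le_lt_trans hv); rewrite ltz_nat.
Qed.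

Let reflect_additive : zmod_morphism (reflect alpha beta).
Proof. by move=> [x1 x2] [y1 y2]; congr pair => /=; ring. Qed.
HB.instance Definition _ :=
  GRing.isZmodMorphism.Build _ _ (reflect alpha beta) reflect_additive.

Lemma coef_reflect J (m c : int) :
  coef (N * J) (m, - c) = coef (N * J) (m - (beta%:Z - alpha%:Z) * c, c).
Proof.
have K : cancel (reflect alpha beta) (reflect alpha beta).
  by move=> [w e]; congr pair => /=; ring.
have E := conv_map (R := R) (reflect alpha beta) _ (parts N alpha beta (N * J)) (@delta R _) K.
have P := conv_perm (R := R) _ _ (@delta R _) (parts_reflect _ _ _ hN ha hb hneq J).
have D : @delta R _ \o reflect alpha beta = @delta R _.
  apply/funext => v; rewrite /delta /=; congr (nat_of_bool _)%:R.
  by rewrite -(inj_eq (can_inj K)) raddf0 K.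
rewrite D P in E.
have := congr1 (fun f => f (m, - c)) E; rewrite /= /reflect /= opprK.
by rewrite /coef mulrN => ->.
Qed.

Let unshear (x : int * int) : int * int := (x.1 - N%:Z * x.2, x.2).
Let unshear_additive : zmod_morphism unshear.
Proof. by move=> [x1 x2] [y1 y2]; congr pair => /=; ring. Qed.
HB.instance Definition _ :=
  GRing.isZmodMorphism.Build _ _ unshear unshear_additive.

Lemma coef_recurrence J (m c : int) : 0 <= c -> m <= (N * J)%:Z - N%:Z ->
  coef (N * J) (m - N%:Z * c, c)
    + coef (N * J) (m - alpha%:Z - N%:Z * (c - 1), c - 1)
  = coef (N * J) (m, c) + coef (N * J) (m + N%:Z - beta%:Z, c + 1).
Proof.
move=> c0 hm.
have K : cancel (shear N) unshear by move=> [w e]; congr pair => /=; ring.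
have K' : cancel unshear (shear N) by move=> [w e]; congr pair => /=; ring.
have E := conv_map (R := R) unshear _ (parts N alpha beta (N * J)) (@delta R _) K.
have D : @delta R _ \o unshear = @delta R _.
  apply/funext => v; rewrite /delta /=; congr (nat_of_bool _)%:R.
  apply/eqP/eqP => [h|->]; last by rewrite raddf0.
  by rewrite -[v]K' h; congr pair; rewrite /= mulr0 addr0.
rewrite D in E.
have P := conv_perm (R := R) _ _ (@delta R _) (parts_shear _ _ _ hN ha hb hneq J).
set F := conv (parts N alpha beta (N * J)) (@delta R _) in E P.
(* [parts_shear] has two extra factors on each side, hence four terms on each side. The four terms
   that use a boundary part [B] or [D'] have negative size, by the bound on [m] and [0 <= c], and
   vanish. *)
pose B : int := (N * J + beta)%:Z - N%:Z; pose D' : int := (N * J + alpha)%:Z.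
have H : F (m - N%:Z * c, c) + F (m - B - N%:Z * (c - -1), c - -1)
   + (F (m - alpha%:Z - N%:Z * (c - 1), c - 1)
      + F (m - alpha%:Z - B - N%:Z * (c - 1 - -1), c - 1 - -1))
  = F (m, c) + F (m - (beta%:Z - N%:Z), c - -1)
    + (F (m - D', c - 1) + F (m - D' - (beta%:Z - N%:Z), c - 1 - -1)).
  have := congr1 (fun f => f (m, c)) P.
  by rewrite !conv_cons E.
rewrite !opprK subrK in H.
have y0 : 0 <= N%:Z * c by rewrite mulr_ge0.
have Z (u v : int) : u < 0 -> F (u, v) = 0.
  by move=> u0; apply: (coef_lt0 (N * J) (u, v)).
rewrite mulrDr mulr1 (Z (m - B - _) (c + 1)) in H; last by rewrite /B; lia.
rewrite (Z (m - alpha%:Z - B - _) c) in H; last by rewrite /B; lia.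
rewrite (Z (m - D') (c - 1)) in H; last by rewrite /D'; lia.
rewrite (Z (m - D' - _) c) in H; last by rewrite /D'; lia.
rewrite !addr0 in H; rewrite /coef -/F H; congr (_ + F _).
by rewrite opprB addrA.
Qed.

Lemma pd_sum (n : nat) (B : {set 'I_n.+1}) :
  pd alpha beta N B = \sum_(i in B) eps N alpha beta i.
Proof.
have E r : (parts_congr N r B)%:Z
    = \sum_(i in B) (((i : nat) == r %[mod N])%N : nat)%:Z.
  rewrite /parts_congr -sum1_card -natz natr_sum big_mkcond [RHS]big_mkcond.
  by apply: eq_bigr => i _; rewrite inE; case: (i \in B) => //; case: eqP.
by rewrite /pd !E -sumrB.
Qed.

(** A distinct partition is a subset of the parts, and [conv_subsets] collects those with the
    prescribed size and parity difference. *)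
Lemma card_pd (n : nat) (c : int) :
  #|[set l in distinct_partitions n | pd alpha beta N l == c]%SET|%:R
  = coef n (n%:Z, c).
Proof.
rewrite /coef; pose g (i : 'I_n.+1) := ((i : nat)%:Z, eps N alpha beta i).
(* [lift ord0] lists the nonzero elements of ['I_n.+1], which are the admissible parts. *)
have -> : parts N alpha beta n = map g [seq lift ord0 i | i <- enum 'I_n].
  rewrite /parts -[in LHS](addn0 1%N) iotaDl -val_enum_ord -!map_comp.
  by apply/seq.eq_in_map => i _ /=.
rewrite conv_subsets; last by rewrite map_inj_uniq ?enum_uniq//; exact: lift_inj.
rewrite -sum1_card natr_sum big_mkcond [RHS]big_mkcond; apply: eq_bigr => B _.
have -> : (B \subset [seq lift ord0 i | i <- enum 'I_n]) = (ord0 \notin B).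
  apply/fintype.subsetP/idP => [sB|B0 i iB].
    by apply/negP => /sB /mapP[i _ /eqP]; rewrite (negbTE (neq_lift _ _)).
  case: (unliftP ord0 i) => [j ->|i0]; first by apply/mapP; exists j; rewrite ?mem_enum.
  by move: B0; rewrite -i0 iB.
have -> : \sum_(i in B) g i = ((\sum_(i in B) (i : nat))%N%:Z, pd alpha beta N B).
  rewrite pd_sum (big_morph Posz PoszD (erefl 0%:Z)).
  by apply: (big_rec3 (fun x y z => x = (y, z))) => // i x y z _ ->.
rewrite !inE /delta; case: (ord0 \notin B) => //=.
have -> : ((n%:Z, c) - ((\sum_(i in B) (i : nat))%N%:Z, pd alpha beta N B) == 0)
  = ((\sum_(i in B) (i : nat))%N == n) && (pd alpha beta N B == c).
  rewrite subr_eq0 [LHS]xpair_eqE eqz_nat eq_sym; congr andb; exact: eq_sym.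
by case: andb.
Qed.

End Coefficients.

Section PartsMass.
Context {R : realType} (N alpha beta : nat).
Hypotheses (hN : (1 < N)%N) (ha : (1 <= alpha <= N)%N) (hb : (1 <= beta <= N)%N).
Hypothesis hneq : alpha <> beta.

Lemma pb_coef (n c : nat) :
  (pb alpha beta N n c)%:~R
  = coef N alpha beta n (n%:Z, c%:Z) - coef N alpha beta n (n%:Z, - c%:Z) :> R.
Proof.
have E : [set l in distinct_partitions n | pd beta alpha N l == c%:Z]%SET
  = [set l in distinct_partitions n | pd alpha beta N l == - c%:Z]%SET.
  by apply/setP => l; rewrite !inE; congr andb; rewrite -[RHS]eqr_oppLR /pd opprB.
by rewrite /pb E rmorphB /= -!card_pd.
Qed.

(** Each part is at least 1 and changes the parity difference by at most 1. *)
Lemma pd_bound (n : nat) (l : {set 'I_n.+1}) :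
  l \in distinct_partitions n -> `|pd alpha beta N l| <= n%:Z.
Proof.
rewrite inE => /andP[l0 /eqP ln]; rewrite pd_sum -[in leRHS]ln.
rewrite (big_morph Posz PoszD (erefl 0%:Z)).
apply: le_trans (ler_norm_sum _ _ _) _; apply: ler_sum => i il.
have i0 : (0 < i)%N.
  by rewrite lt0n; apply: contra l0 => /eqP i0; rewrite (_ : ord0 = i)//; exact/val_inj.
by rewrite /eps; case: (_ == _ %[mod _])%N; case: (_ == _ %[mod _])%N => /=; lia.
Qed.

Lemma dcountE (n : nat) : (dcount alpha beta N (0 : R) n)%:R
  = \sum_(0 <= c < n.+1) coef N alpha beta n (n%:Z, c%:Z) :> R.
Proof.
rewrite /dcount -sum1_card natr_sum big_mkord.
rewrite (eq_bigr (fun c : 'I_n.+1 =>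
  \sum_(l in distinct_partitions n | pd alpha beta N l == (c : nat)%:Z) 1)); last first.
  move=> c _; rewrite -card_pd -sum1_card natr_sum.
  by apply: eq_bigl => l; rewrite inE.
rewrite (exchange_big_dep (mem (distinct_partitions n))) /=; last by move=> c l _ /andP[].
rewrite [RHS](bigID (fun l => 0 <= pd alpha beta N l)) /= [X in _ + X]big1 ?addr0; last first.
  move=> l /andP[_ l0]; apply: big1 => c /andP[_ /eqP lc].
  by move: l0; rewrite lc.
apply: eq_big => l; first by rewrite inE ler0z.
rewrite inE ler0z => /andP[ln l0].
have := pd_bound _ _ ln; rewrite ger0_norm//.
case: (pd alpha beta N l) l0 => // k _; rewrite lez_nat => kn.
by rewrite (big_pred1 (Ordinal (n := n.+1) kn))// => c; rewrite ln /= eqz_nat eq_sym.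
Qed.

End PartsMass.

(** * Elementary trigonometric inequalities *)

Section TrigBounds.
Context {R : realType}.
Implicit Types x y : R.

Lemma ge0_of_derive (f df : R -> R) x : (forall y, is_derive y 1 f (df y)) ->
  (forall y, 0 <= y -> 0 <= df y) -> 0 <= x -> f 0 <= f x.
Proof.
move=> fd df0 x0.
have fc : {within `[0, x], continuous f}.
  apply: continuous_subspaceT => y; apply/differentiable_continuous/derivable1_diffP.
  exact: ex_derive.
have [c] := MVT_segment x0 (fun y _ => fd y) fc.
rewrite in_itv /= => /andP[c0 _] /eqP; rewrite subr_eq => /eqP ->.
by rewrite lerDr mulr_ge0 ?df0// subr0.
Qed.

Lemma sin_le x : 0 <= x -> sin x <= x.
Proof.
move=> x0; rewrite -subr_ge0.
have -> : 0 = (0 : R) - sin 0 by rewrite sin0 subrr.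
apply: (ge0_of_derive (fun x => x - sin x) (fun x => 1 - cos x)) => //.
Qed.

Lemma cos_ge x : 1 - x ^+ 2 / 2 <= cos x.
Proof.
wlog x0 : x / 0 <= x.
  by move=> H; case: (leP 0 x) => [/H//|xn]; rewrite -cosN -sqrrN H// oppr_ge0 ltW.
rewrite -subr_ge0.
have -> : (0 : R) = cos 0 - (1 - 0 ^+ 2 / 2) by rewrite cos0 expr0n /= mul0r subr0 subrr.
apply: (ge0_of_derive (fun x => cos x - (1 - x ^+ 2 / 2)) (fun x => x - sin x)) => //.
  move=> y; apply: is_derive_eq; rewrite /GRing.scale /=; by field.
by move=> y y0; rewrite subr_ge0; exact: sin_le.
Qed.

Lemma sin_ge x : 0 <= x -> x - x ^+ 3 / 6 <= sin x.
Proof.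
move=> x0; rewrite -subr_ge0.
have -> : (0 : R) = sin 0 - (0 - 0 ^+ 3 / 6) by rewrite sin0 expr0n /= mul0r !subr0.
apply: (ge0_of_derive (fun x => sin x - (x - x ^+ 3 / 6)) (fun x => cos x - (1 - x ^+ 2 / 2))) => //.
  move=> y; apply: is_derive_eq; rewrite /GRing.scale /=; by field.
by move=> y y0; rewrite subr_ge0; exact: cos_ge.
Qed.

Lemma cos_le x : 0 <= x -> cos x <= 1 - x ^+ 2 / 2 + x ^+ 3 / 6.
Proof.
have cub y : 0 <= y -> 0 <= y ^+ 2 / 2 - y + sin y.
  move=> y0; have -> : (0 : R) = 0 ^+ 2 / 2 - 0 + sin 0.
    by rewrite sin0 expr0n /= mul0r subr0 addr0.
  apply: (ge0_of_derive (fun x => x ^+ 2 / 2 - x + sin x) (fun x => x - 1 + cos x)) => //.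
    move=> z; apply: is_derive_eq; rewrite /GRing.scale /=; by field.
  move=> z z0; have -> : 0 = (0 : R) - 1 + cos 0 by rewrite cos0; ring.
  apply: (ge0_of_derive (fun x => x - 1 + cos x) (fun x => 1 - sin x)) => //.
  by move=> u; apply: is_derive_eq; rewrite /GRing.scale /=; ring.
move=> x0; rewrite -subr_ge0.
have -> : (0 : R) = 1 - 0 ^+ 2 / 2 + 0 ^+ 3 / 6 - cos 0.
  by rewrite cos0 !expr0n /= !mul0r subr0 addr0 subrr.
apply: (ge0_of_derive (fun x => 1 - x ^+ 2 / 2 + x ^+ 3 / 6 - cos x)
  (fun x => x ^+ 2 / 2 - x + sin x)) => //.
move=> y; apply: is_derive_eq; rewrite /GRing.scale /=; by field.
Qed.

Lemma sin_taylor x : `|sin x - x| <= `|x| ^+ 3.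
Proof.
wlog x0 : x / 0 <= x.
  move=> H; case: (leP 0 x) => [/H//|xn]; have := H (- x).
  by rewrite sinN normrN -opprD normrN; apply; rewrite oppr_ge0 ltW.
rewrite (ger0_norm x0) ler_norml; have := sin_le x x0; have := sin_ge x x0.
have : 0 <= x ^+ 3 by rewrite exprn_ge0.
by lra.
Qed.

Lemma cos_taylor x : `|cos x - (1 - x ^+ 2 / 2)| <= `|x| ^+ 3.
Proof.
wlog x0 : x / 0 <= x.
  move=> H; case: (leP 0 x) => [/H//|xn]; have := H (- x).
  by rewrite cosN sqrrN normrN; apply; rewrite oppr_ge0 ltW.
rewrite (ger0_norm x0) ler_norml; have := cos_ge x; have := cos_le x x0.
have : 0 <= x ^+ 3 by rewrite exprn_ge0.
by lra.
Qed.

(** The versine, equal to [|cis x - 1| ^ 2 / 2]; it measures the distance of an angle to the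
    multiples of [2 pi]. *)
Definition vers x : R := 1 - cos x.

Lemma vers_ge0 x : 0 <= vers x.
Proof. by rewrite subr_ge0 cos_le1. Qed.

Lemma versN x : vers (- x) = vers x.
Proof. by rewrite /vers cosN. Qed.

Lemma vers_le x : vers x <= x ^+ 2 / 2.
Proof. by have := cos_ge x; rewrite /vers; lra. Qed.

Lemma vers_half x : vers x = 2 * sin (x / 2) ^+ 2.
Proof.
have E : x = (x / 2) *+ 2 by rewrite mulr2n -splitr.
rewrite /vers [in LHS]E cos_mulr2n sin2cos2 mulr2n; ring.
Qed.

(** [vers x = 2 sin (x / 2) ^ 2], and [sin y >= y / 3] for [0 <= y <= 2], which covers [y = x / 2]
    because [pi / 2 < 2]. *)
Lemma vers_ge x : `|x| <= pi -> x ^+ 2 / 18 <= vers x.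
Proof.
move=> xpi; wlog x0 : x xpi / 0 <= x.
  move=> H; case: (leP 0 x) => [/H->//|xn]; rewrite -versN -sqrrN H ?normrN//.
  by rewrite oppr_ge0 ltW.
rewrite (ger0_norm x0) in xpi.
have h0 : 0 <= x / 2 by rewrite divr_ge0.
have h2 : x / 2 <= 2 by have := @pihalf_lt2 R; lra.
have := sin_ge _ h0; rewrite vers_half; set y := x / 2 => sy.
have -> : x = 2 * y by rewrite /y; field.
have : y / 3 <= sin y by apply: le_trans sy; rewrite -/y in h0 h2; nra.
rewrite -/y in h0; nra.
Qed.

Lemma versD x y : vers (x + y) <= 2 * vers x + 2 * vers y.
Proof.
rewrite /vers cosD.
have := cos2Dsin2 x; have := cos2Dsin2 y.
set a := cos x; set b := sin x; set c := cos y; set d := sin y => h1 h2.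
(* Parallelogram law for [cis x - 1] and [cis (- y) - 1]: the square displayed is that of their
   sum. *)
have : 0 <= (a + c - 2) ^+ 2 + (b - d) ^+ 2 by rewrite addr_ge0 ?sqr_ge0.
nra.
Qed.

Lemma versB x y : vers (x - y) <= 2 * vers x + 2 * vers y.
Proof. by rewrite -[vers y]versN; exact: versD. Qed.

Lemma cosD2pi_nat x (n : nat) : cos (x + pi *+ 2 *+ n) = cos x.
Proof. by rewrite (periodicn (@cosD2pi R)). Qed.

Lemma cosD2pi_int x (k : int) : cos (x + 2 * pi * k%:~R) = cos x.
Proof.
have E (n : nat) : 2 * pi * n%:R = pi *+ 2 *+ n :> R by rewrite mulr_natr mulr_natl.
case: k => n; first by rewrite -pmulrn E cosD2pi_nat.
rewrite NegzE mulrNz mulrN -pmulrn E -[LHS](cosD2pi_nat _ n.+1).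
by rewrite subrK.
Qed.
End TrigBounds.

Local Notation normc := ComplexField.Normc.normc.

(** * Complex exponentials and Bernoulli characteristic functions *)

Section Cis.
Context {R : realType}.
Implicit Types (x y p : R) (z w : R[i]).

Definition cis x : R[i] := (cos x +i* sin x)%C.

Lemma cisD x y : cis (x + y) = cis x * cis y.
Proof. by rewrite /cis cosD sinD [X in (_ +i* X)%C]addrC; simpc; rewrite [sin x * _]mulrC addrC; congr (_ +i* _)%C; ring. Qed.

Lemma cis0 : cis 0 = 1.
Proof. by rewrite /cis cos0 sin0. Qed.

Lemma cis_sum I (r : seq I) (f : I -> R) :
  cis (\sum_(i <- r) f i) = \prod_(i <- r) cis (f i).
Proof. exact: (big_morph cis cisD cis0). Qed.

Lemma normc_cis x : normc (cis x) = 1.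
Proof. by rewrite /= cos2Dsin2 sqrtr1. Qed.

Lemma sqr_normc2 z : normc z ^+ 2 = complex.Re z ^+ 2 + complex.Im z ^+ 2.
Proof. by case: z => a b /=; rewrite sqr_sqrtr ?addr_ge0 ?sqr_ge0. Qed.

Lemma normc_ge0 z : 0 <= normc z.
Proof. by case: z => a b; exact: sqrtr_ge0. Qed.

Lemma normc_sqr_le z x : 0 <= x -> complex.Re z ^+ 2 + complex.Im z ^+ 2 <= x ^+ 2 -> normc z <= x.
Proof. by move=> x0; rewrite -sqr_normc2 ler_pXn2r// nnegrE normc_ge0. Qed.

Lemma Re_le_normc z : `|complex.Re z| <= normc z.
Proof.
rewrite -(ler_pXn2r (n := 2)) ?nnegrE ?normc_ge0// sqr_normc2 real_normK ?num_real//.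
by rewrite lerDl sqr_ge0.
Qed.

Lemma normc_le_add z : normc z <= `|complex.Re z| + `|complex.Im z|.
Proof.
apply: normc_sqr_le; first by rewrite addr_ge0.
by rewrite sqrrD !real_normK ?num_real// lerD2r lerDl mulrn_wge0 ?mulr_ge0.
Qed.

Lemma normc_prod I (r : seq I) (f : I -> R[i]) :
  normc (\prod_(i <- r) f i) = \prod_(i <- r) normc (f i).
Proof.
elim: r => [|i r IH]; first by rewrite !big_nil; exact: ComplexField.Normc.normc1.
by rewrite !big_cons ComplexField.Normc.normcM IH.
Qed.

Lemma normc_real x : normc x%:C%C = `|x|.
Proof. by rewrite /= expr0n addr0 sqrtr_sqr. Qed.

Lemma normc_cis_sub1 x : normc (cis x - 1) <= `|x|.
Proof.
apply: normc_sqr_le => //=; rewrite oppr0 addr0 real_normK ?num_real//.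
have := vers_le x; have := cos2Dsin2 x; rewrite /vers; nra.
Qed.

Lemma normc_cis_taylor x :
  normc (cis x - ((1 - x ^+ 2 / 2) +i* x)%C) <= 2 * `|x| ^+ 3.
Proof.
apply: le_trans (normc_le_add _) _ => /=.
by have := sin_taylor x; have := cos_taylor x; lra.
Qed.

(** The factors are exchanged one at a time; all the others have modulus at most 1. *)
Lemma normc_prod_sub I (r : seq I) (f g : I -> R[i]) :
  (forall i, normc (f i) <= 1) -> (forall i, normc (g i) <= 1) ->
  normc (\prod_(i <- r) f i - \prod_(i <- r) g i) <= \sum_(i <- r) normc (f i - g i).
Proof.
move=> f1 g1; elim: r => [|i r IH].
  by rewrite !big_nil subrr ComplexField.Normc.normc0.
rewrite !big_cons.
set F := \prod_(j <- r) f j; set H := \prod_(j <- r) g j.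
have -> : f i * F - g i * H = (f i - g i) * F + g i * (F - H) by ring.
apply: le_trans (le_normcD _ _) _; rewrite !ComplexField.Normc.normcM lerD//.
  rewrite ler_piMr ?normc_ge0// normc_prod.
  by apply: prodr_ile1 => j; rewrite normc_ge0 f1.
by apply: le_trans IH; rewrite ler_piMl ?normc_ge0.
Qed.

Definition bernoulli_cf p x : R[i] := (1 - p)%:C%C + p%:C%C * cis x.

(** The squared modulus is exactly [1 - 2 p (1 - p) vers x]. *)
Lemma normc_bernoulli_cf p x : 0 <= p <= 1 ->
  normc (bernoulli_cf p x) <= expR (- (p * (1 - p) * vers x)).
Proof.
move=> /andP[p0 p1]; apply: normc_sqr_le; first exact: expR_ge0.
rewrite -expRM_natl.
have -> : complex.Re (bernoulli_cf p x) ^+ 2 + complex.Im (bernoulli_cf p x) ^+ 2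
  = 1 - 2 * (p * (1 - p) * vers x).
  rewrite /bernoulli_cf /cis /vers /=; have := cos2Dsin2 x.
  set c := cos x; set s := sin x => h.
  rewrite !mul0r subr0 !addr0 add0r.
  have -> : (p * s) ^+ 2 = p ^+ 2 * (1 - c ^+ 2) by rewrite exprMn -h; ring.
  ring.
by rewrite mulrN; exact: expR_ge1Dx.
Qed.

(** The centred variable takes the values [- p] and [q = 1 - p]. The quadratic Taylor polynomials at
    [- p x] and [q x], weighted by [q] and [p], add up to a real number, the linear terms
    cancelling. The factor [p] kept in the error makes the sum over all parts controllable. *)
Lemma normc_bernoulli_taylor p x : 0 <= p <= 1 ->
  normc (bernoulli_cf p x * cis (- (p * x)) - (1 - p * (1 - p) * x ^+ 2 / 2)%:C%C)
  <= 2 * (p * `|x| ^+ 3).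
Proof.
move=> /andP[p0 p1]; set q := 1 - p.
have q0 : 0 <= q by rewrite subr_ge0.
have q1 : q <= 1 by rewrite gerBl.
pose T y := cis y - ((1 - y ^+ 2 / 2) +i* y)%C.
have -> : bernoulli_cf p x * cis (- (p * x)) - (1 - p * q * x ^+ 2 / 2)%:C%C
  = q%:C%C * T (- (p * x)) + p%:C%C * T (q * x).
  have E : cis (q * x) = cis x * cis (- (p * x)) by rewrite -cisD /q; congr cis; ring.
  have S : q%:C%C * ((1 - (- (p * x)) ^+ 2 / 2) +i* (- (p * x)))%C
      + p%:C%C * ((1 - (q * x) ^+ 2 / 2) +i* (q * x))%C = (1 - p * q * x ^+ 2 / 2)%:C%C.
    by simpc; congr (_ +i* _)%C; rewrite /q; field.
  by rewrite -S /T E /bernoulli_cf -/q; ring.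
apply: le_trans (le_normcD _ _) _; rewrite !ComplexField.Normc.normcM !normc_real.
rewrite (ger0_norm q0) (ger0_norm p0).
have T3 y : normc (T y) <= 2 * `|y| ^+ 3 := normc_cis_taylor y.
have := T3 (- (p * x)); have := T3 (q * x).
rewrite normrN !normrM (ger0_norm q0) (ger0_norm p0) !exprMn.
set X := `|x| ^+ 3; set U := normc _; set V := normc _.
have X0 : 0 <= X by rewrite exprn_ge0.
move=> hU hV.
have h1 : q * V <= q * (2 * (p ^+ 3 * X)) by rewrite ler_wpM2l.
have h2 : p * U <= p * (2 * (q ^+ 3 * X)) by rewrite ler_wpM2l.
apply: le_trans (lerD h1 h2) _.
have -> : q * (2 * (p ^+ 3 * X)) + p * (2 * (q ^+ 3 * X))
  = 2 * (p * X) * (q * (p ^+ 2 + q ^+ 2)) by ring.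
rewrite -[leRHS]/(2 * (p * X)); rewrite -[leRHS]mulr1 ler_wpM2l ?mulr_ge0//.
rewrite /q; nra.
Qed.
End Cis.

Section ExpBounds.
Context {R : realType}.
Implicit Types x y : R.

Lemma expRN_le y : 0 <= y -> expR (- y) <= 1 - y + y ^+ 2 / 2.
Proof.
move=> y0; rewrite -subr_ge0.
have -> : (0 : R) = 1 - 0 + 0 ^+ 2 / 2 - expR (- 0) by rewrite oppr0 expR0 expr0n /=; lra.
apply: (ge0_of_derive (fun y => 1 - y + y ^+ 2 / 2 - expR (- y))
  (fun y => expR (- y) - (1 - y))) => //.
  move=> z; apply: is_derive_eq; rewrite /GRing.scale /=; by field.
by move=> z _; have := expR_ge1Dx (- z); lra.
Qed.

Lemma expRN2_le y : 0 <= y <= 1 / 2 -> expR (- (2 * y)) <= 1 - y.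
Proof.
move=> /andP[y0 y1]; have h : 0 <= 2 * y by lra.
by have := expRN_le _ h; nra.
Qed.

Lemma expR_ge_pow y (k : nat) : 0 <= y -> y ^+ k / k`!%:R <= expR y.
Proof.
case: k => [|k] y0; first by rewrite expr0 divr1 -expR0 ler_expR.
by apply: le_trans (@expR_ge1Dxn R y k y0); rewrite lerDr.
Qed.

Lemma pow_expRN_le y (k : nat) : 0 <= y -> y ^+ k * expR (- y) <= (k`!)%:R.
Proof.
move=> y0; rewrite expRN ler_pdivrMr ?expR_gt0//.
have := expR_ge_pow y k y0; rewrite ler_pdivrMr ?ltr0n ?fact_gt0// mulrC.
by [].
Qed.
End ExpBounds.

(** * Exact Fourier inversion on a finite grid *)

Section FourierInversion.
Context {R : realType}.
Implicit Types (v x : int * int) (l : seq (int * int)%type) (K : nat) (psi theta : R).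

Definition dotp psi theta v : R := v.1%:~R * psi + v.2%:~R * theta.

Lemma dotpB psi theta v x : dotp psi theta (v - x) = dotp psi theta v - dotp psi theta x.
Proof. by rewrite /dotp /= !rmorphB /=; ring. Qed.

(** An odd number of equally spaced angles, symmetric about 0. Once the grid exceeds the support,
    averaging over it inverts the transform exactly, so finite sums take the place of integrals. *)
Definition angle K (k : nat) : R := 2 * pi * (k%:R - K%:R) / (K.*2.+1)%:R.

Definition cf (p : int * int -> R) l psi theta : R[i] :=
  \prod_(x <- l) bernoulli_cf (p x) (dotp psi theta x).

Definition dft_mean K (F : R -> R -> R) : R :=
  (\sum_(k < K.*2.+1) \sum_(j < K.*2.+1) F (angle K k) (angle K j))
  / (K.*2.+1)%:R ^+ 2.

Lemma dft_meanD K F G : dft_mean K (fun a b => F a b + G a b) = dft_mean K F + dft_mean K G.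
Proof.
rewrite /dft_mean -mulrDl -big_split /=; congr (_ / _).
by apply: eq_bigr => i _; rewrite -big_split.
Qed.

Lemma dft_meanZ K c F : dft_mean K (fun a b => c * F a b) = c * dft_mean K F.
Proof.
rewrite /dft_mean mulrA mulr_sumr; congr (_ / _).
by apply: eq_bigr => i _; rewrite mulr_sumr.
Qed.

Definition dft p l K v : R := dft_mean K (fun psi theta =>
  complex.Re (cis (- dotp psi theta v) * cf p l psi theta)).

Lemma ReD (z w : R[i]) : complex.Re (z + w) = complex.Re z + complex.Re w.
Proof. by case: z w => a b [c d]. Qed.

Lemma Re_realM (a : R) (w : R[i]) : complex.Re (a%:C%C * w) = a * complex.Re w.
Proof. by case: w => c d /=; rewrite mul0r subr0. Qed.

Lemma dft_cons p x l K v :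
  dft p (x :: l) K v = (1 - p x) * dft p l K v + p x * dft p l K (v - x).
Proof.
rewrite -!dft_meanZ -dft_meanD; congr (dft_mean K _).
apply/funext => psi; apply/funext => theta.
rewrite /cf big_cons; set P := \prod_(y <- l) _.
have -> : cis (- dotp psi theta (v - x)) = cis (dotp psi theta x) * cis (- dotp psi theta v).
  by rewrite dotpB opprB cisD.
rewrite -!Re_realM -ReD; congr complex.Re; rewrite /bernoulli_cf; ring.
Qed.

Lemma cis_expr (a : R) n : cis a ^+ n = cis (a * n%:R).
Proof.
elim: n => [|n IH]; first by rewrite expr0 mulr0 cis0.
by rewrite exprS IH -cisD -addn1 natrD; congr cis; ring.
Qed.

(** A geometric sum over the powers of a root of unity, which differs from 1 when
    [0 < |u| < 2 K + 1]. *)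
Lemma sum_cis_angle K (u : int) : `|u| < (K.*2.+1)%:Z ->
  \sum_(k < K.*2.+1) cis (u%:~R * angle K k) = if u == 0 then (K.*2.+1)%:R else 0 :> R[i].
Proof.
set M := K.*2.+1 => uM; case: eqP => [->|/eqP u0].
  under eq_bigr do rewrite mul0r cis0.
  by rewrite sumr_const card_ord.
have M0 : M%:R != 0 :> R by rewrite pnatr_eq0.
pose h : R := 2 * pi * u%:~R / M%:R.
have E (k : nat) : cis (u%:~R * angle K k) = cis (- (h * K%:R)) * cis h ^+ k.
  rewrite cis_expr -cisD /angle -/M /h; congr cis; by field.
under eq_bigr do rewrite E.
rewrite -mulr_sumr; apply/eqP; rewrite mulf_eq0; apply/orP; right.
have hM : cis h ^+ M = 1.
  rewrite cis_expr /h divfK// /cis -[2 * _ * _]add0r cosD2pi_int cos0.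
  have -> : sin (0 + 2 * pi * u%:~R) = 0 :> R; last by [].
  by apply: cos1sin0; rewrite cosD2pi_int cos0 normr1.
(* If [cis h = 1] then [sin (h / 2) = 0], but [|h / 2|] lies strictly between 0 and [pi]. *)
have h1 : cis h != 1.
  apply/negP => /eqP /(congr1 (@complex.Re R)) /= ch.
  have : vers h = 0 by rewrite /vers ch subrr.
  rewrite vers_half => /eqP; rewrite mulf_eq0 pnatr_eq0 sqrf_eq0 /=.
  have -> : sin (h / 2) = Num.sg (u%:~R : R) * sin (`|u|%:~R * pi / M%:R).
    rewrite -sin_sg; congr sin; rewrite /h [in LHS](numEsg (u%:~R)).
    by rewrite -intr_norm; field.
  rewrite mulf_eq0 sgr_eq0 intr_eq0 (negbTE u0) /=; apply/negP; rewrite gt_eqF//.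
  apply: sin_gt0_pi; apply/andP; split.
    have um : (0 : R) < `|u|%:~R by rewrite ltr0z normr_gt0.
    by rewrite divr_gt0 ?ltr0n// mulr_gt0// pi_gt0.
  by rewrite ltr_pdivrMr ?ltr0n// mulrC ltr_pM2l ?pi_gt0// pmulrn ltr_int.
have /eqP := subrX1 (cis h) M.
by rewrite hM subrr eq_sym mulf_eq0 subr_eq0 (negbTE h1).
Qed.

Lemma dft_nil p K v : `|v.1| < (K.*2.+1)%:Z -> `|v.2| < (K.*2.+1)%:Z ->
  dft p [::] K v = delta v.
Proof.
move=> h1 h2; set M := K.*2.+1 in h1 h2 *.
have M0 : M%:R != 0 :> R by rewrite pnatr_eq0.
rewrite /dft /dft_mean.
have Re0 : complex.Re (0 : R[i]) = 0 by [].
transitivity (complex.Re ((\sum_(k < M) cis ((- v.1)%:~R * angle K k))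
   * (\sum_(k < M) cis ((- v.2)%:~R * angle K k)) : R[i]) / M%:R ^+ 2).
  congr (_ / _); rewrite big_distrl /= (big_morph _ ReD Re0); apply: eq_bigr => k _.
  rewrite big_distrr /= (big_morph _ ReD Re0); apply: eq_bigr => j _.
  rewrite /cf big_nil mulr1 -cisD /dotp; congr (complex.Re (cis _)).
  by rewrite !rmorphN /=; ring.
rewrite !sum_cis_angle ?normrN// !oppr_eq0.
case: v h1 h2 => v1 v2 /= _ _; rewrite /delta [(_, _) == 0]xpair_eqE.
case: eqP => _; last by rewrite mul0r Re0 mul0r.
case: eqP => _; last by rewrite mulr0 Re0 mul0r.
rewrite -natrM -(rmorph_nat (real_complex R)) natrM -expr2 /=.
by rewrite divff ?expf_neq0.
Qed.

(** Both sides obey the recursion [dft_cons]; the hypotheses keep every translate [v - x] met on the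
    way inside the range where the grid inverts exactly. *)
Lemma wconv_dft p l K v :
  `|v.1| + \sum_(x <- l) `|x.1| < (K.*2.+1)%:Z ->
  `|v.2| + \sum_(x <- l) `|x.2| < (K.*2.+1)%:Z ->
  wconv (fun x => 1 - p x) p l (@delta R _) v = dft p l K v.
Proof.
elim: l v => [|x l IH] v; first by rewrite !big_nil !addr0 => h1 h2; rewrite dft_nil.
rewrite !big_cons => h1 h2; rewrite wconv_cons /binop dft_cons !IH//.
- by apply: le_lt_trans h1; rewrite addrA lerD2r; exact: ler_normB.
- by apply: le_lt_trans h2; rewrite addrA lerD2r; exact: ler_normB.
- by apply: le_lt_trans h1; rewrite lerD2l lerDr.
- by apply: le_lt_trans h2; rewrite lerD2l lerDr.
Qed.

End FourierInversion.

(** * Proportion of grid angles in a short interval *)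

Section GridCounting.
Context {R : realType}.
Implicit Types (r : R) (K : nat).

Lemma natr_doubleS n : (n.*2.+1)%:R = 2 * n%:R + 1 :> R.
Proof. by rewrite -addn1 natrD -muln2 natrM mulrC. Qed.

Lemma angle_le_pi K (k : 'I_K.*2.+1) : `|angle K k : R| <= pi.
Proof.
rewrite /angle normrM normfV (ger0_norm (ler0n R _)) ler_pdivrMr ?ltr0n//.
have pi0 := @pi_gt0 R; rewrite normrM ger0_norm ?mulr_ge0 ?pi_ge0//.
have kK : `|k%:R - K%:R : R| <= K%:R.
  rewrite ler_norml; have := ltn_ord k; rewrite ltnS => kK.
  have h : (k : nat)%:R <= K%:R + K%:R :> R by rewrite -natrD ler_nat addnn.
  by have := ler0n R k; lra.
rewrite natr_doubleS.
by rewrite mulrAC -subr_ge0; nra.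
Qed.

Definition grid_count K r : nat := \sum_(k < K.*2.+1) (`|angle K k| <= r)%R.

Lemma angle_le K (k : nat) r : 0 <= r ->
  (`|angle K k| <= r)
  = (K <= k + Num.trunc (r * (K.*2.+1)%:R / (2 * pi)))%N
    && (k <= K + Num.trunc (r * (K.*2.+1)%:R / (2 * pi)))%N.
Proof.
move=> r0; set y := r * _ / _; set b := Num.trunc y.
have pi0 := @pi_gt0 R.
have M0 : 0 < (K.*2.+1)%:R :> R by rewrite ltr0n.
have y0 : 0 <= y by rewrite divr_ge0 ?mulr_ge0// ltW.
have /andP[b1 b2] := trunc_itv y0.
have -> : (`|angle K k| <= r) = (`|k%:R - K%:R| <= y).
  rewrite /angle normrM normfV (gtr0_norm M0) ler_pdivrMr//.
  by rewrite normrM (gtr0_norm (mulr_gt0 (ltr0Sn R 1) pi0)) /y ler_pdivlMr ?mulr_gt0// mulrC.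
rewrite ler_norml; apply/andP/andP => -[h1 h2]; split.
- rewrite -ltnS -(ltr_nat R) -addn1 !natrD; rewrite -addn1 natrD -/b in b1 b2; lra.
- rewrite -ltnS -(ltr_nat R) -addn1 !natrD; rewrite -addn1 natrD -/b in b1 b2; lra.
- move: h1; rewrite -(ler_nat R) natrD; rewrite -/b in b1 b2 *; lra.
- move: h2; rewrite -(ler_nat R) natrD; rewrite -/b in b1 b2 *; lra.
Qed.

Lemma grid_count_iota K r (b := Num.trunc (r * (K.*2.+1)%:R / (2 * pi))) : 0 <= r ->
  grid_count K r = count (fun k => (K <= k + b) && (k <= K + b))%N (iota 0 K.*2.+1).
Proof.
move=> r0; have -> : iota 0 K.*2.+1 = index_iota 0 K.*2.+1 by rewrite /index_iota subn0.
rewrite /grid_count -sumn_count sumnE big_map.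
by rewrite big_mkord; apply: eq_bigr => k _; rewrite angle_le.
Qed.

Lemma grid_count_le K r : 0 <= r ->
  (grid_count K r)%:R <= r * (K.*2.+1)%:R / pi + 1 :> R.
Proof.
move=> r0; have pi0 := @pi_gt0 R; rewrite grid_count_iota//.
have pin : pi != 0 :> R by rewrite gt_eqF.
set y := r * _ / (2 * pi); set b := Num.trunc y.
have y0 : 0 <= y by rewrite divr_ge0 ?mulr_ge0// ltW.
have /andP[b1 b2] := trunc_itv y0; rewrite -/b in b1 b2.
apply: (@le_trans _ _ (b.*2.+1)%:R).
  rewrite ler_nat -size_filter -[leqRHS](size_iota (K - b)).
  apply: uniq_leq_size; first by rewrite filter_uniq ?iota_uniq.
  by move=> k; rewrite mem_filter !mem_iota; lia.
have -> : r * (K.*2.+1)%:R / pi = 2 * y by rewrite /y; move: pi pin => q q0; field.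
by rewrite natr_doubleS; lra.
Qed.

Lemma grid_count_ge K r : 0 <= r <= pi ->
  r * (K.*2.+1)%:R / pi - 2 <= (grid_count K r)%:R :> R.
Proof.
move=> /andP[r0 rpi]; have pi0 := @pi_gt0 R; rewrite grid_count_iota//.
have pin : pi != 0 :> R by rewrite gt_eqF.
set y := r * _ / (2 * pi); set b := Num.trunc y.
have y0 : 0 <= y by rewrite divr_ge0 ?mulr_ge0// ltW.
have /andP[b1 b2] := trunc_itv y0; rewrite -/b in b1 b2.
have bK : (b <= K)%N.
  rewrite -ltnS -(ltr_nat R); apply: le_lt_trans b1 _.
  apply: (@le_lt_trans _ _ ((K.*2.+1)%:R / 2)).
    rewrite /y ler_pdivrMr ?mulr_gt0// mulrCA mulrA [in leRHS]mulrC.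
    rewrite [leRHS](_ : _ = pi * (K.*2.+1)%:R); last by move: pi => q; field.
    by rewrite ler_wpM2r.
  by rewrite natr_doubleS -[K.+1]addn1 natrD; have := ler0n R K; lra.
apply: (@le_trans _ _ (b.*2.+1)%:R); last first.
  rewrite ler_nat -size_filter -[leqLHS](size_iota (K - b)).
  apply: uniq_leq_size; first exact: iota_uniq.
  by move=> k; rewrite mem_filter !mem_iota; lia.
have -> : r * (K.*2.+1)%:R / pi = 2 * y by rewrite /y; move: pi pin => q q0; field.
by rewrite natr_doubleS; lra.
Qed.

(** The proportion is [r / pi] up to rounding errors of at most [2 / M], where [M] is the grid size;
    [20 <= r M] and [2 <= pi < 4] absorb these. Only the order [r] matters later. *)
Lemma grid_density K r : 0 < r <= pi -> 20 / r <= (K.*2.+1)%:R ->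
  r / 10 <= (grid_count K r)%:R / (K.*2.+1)%:R <= r.
Proof.
move=> /andP[r0 rpi] rK; set M : R := (K.*2.+1)%:R.
have M0 : 0 < M by rewrite ltr0n.
have rM : 20 <= r * M by move: rK; rewrite ler_pdivrMr// mulrC.
have pi2 := @pi_ge2 R; have pi4 : pi < 4 :> R by have := @pihalf_lt2 R; lra.
have pi0 := @pi_gt0 R.
have := grid_count_le K r (ltW r0); have := grid_count_ge K r.
rewrite (ltW r0) rpi => /(_ isT); rewrite -/M => h1 h2.
have i1 : r * M / pi <= r * M / 2 by rewrite ler_pM2l ?mulr_gt0// lef_pV2// posrE.
have i2 : r * M / 4 <= r * M / pi by rewrite ler_pM2l ?mulr_gt0// lef_pV2 ?posrE// ltW.
apply/andP; split.
  by rewrite ler_pdivlMr//; lra.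
by rewrite ler_pdivrMr//; lra.
Qed.

End GridCounting.

(** * From bounds on the transform to bounds on the mass *)

Section MassBounds.
Context {R : realType}.
Implicit Types (v x : int * int) (l : seq (int * int)%type) (K : nat).
Implicit Types (psi theta E : R) (F G : R -> R -> R).

Definition box (r1 r2 : R) psi theta : R := ((`|psi| <= r1) && (`|theta| <= r2))%:R.

Lemma box_ge0 (r1 r2 : R) psi theta : 0 <= box r1 r2 psi theta.
Proof. exact: ler0n. Qed.

Lemma ler_dft_mean K F G :
  (forall psi theta, `|psi| <= pi -> `|theta| <= pi -> F psi theta <= G psi theta) ->
  dft_mean K F <= dft_mean K G.
Proof.
move=> FG; rewrite ler_pM2r ?invr_gt0 ?exprn_gt0 ?ltr0n//.
by apply: ler_sum => k _; apply: ler_sum => j _; apply: FG; exact: angle_le_pi.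
Qed.

Lemma dft_mean_norm K F : `|dft_mean K F| <= dft_mean K (fun a b => `|F a b|).
Proof.
rewrite ler_norml -mulN1r -dft_meanZ; apply/andP; split; apply: ler_dft_mean => a b _ _.
  by rewrite mulN1r lerNl -normrN ler_norm.
exact: ler_norm.
Qed.

Lemma dft_mean_cst K (c : R) : dft_mean K (fun _ _ => c) = c.
Proof.
rewrite /dft_mean !sumr_const card_ord -[_ *+ _ *+ _]mulr_natr -[c *+ _]mulr_natr.
have E m : m != 0 -> c * m * m / m ^+ 2 = c by move=> m0; field.
by rewrite E// pnatr_eq0.
Qed.

Lemma dft_mean_box K (r1 r2 : R) : dft_mean K (box r1 r2)
  = ((grid_count K r1)%:R / (K.*2.+1)%:R) * ((grid_count K r2)%:R / (K.*2.+1)%:R).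
Proof.
have M0 : (K.*2.+1)%:R != 0 :> R by rewrite pnatr_eq0.
rewrite /dft_mean mulf_div -expr2; congr (_ / _).
rewrite /grid_count !natr_sum big_distrl /=; apply: eq_bigr => k _.
rewrite big_distrr /=; apply: eq_bigr => j _.
by rewrite /box -mulnb natrM.
Qed.

Lemma dft_mean_box_le (r1 r2 : R) K : 0 < r1 <= pi -> 0 < r2 <= pi ->
  20 / r1 <= (K.*2.+1)%:R -> 20 / r2 <= (K.*2.+1)%:R ->
  r1 * r2 / 100 <= dft_mean K (box r1 r2) <= r1 * r2.
Proof.
move=> h1 h2 K1 K2; rewrite dft_mean_box.
have /andP[a1 b1] := grid_density K r1 h1 K1.
have /andP[a2 b2] := grid_density K r2 h2 K2.
case/andP: h1 => p1 _; case/andP: h2 => p2 _.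
set X := _ / _ in a1 b1 *; set Y := _ / _ in a2 b2 *.
have X0 : 0 <= X by apply: le_trans a1; lra.
have Y0 : 0 <= Y by apply: le_trans a2; lra.
apply/andP; split; last by rewrite ler_pM.
apply: (@le_trans _ _ ((r1 / 10) * (r2 / 10))); last first.
  by rewrite ler_pM//; lra.
by rewrite le_eqVlt; apply/orP; left; apply/eqP; field.
Qed.

Variables (p : int * int -> R) (l : seq (int * int)%type).
Let P v : R := wconv (fun x => 1 - p x) p l (@delta R _) v.

(** The mass does not depend on the grid, so the grid may be taken as fine as an estimate requires
    and large enough for all the points in question. *)
Lemma exists_grid (vs : seq (int * int)%type) (c : R) : exists K : nat,
  c <= (K.*2.+1)%:R /\ {in vs, forall v, P v = dft p l K v}.
Proof.
pose B : nat := (\sum_(v <- vs) (`|v.1| + `|v.2|)%N + \sum_(x <- l) (`|x.1| + `|x.2|)%N)%N.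
pose K := (B + (Num.trunc `|c|).+1)%N; exists K; split.
  apply: le_trans (ler_norm c) _; apply: (@le_trans _ _ (Num.trunc `|c|).+1%:R).
    by apply/ltW; case/andP: (trunc_itv (normr_ge0 c)).
  by rewrite ler_nat /K; lia.
have S (u : int * int -> nat) (w : seq (int * int)%type) :
    \sum_(x <- w) (u x)%:Z = (\sum_(x <- w) u x)%N%:Z.
  by rewrite (big_morph Posz PoszD (erefl 0%:Z)).
move=> v vvs; apply: wconv_dft.
  apply: (@le_lt_trans _ _ B%:Z); last by rewrite ltz_nat /K; lia.
  rewrite -[X in X + _]abszE; under eq_bigr do rewrite -abszE.
  rewrite S -PoszD lez_nat leq_add//.
    by rewrite (big_rem v)//=; lia.
  by apply: leq_sum => x _; lia.
apply: (@le_lt_trans _ _ B%:Z); last by rewrite ltz_nat /K; lia.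
rewrite -[X in X + _]abszE; under eq_bigr do rewrite -abszE.
rewrite S -PoszD lez_nat leq_add//.
  by rewrite (big_rem v)//=; lia.
by apply: leq_sum => x _; lia.
Qed.

Section Upper.
Variables (r1 r2 E : R).
Hypotheses (r1P : 0 < r1 <= pi) (r2P : 0 < r2 <= pi).
Hypothesis E_ge0 : 0 <= E.
Hypothesis cf_le : forall psi theta, `|psi| <= pi -> `|theta| <= pi ->
  normc (cf p l psi theta) <= box r1 r2 psi theta + E.

Lemma mass_le v : `|P v| <= r1 * r2 + E.
Proof.
have [K [cK PK]] := exists_grid [:: v] (20 / r1 + 20 / r2).
have r10 : 0 < r1 by case/andP: r1P.
have r20 : 0 < r2 by case/andP: r2P.
rewrite PK ?mem_head//; apply: le_trans (dft_mean_norm _ _) _.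
apply: (@le_trans _ _ (dft_mean K (fun a b => box r1 r2 a b + E))).
  apply: ler_dft_mean => a b ha hb; apply: le_trans (Re_le_normc _) _.
  by rewrite ComplexField.Normc.normcM normc_cis mul1r cf_le.
rewrite dft_meanD dft_mean_cst lerD2r.
have h1 : 0 <= 20 / r1 by rewrite divr_ge0// ltW.
have h2 : 0 <= 20 / r2 by rewrite divr_ge0// ltW.
by have /andP[] := dft_mean_box_le r1 r2 K r1P r2P ltac:(lra) ltac:(lra).
Qed.

(** Translation by [x] multiplies the transform by a phase. The difference of that phase to 1 is at
    most [d] on the box and at most 2 elsewhere. *)
Lemma mass_diff_le v x (d : R) :
  (forall psi theta, `|psi| <= r1 -> `|theta| <= r2 -> `|dotp psi theta x| <= d) ->
  `|P v - P (v - x)| <= d * (r1 * r2) + 2 * E.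
Proof.
move=> hd.
have [K [cK PK]] := exists_grid [:: v; v - x] (20 / r1 + 20 / r2).
have r10 : 0 < r1 by case/andP: r1P.
have r20 : 0 < r2 by case/andP: r2P.
have d0 : 0 <= d.
  by apply: le_trans (hd 0 0 _ _); rewrite ?normr_ge0// normr0 ltW.
rewrite !PK ?mem_head ?inE ?eqxx ?orbT//.
rewrite /dft -mulN1r -dft_meanZ -dft_meanD; apply: le_trans (dft_mean_norm _ _) _.
apply: (@le_trans _ _ (dft_mean K (fun a b => d * box r1 r2 a b + 2 * E))).
  apply: ler_dft_mean => a b ha hb; set z := cf _ _ _ _.
  have -> : complex.Re (cis (- dotp a b v) * z) + - 1 * complex.Re (cis (- dotp a b (v - x)) * z)
    = complex.Re (- (cis (- dotp a b v) * (cis (dotp a b x) - 1) * z)).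
    have -> : cis (- dotp a b (v - x)) = cis (- dotp a b v) * cis (dotp a b x).
      by rewrite dotpB opprB addrC cisD.
    have R1 (w : R[i]) : - 1 * complex.Re w = complex.Re (- w) by case: w => ? ? /=; rewrite mulN1r.
    by rewrite R1 -ReD; congr complex.Re; ring.
  apply: le_trans (Re_le_normc _) _.
  rewrite normcN !ComplexField.Normc.normcM normc_cis mul1r.
  have cz := cf_le _ _ ha hb; rewrite -/z in cz.
  have z0 := normc_ge0 z; have c0 := normc_ge0 (cis (dotp a b x) - 1).
  have c1 := normc_cis_sub1 (dotp a b x).
  have c2 : normc (cis (dotp a b x) - 1) <= 2.
    apply: le_trans (le_normcD _ _) _; rewrite normcN normc_cis.
    by rewrite ComplexField.Normc.normc1; lra.
  rewrite /box in cz *; case: (boolP (_ && _)) cz => [/andP[ha' hb'] | _] cz.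
    have := hd _ _ ha' hb'; rewrite mulr1 => hx.
    apply: le_trans (ler_wpM2l c0 cz) _; rewrite mulrDr mulr1 lerD//.
      exact: le_trans c1 hx.
    by rewrite ler_wpM2r.
  by rewrite mulr0 !add0r in cz *; rewrite ler_pM.
rewrite dft_meanD dft_meanZ dft_mean_cst lerD2r ler_wpM2l//.
have h1 : 0 <= 20 / r1 by rewrite divr_ge0// ltW.
have h2 : 0 <= 20 / r2 by rewrite divr_ge0// ltW.
by have /andP[] := dft_mean_box_le r1 r2 K r1P r2P ltac:(lra) ltac:(lra).
Qed.
End Upper.

(** The small box carries the main term [g], the large box the approximation error [e], and [E]
    bounds everything outside. *)
Lemma mass_ge v (r1 r2 s1 s2 g e E : R) :
  0 < r1 <= pi -> 0 < r2 <= pi -> 0 < s1 <= pi -> 0 < s2 <= pi -> 0 <= g -> 0 <= e ->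
  (forall psi theta, `|psi| <= pi -> `|theta| <= pi ->
     g * box s1 s2 psi theta - e * box r1 r2 psi theta - E
     <= complex.Re (cis (- dotp psi theta v) * cf p l psi theta)) ->
  g * (s1 * s2 / 100) - e * (r1 * r2) - E <= P v.
Proof.
move=> h1 h2 h3 h4 g0 e0 H.
have [K [cK PK]] := exists_grid [:: v] (20 / r1 + 20 / r2 + 20 / s1 + 20 / s2).
have i1 : 0 <= 20 / r1 by rewrite divr_ge0// ltW//; case/andP: h1.
have i2 : 0 <= 20 / r2 by rewrite divr_ge0// ltW//; case/andP: h2.
have i3 : 0 <= 20 / s1 by rewrite divr_ge0// ltW//; case/andP: h3.
have i4 : 0 <= 20 / s2 by rewrite divr_ge0// ltW//; case/andP: h4.
rewrite PK ?mem_head//.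
apply: (@le_trans _ _ (dft_mean K (fun a b => (g * box s1 s2 a b + - e * box r1 r2 a b) + - E))).
  rewrite dft_meanD dft_mean_cst lerD2r dft_meanD !dft_meanZ.
  have /andP[_ b1] := dft_mean_box_le r1 r2 K h1 h2 ltac:(lra) ltac:(lra).
  have /andP[b2 _] := dft_mean_box_le s1 s2 K h3 h4 ltac:(lra) ltac:(lra).
  by rewrite mulNr lerB// ler_wpM2l.
by apply: ler_dft_mean => a b ha hb; rewrite mulNr; exact: H.
Qed.
End MassBounds.

(** * Minor arcs: angles at which the transform is not small *)

Section MinorArcs.
Context {R : realType}.
Implicit Types (x y : R).

Lemma sum_iota_blocks (V : nmodType) (N J : nat) (F : nat -> V) :
  \sum_(m <- iota 1 (N * J)) F m = \sum_(j < J) \sum_(r < N) F (N * j + r.+1)%N.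
Proof.
elim: J => [|J IH]; first by rewrite muln0 big_nil big_ord0.
rewrite mulnSr iotaD big_cat IH big_ord_recr; congr +%R.
rewrite -[in LHS](addn0 (1 + N * J)%N) iotaDl big_map -[iota 0 N]/(iota 0 N).
have -> : iota 0 N = index_iota 0 N by rewrite /index_iota subn0.
rewrite big_mkord; apply: eq_bigr => r _; congr F => /=; lia.
Qed.

Lemma sum_class_le (N J g : nat) (F : nat -> R) : (1 <= g <= N)%N ->
  (forall m, 0 <= F m) ->
  \sum_(j < J) F (N * j + g)%N <= \sum_(m <- iota 1 (N * J)) F m.
Proof.
move=> hg F0; rewrite sum_iota_blocks; apply: ler_sum => j _.
have gN : (g.-1 < N)%N by lia.
rewrite (bigD1 (Ordinal gN)) //= prednK; last by lia.
by rewrite lerDl sumr_ge0.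
Qed.

Lemma versD2pi x (k : int) : vers (x + 2 * pi * k%:~R) = vers x.
Proof. by rewrite /vers cosD2pi_int. Qed.

Lemma angle_reduction x : exists r : int, exists2 y, x = 2 * pi * r%:~R + y & `|y| <= pi.
Proof.
have pi0 := @pi_gt0 R; pose r := Num.floor (x / (2 * pi) + 1 / 2).
exists r, (x - 2 * pi * r%:~R); first by rewrite addrC subrK.
have /andP[] : r%:~R <= x / (2 * pi) + 1 / 2 < (r + 1)%:~R.
  by rewrite floor_le_tmp ?floorD1_gt.
rewrite rmorphD /=; set u := x / (2 * pi) => h1 h2.
have -> : x = 2 * pi * u by rewrite /u mulrC divfK// mulf_neq0// gt_eqF.
by rewrite ler_norml; apply/andP; split; nra.
Qed.

(** Modulo [N] the numerator is some [b] with [1 <= |b| <= N / 2]; the angle [2 pi b / N] is then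
    between [4 / N] and [pi] in absolute value and [vers_ge] applies. *)
Lemma vers_ratio_ge (N : nat) (k : int) : (0 < N)%N -> ~~ (N%:Z %| k)%Z ->
  8 / (9 * N%:R ^+ 2) <= vers (2 * pi * k%:~R / N%:R : R).
Proof.
move=> N0 Nk; have pi0 := @pi_gt0 R; have pi2 := @pi_ge2 R.
have NR : 0 < N%:R :> R by rewrite ltr0n.
have [b [kb b0 bN]] : exists b : int, [/\ exists a : int, k = a * N%:Z + b, b != 0 & `|b| * 2 <= N%:Z].
  have := divz_eq k N%:Z; set a := (k %/ _)%Z; set b := (k %% _)%Z => kE.
  have b0 : 0 <= b by rewrite modz_ge0//; lia.
  have bN : b < N%:Z by rewrite ltz_pmod.
  have bn0 : b != 0 by apply: contra Nk => /eqP bz; apply/dvdz_mod0P.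
  have [h|h] := leP (b * 2) N%:Z.
    by exists b; split => //; [exists a | rewrite ger0_norm].
  by exists (b - N%:Z); split; [exists (a + 1); lia | lia | lia].
case: kb => a ->.
have -> : 2 * pi * (a * N%:Z + b)%:~R / N%:R = 2 * pi * b%:~R / N%:R + 2 * pi * a%:~R :> R.
  rewrite rmorphD rmorphM /= -pmulrn; move: pi => q; field; exact: lt0r_neq0.
rewrite versD2pi.
have bR : 1 <= `|b|%:~R :> R by rewrite ler1z; lia.
have bR2 : `|b|%:~R * 2 <= N%:R :> R.
  have : (`|b| * 2)%:~R <= N%:Z%:~R :> R by rewrite ler_int.
  by rewrite rmorphM.
have E : `|2 * pi * b%:~R / N%:R : R| = 2 * pi * `|b|%:~R / N%:R.
  by rewrite normrM normfV (gtr0_norm NR) normrM (gtr0_norm (mulr_gt0 (ltr0Sn R 1) pi0)) intr_norm.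
apply: le_trans (vers_ge _ _); last first.
  by rewrite E ler_pdivrMr//; nra.
rewrite -[X in X / 18]real_normK ?num_real// E.
have -> : (2 * pi * `|b|%:~R / N%:R) ^+ 2 / 18 = (2 * pi * `|b|%:~R) ^+ 2 / 2 / (9 * N%:R ^+ 2) :> R.
  by move: pi => q; field; exact: lt0r_neq0.
rewrite ler_pM2r ?invr_gt0 ?mulr_gt0 ?exprn_gt0//.
have : 4 <= 2 * pi * `|b|%:~R :> R by nra.
by nra.
Qed.

(** If [J |y| <= pi], the case [k = J] is the claim. Otherwise the least [k] with [k |y| >= 1]
    satisfies [k <= J] and [k |y| <= pi], so [vers (k y) >= 1 / 18], against the bound on [W]. *)
Lemma small_angle (J : nat) y (W : R) : (0 < J)%N -> `|y| <= pi ->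
  (forall k : nat, (1 <= k <= J)%N -> J%:R * vers (k%:R * y) <= W) ->
  W < J%:R / 18 -> J%:R ^+ 3 * y ^+ 2 <= 18 * W.
Proof.
move=> J0 ypi H WJ; have JR : 0 < J%:R :> R by rewrite ltr0n.
have pi2 := @pi_ge2 R.
have [Jy|Jy] := leP (J%:R * `|y|) pi.
  have := H J; rewrite J0 leqnn => /(_ isT) h.
  have : (J%:R * y) ^+ 2 / 18 <= vers (J%:R * y).
    by apply: vers_ge; rewrite normrM (gtr0_norm JR).
  move=> /(ler_wpM2l (ltW JR)) h2; have := le_trans h2 h.
  rewrite exprMn; have -> : J%:R ^+ 3 * y ^+ 2 = 18 * (J%:R * (J%:R ^+ 2 * y ^+ 2 / 18)); [by field|lra].
exfalso.
have ex : exists k : nat, 1 <= k%:R * `|y| by exists J; lra.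
have [k k1 kmin] := ex_minnP ex.
have kJ : (k <= J)%N by apply: kmin; lra.
have k0 : (0 < k)%N.
  by rewrite lt0n; apply/eqP => kz; move: k1; rewrite kz mul0r; lra.
have kpi : k%:R * `|y| <= pi.
  have [y1|y1] := leP 1 `|y|.
    have : (k <= 1)%N by apply: kmin; rewrite mul1r.
    move=> kle; have -> : k = 1%N by lia. 
    by rewrite mul1r.
  have : k.-1%:R * `|y| < 1.
    by rewrite ltNge; apply/negP => /kmin; lia.
  have kE : k%:R = k.-1%:R + 1 :> R by rewrite natr1 prednK.
  rewrite kE; nra.
have := H k; rewrite kJ k0 => /(_ isT) h.
have : (k%:R * y) ^+ 2 / 18 <= vers (k%:R * y).
  by apply: vers_ge; rewrite normrM ger0_norm ?ler0n.
have : 1 <= (k%:R * y) ^+ 2.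
  rewrite -real_normK ?num_real// normrM (ger0_norm (ler0n R k)); nra.
move=> h1 h2; have : J%:R * (1 / 18) <= J%:R * vers (k%:R * y).
  by rewrite ler_pM2l//; lra.
lra.
Qed.
End MinorArcs.

Section MinorArcTheorem.
Context {R : realType}.
Variables (N alpha beta : nat).
Hypotheses (hN : N = 2%N \/ (5 <= N)%N).
Hypotheses (ha : (1 <= alpha <= N)%N) (hb : (1 <= beta <= N)%N).
Hypothesis hneq : alpha <> beta.

Local Notation sgn := (eps N alpha beta).

Lemma eps_period j g : sgn (N * j + g)%N = sgn g.
Proof. by rewrite /eps mulnC !modnMDl. Qed.

Lemma eps_small g : (1 <= g <= N)%N ->
  sgn g = (g == alpha : nat)%:Z - (g == beta : nat)%:Z.
Proof.
move=> hg; have := eqn_mod_period N 0 g alpha hg ha.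
by have := eqn_mod_period N 0 g beta hg hb; rewrite muln0 add0n /eps => -> ->.
Qed.

(** Either the class 1 is free, or two consecutive classes are and their difference gives [r]. With
    [N >= 5] such a pair is found among 2, 3 and 4, 5; for [N = 4] and classes 1, 3 the value
    [r = 2] would be a counterexample. *)
Lemma free_residue (r : int) : (5 <= N)%N ->
  (forall g : nat, (1 <= g <= N)%N -> g <> alpha -> g <> beta -> (N%:Z %| r * g%:Z)%Z) ->
  (N%:Z %| r)%Z.
Proof.
move=> N5 H.
have step (g : nat) : (1 <= g < N)%N -> g <> alpha -> g <> beta ->
    g.+1 <> alpha -> g.+1 <> beta -> (N%:Z %| r)%Z.
  move=> hg a1 b1 a2 b2; have d1 := H g ltac:(lia) a1 b1.
  have d2 := H g.+1 ltac:(lia) a2 b2.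
  have -> : r = r * g.+1%:Z - r * g%:Z by rewrite -addn1 PoszD mulrDr mulr1 addrC addKr.
  exact: rpredB.
have one : 1%N <> alpha -> 1%N <> beta -> (N%:Z %| r)%Z.
  by move=> a1 b1; have := H 1%N ltac:(lia) a1 b1; rewrite mulr1.
have [a1|a1] := eqVneq alpha 1%N.
  have [b1|b1] := ltnP beta 4.
    by apply: (step 4); lia.
  by apply: (step 2); lia.
have [b1|b1] := eqVneq beta 1%N.
  have [b2|b2] := ltnP alpha 4.
    by apply: (step 4); lia.
  by apply: (step 2); lia.
by apply: one; apply/eqP; rewrite eq_sym.
Qed.

Definition phase (psi theta : R) (m : nat) : R := m%:R * psi + (sgn m)%:~R * theta.

Definition vers_sum (t psi theta : R) (M : nat) : R :=
  \sum_(m <- iota 1 M) expR (- (t * m%:R)) * vers (phase psi theta m).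

Lemma expRN1_ge : 1 / 4 <= expR (- 1) :> R.
Proof.
have -> : -1 = 2%:R * - (1 / 2) :> R by lra.
rewrite expRM_natl.
have h := expR_ge1Dx (- (1 / 2) : R).
have h2 : 1 / 2 <= expR (- (1 / 2) : R) by lra.
by rewrite expr2; nra.
Qed.

Section Arc.
Variables (L s t psi theta : R) (M : nat).
Hypotheses (L1 : 1 <= L) (s0 : 0 < s) (Ls : 100 * N%:R ^+ 2 * L ^+ 2 <= s ^+ 2).
Hypotheses (t0 : 0 < t) (ts : t * s ^+ 2 <= 1) (sM : s ^+ 2 <= M%:R).
Hypotheses (hpsi : `|psi| <= pi) (htheta : `|theta| <= pi).
Hypothesis small : vers_sum t psi theta M < L ^+ 2 / (288 * (64 * N%:R ^+ 3)).

Let J := Num.trunc (s ^+ 2 / (2 * N%:R)).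
Let V := \sum_(m <- iota 1 (N * (J + J))) vers (phase psi theta m).

Lemma natN_ge2 : 2 <= N%:R :> R.
Proof. by rewrite ler_nat; clear -hN; lia. Qed.

Lemma J_bounds : s ^+ 2 / (4 * N%:R) <= J%:R <= s ^+ 2 / (2 * N%:R).
Proof.
have N2 := natN_ge2; have N0 : 0 < N%:R :> R by lra.
have y0 : 0 <= s ^+ 2 / (2 * N%:R) by rewrite divr_ge0 ?sqr_ge0// mulr_ge0// ltW.
have /andP[h1 h2] := trunc_itv y0; rewrite -/J in h1 h2; rewrite h1 andbT.
have E : s ^+ 2 / (2 * N%:R) = 2 * (s ^+ 2 / (4 * N%:R)) by field; rewrite gt_eqF.
have big : 1 <= s ^+ 2 / (4 * N%:R).
  rewrite ler_pdivlMr ?mulr_gt0// mul1r; apply: le_trans Ls.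
  have L2 : 1 <= L ^+ 2 by rewrite exprn_ege1.
  have : 0 <= N%:R ^+ 2 * (L ^+ 2 - 1) by rewrite mulr_ge0 ?sqr_ge0// subr_ge0.
  by rewrite mulrBr mulr1; nra.
have JE : J.+1%:R = J%:R + 1 :> R by rewrite natr1.
by move: h2; rewrite JE E; lra.
Qed.

Lemma J_gt0 : (0 < J)%N.
Proof.
have N2 := natN_ge2; have N0 : 0 < N%:R :> R by lra.
have /andP[h _] := J_bounds; rewrite -(ltr_nat R); apply: lt_le_trans h.
by rewrite divr_gt0 ?exprn_gt0// mulr_gt0.
Qed.

Lemma NJ_le : (N * (J + J))%:R <= s ^+ 2.
Proof.
have N2 := natN_ge2; have N0 : 0 < N%:R :> R by lra.
have /andP[_] := J_bounds; rewrite natrM natrD ler_pdivlMr ?mulr_gt0//; lra.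
Qed.

Lemma V_small : V < L ^+ 2 / (72 * (64 * N%:R ^+ 3)).
Proof.
have N2 := natN_ge2; have N0 : 0 < N%:R :> R by lra.
have hM : (N * (J + J) <= M)%N by rewrite -(ler_nat R); exact: le_trans NJ_le sM.
have VS : V <= 4 * vers_sum t psi theta M.
  rewrite /vers_sum -(subnKC hM) iotaD big_cat /= mulrDr.
  rewrite -[V]addr0 lerD//; last first.
    apply: mulr_ge0 => //; apply: sumr_ge0 => m _.
    by apply: mulr_ge0; [exact: expR_ge0|exact: vers_ge0].
  rewrite mulr_sumr /V big_seq [leRHS]big_seq; apply: ler_sum => m.
  rewrite mem_iota => /andP[_ mM].
  rewrite mulrA -[leLHS]mul1r ler_wpM2r ?vers_ge0//.
  have : 1 / 4 <= expR (- (t * m%:R)).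
    apply: le_trans expRN1_ge _; rewrite ler_expR lerN2.
    apply: le_trans ts; rewrite ler_pM2l//; apply: le_trans NJ_le.
    by rewrite ler_nat; clear -mM; lia.
  by lra.
have E : L ^+ 2 / (72 * (64 * N%:R ^+ 3)) = 4 * (L ^+ 2 / (288 * (64 * N%:R ^+ 3))).
  by field; rewrite gt_eqF.
by rewrite E; apply: le_lt_trans VS _; rewrite ltr_pM2l.
Qed.

Lemma class_sum_le (g k : nat) : (1 <= g <= N)%N -> (k <= J)%N ->
  \sum_(j < J) vers (phase psi theta (N * (k + j) + g)) <= V.
Proof.
move=> hg kJ; have F0 m : 0 <= vers (phase psi theta m) by exact: vers_ge0.
apply: le_trans (sum_class_le N (J + J) g _ hg F0).
rewrite -(big_mkord xpredT (fun j => vers (phase psi theta (N * j + g)))).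
rewrite (big_cat_nat (n := k)) ?leq_addr//=; last by clear -kJ; lia.
rewrite [X in _ + X](big_cat_nat (n := (k + J)%N))/=; [|clear -kJ; lia|clear -kJ; lia].
rewrite addrCA -[leLHS]addr0 lerD//; last by rewrite addr_ge0// sumr_ge0.
rewrite -[in X in index_iota X _](add0n k) [(k + J)%N]addnC big_addn addnK big_mkord.
by apply: ler_sum => j _; rewrite [(k + j)%N]addnC.
Qed.

(** Two parts of one class that are [k] blocks apart have phases differing by [k N psi]: [theta]
    cancels. Averaging over the blocks makes [vers (k eta)] small for all [k <= J], and
    [small_angle] applies with [W = 4 V]. The constants of the threshold come from here:
    [72 = 18 * 4], [64 N ^ 3] from [J >= s ^ 2 / (4 N)], and a further 4 from dropping the
    weights. *)
Lemma small_slope (r : int) (eta : R) : N%:R * psi = 2 * pi * r%:~R + eta ->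
  `|eta| <= pi -> `|eta| <= L / s ^+ 3.
Proof.
move=> E eta_pi; have N2 := natN_ge2; have N0 : 0 < N%:R :> R by lra.
have JR : 0 < J%:R :> R by rewrite ltr0n J_gt0.
have /andP[J1 J2] := J_bounds.
have H k : (1 <= k <= J)%N -> J%:R * vers (k%:R * eta) <= 4 * V.
  move=> /andP[_ kJ].
  have D (j : 'I_J) : vers (k%:R * eta) <= 2 * vers (phase psi theta (N * (k + j) + 1))
      + 2 * vers (phase psi theta (N * (0 + j) + 1)).
    have -> : vers (k%:R * eta) = vers (phase psi theta (N * (k + j) + 1) - phase psi theta (N * (0 + j) + 1)).
      rewrite /phase !eps_period -(versD2pi (k%:R * eta) (k%:Z * r)); congr vers.
      rewrite rmorphM /= -pmulrn !natrD !natrM !natrD.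
      have -> : 2 * pi * (k%:R * r%:~R) = k%:R * (N%:R * psi - eta) :> R by rewrite E; ring.
      ring.
    exact: versB.
  have : \sum_(j < J) vers (k%:R * eta) <= \sum_(j < J)
      (2 * vers (phase psi theta (N * (k + j) + 1)) + 2 * vers (phase psi theta (N * (0 + j) + 1))).
    by apply: ler_sum => j _; exact: D.
  rewrite sumr_const card_ord -[X in X <= _]mulr_natl big_split /= -!mulr_sumr.
  have N1 : (1 <= 1 <= N)%N by clear -hN; lia.
  have := class_sum_le 1 k N1 kJ; have := class_sum_le 1 0 N1 (leq0n J).
  lra.
have W : 4 * V < J%:R / 18.
  have : L ^+ 2 / (72 * (64 * N%:R ^+ 3)) <= s ^+ 2 / (4 * N%:R) / 72.
    rewrite ler_pdivrMr ?mulr_gt0 ?exprn_gt0//.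
    have -> : s ^+ 2 / (4 * N%:R) / 72 * (72 * (64 * N%:R ^+ 3)) = 16 * N%:R ^+ 2 * s ^+ 2.
      by field; rewrite gt_eqF.
    have : 1 <= N%:R ^+ 2 :> R by rewrite exprn_ege1//; lra.
    rewrite -subr_ge0 => a1; have l1 := mulr_ge0 a1 (sqr_ge0 L).
    have l2 := mulr_ge0 a1 (sqr_ge0 s); rewrite !mulrBl !mul1r in l1 l2.
    move: Ls (sqr_ge0 L) (sqr_ge0 s); rewrite -!mulrA; lra.
  have := V_small; lra.
have := small_angle J eta (4 * V) J_gt0 eta_pi H W => Q.
have S0 : 0 < s ^+ 3 by rewrite exprn_gt0.
have J3 : (s ^+ 2 / (4 * N%:R)) ^+ 3 <= J%:R ^+ 3.
  by rewrite lerXn2r// nnegrE ?ler0n// divr_ge0 ?sqr_ge0// mulr_ge0// ltW.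
have Q2 : (s ^+ 2 / (4 * N%:R)) ^+ 3 * eta ^+ 2 <= 72 * (L ^+ 2 / (72 * (64 * N%:R ^+ 3))).
  apply: le_trans (_ : J%:R ^+ 3 * eta ^+ 2 <= _).
    by rewrite ler_wpM2r ?sqr_ge0.
  by apply: le_trans Q _; have := V_small; lra.
have Q3 : (s ^+ 3 * `|eta|) ^+ 2 <= L ^+ 2.
  rewrite exprMn real_normK ?num_real//.
  have N3 : 0 < N%:R ^+ 3 :> R by rewrite exprn_gt0.
  move: Q2; have -> : (s ^+ 2 / (4 * N%:R)) ^+ 3 * eta ^+ 2
    = ((s ^+ 3) ^+ 2 * eta ^+ 2) / (64 * N%:R ^+ 3) by field; rewrite gt_eqF.
  rewrite ler_pdivrMr ?mulr_gt0//.
  have -> : 72 * (L ^+ 2 / (72 * (64 * N%:R ^+ 3))) * (64 * N%:R ^+ 3) = L ^+ 2 by field; rewrite gt_eqF.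
  by [].
have a0 : 0 <= s ^+ 3 * `|eta| by rewrite mulr_ge0// ltW.
have L0 : 0 <= L by exact: le_trans ler01 L1.
by rewrite ler_pdivlMr// mulrC -(ler_pXn2r (n := 2)) ?nnegrE.
Qed.

(** Once [N psi] is replaced by [2 pi r], the phase of a part depends modulo [2 pi] only on its
    class. The replacement shifts a phase by [m eta / N], at most [L / s] since [m <= s ^ 2 / 2];
    the rest is an average over [J] blocks. *)
Lemma class_phase (r : int) (eta : R) (g : nat) : N%:R * psi = 2 * pi * r%:~R + eta ->
  `|eta| <= L / s ^+ 3 -> (1 <= g <= N)%N ->
  vers (2 * pi * (r * g%:Z)%:~R / N%:R + (sgn g)%:~R * theta) <= 3 * (L ^+ 2 / s ^+ 2).
Proof.
move=> E eta_s hg; have N2 := natN_ge2; have N0 : 0 < N%:R :> R by lra.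
have JR : 0 < J%:R :> R by rewrite ltr0n J_gt0.
have /andP[J1 J2] := J_bounds; set z := _ + _.
have S2 : 0 < s ^+ 2 by rewrite exprn_gt0.
have D (j : 'I_J) : vers z <= 2 * vers (phase psi theta (N * (0 + j) + g)) + L ^+ 2 / s ^+ 2.
  set m := (N * (0 + j) + g)%N.
  have mS : m%:R <= s ^+ 2 / 2.
    have h : (m + m)%:R <= s ^+ 2 :> R.
      by apply: le_trans NJ_le; rewrite ler_nat /m; have := ltn_ord j; clear -hg; nia.
    by rewrite natrD in h; lra.
  have -> : vers z = vers (phase psi theta m - m%:R * eta / N%:R).
    rewrite -(versD2pi z (j%:Z * r)) /z; congr vers.
    rewrite /phase /m eps_period !rmorphM /= -!pmulrn add0n natrD natrM.
    have -> : psi = (2 * pi * r%:~R + eta) / N%:R by rewrite -E mulrC mulKf// gt_eqF.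
    by move: pi => q; field; rewrite gt_eqF.
  apply: le_trans (versB _ _) _; rewrite lerD2l.
  have h := vers_le (m%:R * eta / N%:R).
  have h2 : (m%:R * eta / N%:R) ^+ 2 <= (L / s) ^+ 2.
    have Ls0 : 0 <= L / s by rewrite divr_ge0 ?(ltW s0)//; exact: le_trans ler01 L1.
    rewrite -real_normK ?num_real// lerXn2r ?nnegrE//.
    rewrite normrM normfV normrM (gtr0_norm N0) ger0_norm ?ler0n//.
    rewrite ler_pdivrMr//; apply: (@le_trans _ _ (s ^+ 2 / 2 * (L / s ^+ 3))).
      by rewrite ler_pM.
    have -> : s ^+ 2 / 2 * (L / s ^+ 3) = L / s / 2 by field; rewrite gt_eqF.
    have Ns1 : L / s / 2 <= L / s by rewrite ler_pdivrMr// ler_peMr//; lra.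
    by apply: le_trans Ns1 _; rewrite ler_peMr//; lra.
  by rewrite expr_div_n in h2; lra.
have : \sum_(j < J) vers z <= \sum_(j < J)
    (2 * vers (phase psi theta (N * (0 + j) + g)) + L ^+ 2 / s ^+ 2).
  by apply: ler_sum => j _; exact: D.
rewrite sumr_const big_split /= sumr_const !card_ord -mulr_sumr.
rewrite -[X in X <= _]mulr_natl -[X in _ <= _ + X]mulr_natl => H.
have := class_sum_le g 0 hg (leq0n J) => H2.
have H3 : 2 * V <= J%:R * (2 * L ^+ 2 / s ^+ 2).
  apply: (@le_trans _ _ (s ^+ 2 / (4 * N%:R) * (2 * L ^+ 2 / s ^+ 2))); last first.
    by rewrite ler_wpM2r// divr_ge0 ?sqr_ge0// mulr_ge0 ?sqr_ge0.
  have -> : s ^+ 2 / (4 * N%:R) * (2 * L ^+ 2 / s ^+ 2) = L ^+ 2 / (2 * N%:R).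
    by field; rewrite !gt_eqF.
  apply: (@le_trans _ _ (2 * (L ^+ 2 / (72 * (64 * N%:R ^+ 3))))).
    by have := V_small; lra.
  rewrite mulrA ler_pdivrMr ?mulr_gt0 ?exprn_gt0//.
  have -> : L ^+ 2 / (2 * N%:R) * (72 * (64 * N%:R ^+ 3)) = 36 * (64 * (N%:R ^+ 2 * L ^+ 2)).
    by field; rewrite gt_eqF.
  have : 1 <= N%:R ^+ 2 :> R by rewrite exprn_ege1//; lra.
  rewrite -subr_ge0 => a1; have l1 := mulr_ge0 a1 (sqr_ge0 L).
  by rewrite mulrBl mul1r in l1; move: (sqr_ge0 L); lra.
rewrite -(ler_pM2l JR); apply: le_trans H _.
apply: (@le_trans _ _ (J%:R * (2 * L ^+ 2 / s ^+ 2) + J%:R * (L ^+ 2 / s ^+ 2))).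
  by rewrite lerD2r; apply: le_trans H3; lra.
by rewrite le_eqVlt; apply/orP; left; apply/eqP; ring.
Qed.

(** The 12 is twice [3 + 3]: [versD] applied to two instances of [class_phase]. *)
Lemma arc_ratio : 12 * (L ^+ 2 / s ^+ 2) < 8 / (9 * N%:R ^+ 2).
Proof.
have N2 := natN_ge2; have N0 : 0 < N%:R :> R by lra.
have S2 : 0 < s ^+ 2 by rewrite exprn_gt0.
have NN : 0 < N%:R ^+ 2 :> R by rewrite exprn_gt0.
rewrite mulrA ltr_pdivrMr// mulrAC ltr_pdivlMr ?mulr_gt0//.
have h : 100 * (N%:R ^+ 2 * L ^+ 2) <= s ^+ 2 by rewrite mulrA.
have -> : 12 * L ^+ 2 * (9 * N%:R ^+ 2) = 108 * (N%:R ^+ 2 * L ^+ 2) by ring.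
lra.
Qed.

(** In a free class [theta] is absent, so [vers_ratio_ge] forces [r g] to be divisible by [N]. For
    [N = 2] no class is free, but in the sum of the classes 1 and 2 [theta] cancels, and [3 r] even
    means [r] even. *)
Lemma residue_dvd (r : int) (eta : R) : N%:R * psi = 2 * pi * r%:~R + eta ->
  `|eta| <= L / s ^+ 3 -> (N%:Z %| r)%Z.
Proof.
move=> E eta_s; have Np : (0 < N)%N by clear -hN; lia.
have S2 : 0 < s ^+ 2 by rewrite exprn_gt0.
have X0 : 0 <= L ^+ 2 / s ^+ 2 by rewrite divr_ge0 ?sqr_ge0.
have AR := arc_ratio.
case: (hN) => [N2|N5].
  have h1 := class_phase r eta 1 E eta_s ltac:(clear -Np; lia).
  have h2 := class_phase r eta 2 E eta_s ltac:(clear -N2; lia).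
  have e12 : sgn 1 + sgn 2 = 0.
    rewrite !eps_small; [|clear -N2; lia|clear -N2; lia].
    by clear -N2 ha hb hneq; lia.
  have d3 : (N%:Z %| r * 1%:Z + r * 2%:Z)%Z.
    apply: contraT => /(vers_ratio_ge (R := R) N _ Np) v.
    have := versD (2 * pi * (r * 1%:Z)%:~R / N%:R + (sgn 1)%:~R * theta)
                  (2 * pi * (r * 2%:Z)%:~R / N%:R + (sgn 2)%:~R * theta).
    have -> : 2 * pi * (r * 1%:Z)%:~R / N%:R + (sgn 1)%:~R * theta
      + (2 * pi * (r * 2%:Z)%:~R / N%:R + (sgn 2)%:~R * theta)
      = 2 * pi * (r * 1%:Z + r * 2%:Z)%:~R / N%:R.
      have -> : sgn 2 = - sgn 1 by apply/eqP; rewrite -addr_eq0 addrC e12.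
      rewrite rmorphN [(r * 1%:Z + _)%:~R]rmorphD /=.
      move: pi (r * 1%:Z)%:~R (r * 2%:Z)%:~R (sgn 1)%:~R => u x y e; ring.
    by lra.
  have -> : r = (r * 1%:Z + r * 2%:Z) - N%:Z * r by rewrite N2; ring.
  by rewrite rpredB// dvdz_mulr.
apply: free_residue => // g hg ga gb; apply: contraT => /(vers_ratio_ge (R := R) N _ Np) v.
have h := class_phase r eta g E eta_s hg.
have e0 : sgn g = 0 by rewrite eps_small//; clear -ga gb; lia.
by move: h; rewrite e0 mul0r addr0; lra.
Qed.

(** Divisibility of [r] by [N] and [|psi| <= pi] leave only [r = 0]. Then the class [alpha] isolates
    [theta], and [theta ^ 2 <= 18 * 3 (L / s) ^ 2] explains the 8. *)
Lemma minor_arc : `|psi| <= L / s ^+ 3 /\ `|theta| <= 8 * (L / s).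
Proof.
have N2 := natN_ge2; have N0 : 0 < N%:R :> R by lra.
have S2 : 0 < s ^+ 2 by rewrite exprn_gt0.
have L0 : 0 <= L by exact: le_trans ler01 L1.
have pi0 := @pi_gt0 R; have pi2 := @pi_ge2 R.
have [r [eta E eta_pi]] := angle_reduction (N%:R * psi).
have eta_s := small_slope r eta E eta_pi.
have S3 : 0 <= L / s ^+ 3 by rewrite divr_ge0// exprn_ge0// ltW.
have r0 : r = 0.
  have /dvdzP[q qE] := residue_dvd r eta E eta_s.
  have h : `|2 * pi * q%:~R : R| <= pi + pi / 2.
    have -> : 2 * pi * q%:~R = psi - eta / N%:R :> R.
      move: E; rewrite qE rmorphM /= -pmulrn => E.
      have -> : psi = N%:R * psi / N%:R by rewrite mulrC mulKf// gt_eqF.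
      by rewrite E; move: pi => u; field; rewrite gt_eqF.
    apply: le_trans (ler_normB _ _) _; rewrite lerD//.
    rewrite normrM normfV (gtr0_norm N0) ler_pdivrMr//.
    apply: le_trans eta_pi _; rewrite -[leLHS]mulr1 -mulrA ler_pM2l//; lra.
  have q1 : `|q%:~R| < 1 :> R.
    rewrite normrM (gtr0_norm (mulr_gt0 (ltr0Sn R 1) pi0)) in h; nra.
  have : `|q| < 1 by rewrite -intr_norm ltrz1 in q1.
  by rewrite qE; clear; case: (q =P 0) => [->|]; lia.
rewrite r0 mulr0 add0r in E.
have NP : N%:R * `|psi| = `|eta| by rewrite -E normrM (gtr0_norm N0).
split.
  by apply: le_trans eta_s; rewrite -NP; have := normr_ge0 psi; nra.
have vt : vers theta <= 3 * (L ^+ 2 / s ^+ 2).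
  have Er : N%:R * psi = 2 * pi * 0%:~R + eta by rewrite mulr0 add0r.
  have := class_phase 0 eta alpha Er eta_s ha.
  rewrite mul0r mulr0 mul0r add0r eps_small// eqxx.
  by move/eqP/negbTE: hneq => ->; rewrite subr0 mul1r.
have T2 : theta ^+ 2 <= (8 * (L / s)) ^+ 2.
  have := vers_ge _ htheta; rewrite exprMn expr_div_n.
  have X0 : 0 <= L ^+ 2 / s ^+ 2 by rewrite divr_ge0 ?sqr_ge0// ltW.
  lra.
have Ls0 : 0 <= L / s by rewrite divr_ge0// ltW.
have Ls8 : 0 <= 8 * (L / s) by rewrite mulr_ge0.
by rewrite -(ler_pXn2r (n := 2)) ?nnegrE// real_normK ?num_real.
Qed.

End Arc.
End MinorArcTheorem.

(** * The Boltzmann mass *)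

Section Mass.
Context {R : realType}.
Variables (N alpha beta : nat).
Hypotheses (hN : N = 2%N \/ (5 <= N)%N).
Hypotheses (ha : (1 <= alpha <= N)%N) (hb : (1 <= beta <= N)%N).
Hypothesis hneq : alpha <> beta.
Implicit Types (t : R) (x v : int * int) (M J : nat).

Definition weight t x : R := expR (- (t * x.1%:~R)).

Definition prob t x : R := weight t x / (1 + weight t x).

(** The law of (size, parity difference) when each part is present independently with probability
    [prob]. *)
Definition mass t M v : R :=
  wconv (fun x => 1 - prob t x) (prob t) (parts N alpha beta M) (@delta R _) v.

Definition partition_fun t M : R := \prod_(x <- parts N alpha beta M) (1 + weight t x).

Lemma weight_gt0 t x : 0 < weight t x.
Proof. exact: expR_gt0. Qed.

Lemma partition_fun_gt0 t M : 0 < partition_fun t M.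
Proof. by apply: prodr_gt0 => x _; rewrite addr_gt0 ?weight_gt0. Qed.

Lemma prob_itv t x : 0 <= prob t x <= 1.
Proof.
have w := weight_gt0 t x; apply/andP; split.
  by rewrite /prob divr_ge0 // ltW// addr_gt0.
by rewrite /prob ler_pdivrMr ?addr_gt0// mul1r lerDr.
Qed.

Lemma prob_le t x : prob t x <= weight t x.
Proof.
have w := weight_gt0 t x.
by rewrite /prob ler_pdivrMr ?addr_gt0// mulrDr mulr1 lerDl mulr_ge0// ltW.
Qed.

Lemma prob_var_ge t x : 0 <= t * x.1%:~R -> weight t x / 4 <= prob t x * (1 - prob t x).
Proof.
move=> tx; have w := weight_gt0 t x.
have w1 : weight t x <= 1 by rewrite expR_le1 oppr_le0.
have w1n : 1 + weight t x != 0 by rewrite gt_eqF// addr_gt0.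
have -> : prob t x * (1 - prob t x) = weight t x / (1 + weight t x) ^+ 2.
  by rewrite /prob; field.
rewrite ler_pM2l// lef_pV2 ?posrE// ?exprn_gt0 ?addr_gt0//.
by nra.
Qed.

(** The weight is multiplicative in the size, so tilting multiplies a coefficient by a factor that
    depends on the size alone. At fixed [n] the masses are therefore proportional to the counts. *)
Lemma mass_coef t M v :
  mass t M v = coef N alpha beta M v * weight t v / partition_fun t M.
Proof.
rewrite /mass /coef /partition_fun; elim: (parts _ _ _ _) v => [|x l IH] v.
  rewrite big_nil divr1 /= /delta; have [->|_] := eqVneq v 0; last by rewrite mul0r.
  by rewrite /weight /= mulr0 oppr0 expR0 mulr1.
rewrite wconv_cons conv_cons /binop !IH big_cons.
set P := \prod_(y <- l) _.
have P0 : P != 0 by rewrite gt_eqF// prodr_gt0// => y _; rewrite addr_gt0 ?weight_gt0.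
have w := weight_gt0 t x; have w1n : 1 + weight t x != 0 by rewrite gt_eqF// addr_gt0.
have -> : weight t v = weight t (v - x) * weight t x.
  by rewrite /weight -expRD /= rmorphB /=; congr expR; ring.
by rewrite /prob; field; rewrite P0 w1n.
Qed.

Let N1 : (1 < N)%N. Proof. by clear -hN; lia. Qed.

Lemma mass_reflect t J (m c : int) : mass t (N * J) (m, - c)
  = mass t (N * J) (m - (beta%:Z - alpha%:Z) * c, c)
    * expR (- (t * ((beta%:Z - alpha%:Z) * c)%:~R)).
Proof.
rewrite !mass_coef (coef_reflect _ _ _ N1 ha hb hneq).
have -> : weight t (m, - c) = weight t (m - (beta%:Z - alpha%:Z) * c, c)
    * expR (- (t * ((beta%:Z - alpha%:Z) * c)%:~R)).
  by rewrite /weight -expRD /= [(m - _)%:~R]rmorphB /=; congr expR; ring.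
by ring.
Qed.

(** The points have sizes [m - k] for various [k]; each exponential restores the weight belonging to
    size [m]. *)
Lemma mass_recurrence t J (m c : int) : 0 <= c -> m <= (N * J)%:Z - N%:Z ->
  mass t (N * J) (m - N%:Z * c, c) * expR (- (t * (N%:Z * c)%:~R))
  + mass t (N * J) (m - (alpha%:Z + N%:Z * (c - 1)), c - 1)
    * expR (- (t * (alpha%:Z + N%:Z * (c - 1))%:~R))
  = mass t (N * J) (m, c)
    + mass t (N * J) (m - (beta%:Z - N%:Z), c + 1) * expR (- (t * (beta%:Z - N%:Z)%:~R)).
Proof.
move=> c0 hm; have := coef_recurrence (R := R) N alpha beta N1 ha hb hneq J m c c0 hm.
rewrite !mass_coef.
have W (k c' : int) : weight t (m - k, c') * expR (- (t * k%:~R)) = weight t (m, c).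
  by rewrite /weight -expRD /= rmorphB /=; congr expR; ring.
have E (k c' : int) : coef N alpha beta (N * J) (m - k, c') * weight t (m - k, c')
    / partition_fun t (N * J) * expR (- (t * k%:~R))
    = coef N alpha beta (N * J) (m - k, c') * (weight t (m, c) / partition_fun t (N * J)).
  by rewrite -[in RHS](W k c'); ring.
have F : coef N alpha beta (N * J) (m, c) * weight t (m, c) / partition_fun t (N * J)
    = coef N alpha beta (N * J) (m, c) * (weight t (m, c) / partition_fun t (N * J)) by rewrite mulrA.
rewrite !E F -!mulrDl => H.
by rewrite opprD addrA H opprB addrA.
Qed.

Lemma cf_parts_le t M (psi theta : R) : 0 <= t ->
  normc (cf (prob t) (parts N alpha beta M) psi theta)
  <= expR (- (vers_sum N alpha beta t psi theta M / 4)).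
Proof.
move=> t0; rewrite /cf normc_prod /vers_sum mulr_suml -sumrN expR_sum /parts big_map.
apply: ler_prod => m _; rewrite normc_ge0 /=.
apply: le_trans (normc_bernoulli_cf _ _ (prob_itv _ _)) _; rewrite ler_expR lerN2.
have tm : 0 <= t * (m%:Z, eps N alpha beta m).1%:~R by rewrite mulr_ge0//= -pmulrn.
by rewrite mulrAC ler_pM ?vers_ge0 ?divr_ge0 ?expR_ge0 ?(prob_var_ge _ _ tm).
Qed.

(** The threshold of [minor_arc] divided by 4, the loss in bounding the variance of a part by its
    weight. *)
Definition arc_rate : R := (4 * (288 * (64 * N%:R ^+ 3)))^-1.

Section SmallAngles.
Variables (L s t : R) (M : nat).
Hypotheses (L1 : 1 <= L) (s0 : 0 < s) (Ls : 100 * N%:R ^+ 2 * L ^+ 2 <= s ^+ 2).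
Hypotheses (t0 : 0 < t) (ts : t * s ^+ 2 <= 1) (sM : s ^+ 2 <= M%:R).

Local Notation r1 := (L / s ^+ 3).
Local Notation r2 := (8 * (L / s)).
Local Notation E := (expR (- (arc_rate * L ^+ 2))).

Lemma cf_parts_box (psi theta : R) : `|psi| <= pi -> `|theta| <= pi ->
  normc (cf (prob t) (parts N alpha beta M) psi theta) <= box r1 r2 psi theta + E.
Proof.
move=> hp ht; apply: le_trans (cf_parts_le _ _ _ _ (ltW t0)) _.
have V0 : 0 <= vers_sum N alpha beta t psi theta M.
  by apply: sumr_ge0 => m _; apply: mulr_ge0; [exact: expR_ge0|exact: vers_ge0].
have [sm|big] := ltP (vers_sum N alpha beta t psi theta M) (L ^+ 2 / (288 * (64 * N%:R ^+ 3))).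
  have [b1 b2] := minor_arc N alpha beta hN ha hb hneq L s t psi theta M L1 s0 Ls t0 ts sM hp ht sm.
  rewrite /box b1 b2 /=; apply: (@le_trans _ _ 1); last by rewrite lerDl expR_ge0.
  by rewrite expR_le1 oppr_le0 divr_ge0.
apply: (@le_trans _ _ E); last by rewrite lerDr box_ge0.
rewrite ler_expR lerN2.
have -> : arc_rate * L ^+ 2 = L ^+ 2 / (288 * (64 * N%:R ^+ 3)) / 4.
  by rewrite /arc_rate [(4 * _)^-1]invfM; ring.
by rewrite ler_pM2r ?invr_gt0.
Qed.

Lemma arc_radii : [/\ 0 < r1 <= pi, 0 < r2 <= pi & L / s <= 1 / 20].
Proof.
have N2 : 2 <= N%:R :> R by exact: natN_ge2.
have L0 : 0 < L by exact: lt_le_trans ltr01 L1.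
have pi2 := @pi_ge2 R.
have h : 20 * L <= s.
  rewrite -(ler_pXn2r (n := 2)) ?nnegrE ?mulr_ge0 ?(ltW s0) ?(ltW L0)//.
  apply: le_trans Ls; rewrite exprMn ler_wpM2r ?sqr_ge0//.
  have : 4 <= N%:R ^+ 2 :> R by nra.
  by lra.
have hr : L / s <= 1 / 20 by rewrite ler_pdivrMr//; lra.
have s1 : 1 <= s by have := L1; lra.
have s2 : 1 <= s ^+ 2 by rewrite exprn_ege1.
have Ls0 : 0 < L / s by rewrite divr_gt0.
split => //; last by apply/andP; split; [rewrite mulr_gt0|lra].
have E3 : L / s ^+ 3 = L / s / s ^+ 2 by field; rewrite gt_eqF.
rewrite E3 divr_gt0 ?exprn_gt0//=; apply: (@le_trans _ _ (L / s)); last by lra.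
by rewrite ler_pdivrMr ?exprn_gt0// ler_peMr// ltW.
Qed.

Lemma mass_sup v : `|mass t M v| <= r1 * r2 + E.
Proof.
have [h1 h2 _] := arc_radii.
exact: (mass_le _ _ _ _ _ h1 h2 cf_parts_box).
Qed.

Lemma mass_step1 (v : int * int) : `|mass t M v - mass t M (v - (1, 0))| <= r1 * (r1 * r2) + 2 * E.
Proof.
have [h1 h2 _] := arc_radii.
apply: (mass_diff_le _ _ _ _ _ h1 h2 (expR_ge0 _) cf_parts_box) => psi theta a b.
by rewrite /dotp /= mul1r mul0r addr0.
Qed.

Lemma mass_step2 (v : int * int) : `|mass t M v - mass t M (v - (0, 1))| <= r2 * (r1 * r2) + 2 * E.
Proof.
have [h1 h2 _] := arc_radii.
apply: (mass_diff_le _ _ _ _ _ h1 h2 (expR_ge0 _) cf_parts_box) => psi theta a b.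
by rewrite /dotp /= mul1r mul0r add0r.
Qed.

Lemma mass_shift1 (m c k : int) :
  `|mass t M (m - k, c) - mass t M (m, c)| <= `|k|%:~R * (r1 * (r1 * r2) + 2 * E).
Proof.
have H (n : nat) (m' : int) : `|mass t M (m' - n%:Z, c) - mass t M (m', c)|
    <= n%:R * (r1 * (r1 * r2) + 2 * E).
  elim: n => [|n IH]; first by rewrite subr0 subrr normr0 mul0r.
  rewrite -natr1 mulrDl mul1r.
  apply: le_trans (ler_distD (mass t M (m' - n%:Z, c)) _ _) _.
  rewrite addrC; apply: lerD; first exact: IH.
  rewrite distrC; have := mass_step1 (m' - n%:Z, c).
  have -> : (m' - n%:Z, c) - (1, 0) = (m' - n.+1%:Z, c).
    by congr pair; rewrite /= ?subr0//; lia.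
  by [].
case: k => n; first exact: (H n m).
have := H n.+1 (m - Negz n); rewrite distrC NegzE.
by have -> : m - - n.+1%:Z - n.+1%:Z = m by lia.
Qed.

End SmallAngles.
End Mass.

(** * Moments of the weights *)

Section PowerSums.
Context {R : realType}.
Implicit Types (t y : R).

Lemma sum_expRN_le y (M : nat) : 0 < y -> \sum_(m <- iota 1 M) expR (- (y * m%:R)) <= 1 / y.
Proof.
move=> y0; suff H : y * \sum_(m <- iota 1 M) expR (- (y * m%:R)) <= 1 - expR (- (y * M%:R)).
  by rewrite ler_pdivlMr// mulrC (le_trans H)// gerBl expR_ge0.
elim: M => [|M IH]; first by rewrite big_nil !mulr0 oppr0 expR0 subrr.
have -> : iota 1 M.+1 = iota 1 M ++ [:: M.+1] by rewrite -(addn1 M) iotaD add1n addn1.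
rewrite big_cat big_seq1 /= mulrDr.
have E : expR (- (y * M%:R)) = expR y * expR (- (y * M.+1%:R)).
  by rewrite -expRD -natr1; congr expR; ring.
have := expR_ge1Dx y; have := expR_gt0 (- (y * M.+1%:R)); rewrite E in IH.
by move: IH; set S := \sum_(m <- _) _; set e := expR (- _); set u := expR y; nra.
Qed.

(** Half of the exponent absorbs the power of [m], the other half is summed as a geometric
    series. *)
Lemma sum_pow_expRN_le t (k M : nat) : 0 < t ->
  \sum_(m <- iota 1 M) m%:R ^+ k * expR (- (t * m%:R)) <= (2 / t) ^+ k.+1 * k`!%:R.
Proof.
move=> t0; have t2 : 0 < t / 2 by rewrite divr_gt0.
have B (m : nat) : m%:R ^+ k * expR (- (t * m%:R))
    <= (2 / t) ^+ k * k`!%:R * expR (- (t / 2 * m%:R)).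
  have h : 0 <= t / 2 * m%:R by rewrite mulr_ge0// ltW.
  have E1 : t * m%:R = t / 2 * m%:R + t / 2 * m%:R by rewrite -mulrDl -splitr.
  have E2 : m%:R = 2 / t * (t / 2 * m%:R) by field; rewrite gt_eqF.
  rewrite [X in expR (- X)]E1 opprD expRD mulrA ler_wpM2r ?expR_ge0//.
  have -> : m%:R ^+ k = (2 / t) ^+ k * (t / 2 * m%:R) ^+ k by rewrite -exprMn -E2.
  rewrite -[leLHS]mulrA ler_wpM2l ?exprn_ge0 ?divr_ge0 ?(ltW t0)//.
  exact: pow_expRN_le.
apply: (@le_trans _ _ (\sum_(m <- iota 1 M) (2 / t) ^+ k * k`!%:R * expR (- (t / 2 * m%:R)))).
  by apply: ler_sum => m _; exact: B.
rewrite -mulr_sumr exprSr [leRHS]mulrAC ler_wpM2l//.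
  by rewrite mulr_ge0 ?exprn_ge0 ?divr_ge0 ?(ltW t0).
by have := sum_expRN_le _ M t2; rewrite div1r invf_div.
Qed.

Lemma cube_add_le y z : `|y + z : R| ^+ 3 <= 4 * (`|y| ^+ 3 + `|z| ^+ 3).
Proof.
apply: (@le_trans _ _ ((`|y| + `|z|) ^+ 3)).
  by rewrite lerXn2r ?nnegrE ?addr_ge0// ler_normD.
have := normr_ge0 y; have := normr_ge0 z; set a := `|y|; set b := `|z| => b0 a0.
rewrite -subr_ge0.
have -> : 4 * (a ^+ 3 + b ^+ 3) - (a + b) ^+ 3 = 3 * ((a + b) * (a - b) ^+ 2) by ring.
by rewrite mulr_ge0// mulr_ge0 ?sqr_ge0 ?addr_ge0.
Qed.

Lemma sqr_add_le (y z : R) : (y + z) ^+ 2 <= 2 * y ^+ 2 + 2 * z ^+ 2.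
Proof. by have := sqr_ge0 (y - z); rewrite sqrrB sqrrD; lra. Qed.
End PowerSums.

(** * Lower bound for the mass at parity difference 0 *)

Section Centre.
Context {R : realType}.
Variables (N alpha beta : nat).
Hypotheses (hN : N = 2%N \/ (5 <= N)%N).
Hypotheses (ha : (1 <= alpha <= N)%N) (hb : (1 <= beta <= N)%N).
Hypothesis hneq : alpha <> beta.

Local Notation sgn := (eps N alpha beta).

Definition fermi (t : R) (m : nat) : R := expR (- (t * m%:R)) / (1 + expR (- (t * m%:R))).

Lemma fermi_itv (t : R) m : 0 <= fermi t m <= 1.
Proof. exact: (prob_itv t (m%:Z, 0)). Qed.

Lemma fermi_le (t : R) m : fermi t m <= expR (- (t * m%:R)).
Proof. exact: (prob_le t (m%:Z, 0)). Qed.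

Lemma prob_fermi t m e : prob t (m%:Z, e) = fermi t m.
Proof. by []. Qed.

Lemma fermi_nincr (t : R) m n : 0 < t -> (m <= n)%N -> fermi t n <= fermi t m.
Proof.
move=> t0 mn; rewrite /fermi.
have : expR (- (t * n%:R)) <= expR (- (t * m%:R)).
  by rewrite ler_expR lerN2 ler_pM2l// ler_nat.
have := expR_gt0 (- (t * n%:R)); have := expR_gt0 (- (t * m%:R)).
set x := expR _; set y := expR (- (t * m%:R)) => y0 x0 xy.
rewrite ler_pdivrMr ?addr_gt0// mulrAC ler_pdivlMr ?addr_gt0//; nra.
Qed.

Definition mean_size t M : R := \sum_(m <- iota 1 M) m%:R * fermi t m.

Definition mean_pd t M : R := \sum_(m <- iota 1 M) (sgn m)%:~R * fermi t m.

(** Each block contributes the difference of two values of the decreasing function [fermi], at most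
    the drop of [fermi] across the block; these drops telescope. *)
Lemma mean_pd_le (t : R) J : 0 < t -> `|mean_pd t (N * J)| <= 1.
Proof.
move=> t0; rewrite /mean_pd sum_iota_blocks.
have B j : `|\sum_(r < N) (sgn (N * j + r.+1))%:~R * fermi t (N * j + r.+1)|
    <= fermi t (N * j + 1) - fermi t (N * j.+1 + 1).
  have single a : (1 <= a <= N)%N ->
      \sum_(r < N) (r.+1 == a)%:R * fermi t (N * j + r.+1) = fermi t (N * j + a).
    move=> ha'; have aN : (a.-1 < N)%N by clear -ha'; lia.
    rewrite (bigD1 (Ordinal aN)) //= prednK; last by clear -ha'; lia.
    rewrite eqxx mul1r big1 ?addr0// => r ra.
    have -> : (r.+1 == a) = false; last by rewrite mul0r.
    apply/negbTE; apply: contra ra => /eqP ra; apply/eqP/val_inj => /=.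
    by rewrite -ra.
  have -> : \sum_(r < N) (sgn (N * j + r.+1))%:~R * fermi t (N * j + r.+1)
      = fermi t (N * j + alpha) - fermi t (N * j + beta).
    rewrite -(single alpha ha) -(single beta hb) -sumrB; apply: eq_bigr => r _.
    rewrite eps_period (eps_small N alpha beta ha hb).
      by rewrite rmorphB /= -!pmulrn mulrBl.
    by rewrite /= ltn_ord.
  have mono a : (1 <= a <= N)%N ->
      fermi t (N * j.+1 + 1) <= fermi t (N * j + a) <= fermi t (N * j + 1).
    move=> ha'; rewrite !fermi_nincr//; clear -ha'; nia.
  have /andP[h1 h2] := mono _ ha; have /andP[h3 h4] := mono _ hb.
  by rewrite ler_norml; apply/andP; split; lra.
apply: le_trans (ler_norm_sum _ _ _) _.
apply: (@le_trans _ _ (\sum_(j < J) (fermi t (N * j + 1) - fermi t (N * j.+1 + 1)))).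
  by apply: ler_sum => j _; exact: B.
rewrite -(big_mkord xpredT (fun j => fermi t (N * j + 1) - fermi t (N * j.+1 + 1))).
under eq_bigr do rewrite -opprB.
rewrite sumrN telescope_sumr// opprB.
have /andP[_ h1] := fermi_itv t (N * 0 + 1).
have /andP[h2 _] := fermi_itv t (N * J + 1).
lra.
Qed.

Lemma eps_sqr_le (theta : R) m : ((sgn m)%:~R * theta) ^+ 2 <= theta ^+ 2.
Proof.
have [s2|s2] : (sgn m)%:~R ^+ 2 = 1 :> R \/ (sgn m)%:~R ^+ 2 = 0 :> R.
  rewrite /eps; case: (_ == _ %[mod _])%N; case: (_ == _ %[mod _])%N => /=.
  - by right; rewrite subrr expr0n.
  - by left; rewrite subr0 expr1n.
  - by left; rewrite sub0r rmorphN sqrrN expr1n.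
  - by right; rewrite subrr expr0n.
- by rewrite exprMn s2 mul1r.
- by rewrite exprMn s2 mul0r sqr_ge0.
Qed.

Section CentreBound.
Variables (L s t K0 K2 K3 : R) (J n : nat).
Let M := (N * J)%N.
Hypotheses (L1 : 1 <= L) (s0 : 0 < s) (Ls : 100 * N%:R ^+ 2 * L ^+ 2 <= s ^+ 2).
Hypotheses (t0 : 0 < t) (ts : t * s ^+ 2 <= 1) (ts6 : 1 <= 6 * (t * s ^+ 2)).
Hypothesis (sM : s ^+ 2 <= M%:R).
Hypothesis (saddle : mean_size t M = n%:R).
Hypothesis (sum0 : \sum_(m <- iota 1 M) expR (- (t * m%:R)) <= K0 * s ^+ 2).
Hypothesis (sum2 : \sum_(m <- iota 1 M) m%:R ^+ 2 * expR (- (t * m%:R)) <= K2 * s ^+ 6).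
Hypothesis (sum3 : \sum_(m <- iota 1 M) m%:R ^+ 3 * expR (- (t * m%:R)) <= K3 * s ^+ 8).

Local Notation r1 := (L / s ^+ 3).
Local Notation r2 := (8 * (L / s)).
Local Notation E := (expR (- (arc_rate N * L ^+ 2))).
Local Notation phi psi theta := (phase N alpha beta psi theta).

Definition gauss_factor (psi theta : R) (m : nat) : R :=
  1 - fermi t m * (1 - fermi t m) * phi psi theta m ^+ 2 / 2.

(** The choice of [t] as saddle point removes the linear term in [psi]. The linear term in [theta]
    remains as a phase, harmless because [mean_pd] is bounded. *)
Lemma cf_centred psi theta :
  cis (- dotp psi theta (n%:Z, 0)) * cf (prob t) (parts N alpha beta M) psi theta
  = \prod_(m <- iota 1 M) (bernoulli_cf (fermi t m) (phi psi theta m)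
                           * cis (- (fermi t m * phi psi theta m)))
    * cis (mean_pd t M * theta).
Proof.
rewrite big_split /= -cis_sum /cf /parts big_map mulrC -mulrA -cisD; congr (_ * cis _).
rewrite /dotp /= mul0r addr0 -pmulrn -saddle /mean_size /mean_pd sumrN !mulr_suml -sumrN -sumrN.
rewrite -big_split /=; apply: eq_bigr => m _; rewrite /phase; ring.
Qed.

Lemma gauss_small (psi theta : R) m : `|psi| <= r1 -> `|theta| <= r2 ->
  0 <= fermi t m * (1 - fermi t m) * phi psi theta m ^+ 2 / 2 <= 1 / 2.
Proof.
move=> hp ht; have /andP[p0 p1] := fermi_itv t m; have pe := fermi_le t m.
have [h1 h2 hr] := arc_radii N hN L s L1 s0 Ls.
have L0 : 0 < L by exact: lt_le_trans ltr01 L1.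
have q0 : 0 <= 1 - fermi t m by rewrite subr_ge0.
set x := phi psi theta m; set e := expR _ in pe.
have e0 : 0 <= e by exact: expR_ge0.
have e1 : e <= 1 by rewrite expR_le1 oppr_le0 mulr_ge0// ltW.
have x2 := sqr_ge0 x.
apply/andP; split.
  by apply: divr_ge0 => //; apply: mulr_ge0 => //; exact: mulr_ge0.
rewrite ler_pM2r ?invr_gt0//.
apply: (@le_trans _ _ (e * x ^+ 2)).
  by rewrite ler_wpM2r//; apply: le_trans pe; rewrite ler_piMr// gerBl.
have hx : x ^+ 2 <= 2 * (m%:R ^+ 2 * r1 ^+ 2) + 2 * r2 ^+ 2.
  apply: le_trans (sqr_add_le _ _) _; apply: lerD; rewrite ler_pM2l//.
    rewrite exprMn ler_wpM2l ?sqr_ge0// -[psi ^+ 2]real_normK ?num_real//.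
    rewrite lerXn2r ?nnegrE//; exact: le_trans (normr_ge0 _) hp.
  apply: le_trans (eps_sqr_le _ _) _; rewrite -[theta ^+ 2]real_normK ?num_real//.
  rewrite lerXn2r ?nnegrE//; exact: le_trans (normr_ge0 _) ht.
(* From [(t m) ^ 2 exp (- t m) <= 2] and [t >= 1 / (6 s ^ 2)]. *)
have em : e * m%:R ^+ 2 <= 72 * s ^+ 4.
  have tm : 0 <= t * m%:R by rewrite mulr_ge0// ltW.
  have := pow_expRN_le _ 2 tm; rewrite -/e exprMn => h.
  have t36 : 1 <= 36 * (t ^+ 2 * s ^+ 4).
    have -> : 36 * (t ^+ 2 * s ^+ 4) = (6 * (t * s ^+ 2)) ^+ 2 by ring.
    by rewrite exprn_ege1.
  have f2 : 2`!%:R = 2 :> R by [].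
  rewrite f2 in h.
  have A0 : 0 <= e * m%:R ^+ 2 by rewrite mulr_ge0 ?sqr_ge0.
  have S4 : 0 <= s ^+ 4 by rewrite exprn_ge0// ltW.
  have k1 : e * m%:R ^+ 2 * 1 <= e * m%:R ^+ 2 * (36 * (t ^+ 2 * s ^+ 4)) by rewrite ler_wpM2l.
  have k2 : 36 * s ^+ 4 * (t ^+ 2 * m%:R ^+ 2 * e) <= 36 * s ^+ 4 * 2.
    by rewrite ler_wpM2l// mulr_ge0.
  rewrite mulr1 in k1; apply: le_trans k1 _.
  have -> : e * m%:R ^+ 2 * (36 * (t ^+ 2 * s ^+ 4)) = 36 * s ^+ 4 * (t ^+ 2 * m%:R ^+ 2 * e) by ring.
  by apply: le_trans k2 _; lra.
have R1 : e * (m%:R ^+ 2 * r1 ^+ 2) <= 72 * (L / s) ^+ 2.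
  rewrite mulrA; apply: (@le_trans _ _ (72 * s ^+ 4 * r1 ^+ 2)).
    by rewrite ler_wpM2r ?sqr_ge0.
  rewrite le_eqVlt; apply/orP; left; apply/eqP; field; rewrite gt_eqF//.
have hr0 : 0 <= L / s by rewrite divr_ge0 ?ltW.
have hr2 : (L / s) ^+ 2 <= (1 / 20) ^+ 2 by rewrite lerXn2r ?nnegrE//; lra.
have H1 : e * x ^+ 2 <= e * (2 * (m%:R ^+ 2 * r1 ^+ 2) + 2 * r2 ^+ 2) by rewrite ler_wpM2l.
have H2 : e * r2 ^+ 2 <= r2 ^+ 2 by rewrite ler_piMl ?sqr_ge0.
have R2 : r2 ^+ 2 = 64 * (L / s) ^+ 2 by ring.
rewrite R2 in H1 H2; move: hr2 H1 H2 R1; set z := (L / s) ^+ 2; lra.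
Qed.

(** On the box of natural size, without the widening [L], the total variance of the phase is
    bounded, and [1 - y >= exp (- 2 y)] turns this into a constant lower bound. *)
Lemma gauss_prod_ge (psi theta : R) : `|psi| <= 1 / s ^+ 3 -> `|theta| <= 1 / s ->
  expR (- (2 * K2 + 2 * K0)) <= \prod_(m <- iota 1 M) gauss_factor psi theta m.
Proof.
move=> hp ht; have L0 : 0 < L by exact: lt_le_trans ltr01 L1.
have hp' : `|psi| <= r1.
  by apply: le_trans hp _; rewrite ler_pM2r ?invr_gt0 ?exprn_gt0.
have ht' : `|theta| <= r2.
  apply: le_trans ht _; rewrite mulrA ler_pM2r ?invr_gt0//.
  by have := L1; lra.
apply: (@le_trans _ _ (\prod_(m <- iota 1 M)
    expR (- (2 * (fermi t m * (1 - fermi t m) * phi psi theta m ^+ 2 / 2))))); last first.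
  by apply: ler_prod => m _; rewrite expR_ge0 /=; apply: expRN2_le; exact: gauss_small.
rewrite -expR_sum ler_expR sumrN lerN2.
apply: (@le_trans _ _ (\sum_(m <- iota 1 M) expR (- (t * m%:R))
    * (2 * (m%:R ^+ 2 / s ^+ 6) + 2 / s ^+ 2))).
  apply: ler_sum => m _.
  have /andP[p0 p1] := fermi_itv t m; have pe := fermi_le t m.
  rewrite mulrCA divff// mulr1.
  have x2 := sqr_ge0 (phi psi theta m).
  apply: (@le_trans _ _ (expR (- (t * m%:R)) * phi psi theta m ^+ 2)).
    rewrite ler_wpM2r//; apply: le_trans pe; rewrite ler_piMr// ?gerBl//.
  rewrite ler_wpM2l ?expR_ge0//; apply: le_trans (sqr_add_le _ _) _.
  apply: lerD; rewrite ler_pM2l//.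
    rewrite exprMn ler_wpM2l ?sqr_ge0// -[psi ^+ 2]real_normK ?num_real//.
    have -> : (s ^+ 6)^-1 = (1 / s ^+ 3) ^+ 2 by field; rewrite gt_eqF.
    rewrite lerXn2r ?nnegrE//; exact: le_trans (normr_ge0 _) hp.
  apply: le_trans (eps_sqr_le _ _) _; rewrite -[theta ^+ 2]real_normK ?num_real//.
  have -> : (s ^+ 2)^-1 = (1 / s) ^+ 2 by field; rewrite gt_eqF.
  rewrite lerXn2r ?nnegrE//; exact: le_trans (normr_ge0 _) ht.
have -> : \sum_(m <- iota 1 M) expR (- (t * m%:R)) * (2 * (m%:R ^+ 2 / s ^+ 6) + 2 / s ^+ 2)
  = 2 / s ^+ 6 * (\sum_(m <- iota 1 M) m%:R ^+ 2 * expR (- (t * m%:R)))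
    + 2 / s ^+ 2 * (\sum_(m <- iota 1 M) expR (- (t * m%:R))).
  by rewrite !mulr_sumr -big_split; apply: eq_bigr => m _ /=; ring.
have i6 : 0 < 2 / s ^+ 6 by rewrite divr_gt0// exprn_gt0.
have i2 : 0 < 2 / s ^+ 2 by rewrite divr_gt0// exprn_gt0.
have -> : 2 * K2 = 2 / s ^+ 6 * (K2 * s ^+ 6) by field; rewrite gt_eqF.
have -> : 2 * K0 = 2 / s ^+ 2 * (K0 * s ^+ 2) by field; rewrite gt_eqF.
by rewrite lerD// ler_pM2l.
Qed.

Lemma gauss_error (psi theta : R) : `|psi| <= r1 -> `|theta| <= r2 ->
  \sum_(m <- iota 1 M) 2 * (fermi t m * `|phi psi theta m| ^+ 3)
  <= (8 * K3 + 8 * (512 * K0)) * (L ^+ 3 / s).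
Proof.
move=> hp ht; have L0 : 0 < L by exact: lt_le_trans ltr01 L1.
have r10 : 0 <= r1 by exact: le_trans (normr_ge0 _) hp.
have r20 : 0 <= r2 by exact: le_trans (normr_ge0 _) ht.
apply: (@le_trans _ _ (\sum_(m <- iota 1 M) expR (- (t * m%:R))
    * (8 * (m%:R ^+ 3 * r1 ^+ 3) + 8 * r2 ^+ 3))).
  apply: ler_sum => m _.
  have /andP[p0 p1] := fermi_itv t m; have pe := fermi_le t m.
  rewrite mulrCA; apply: ler_pM => //.
  have c := cube_add_le (m%:R * psi) ((sgn m)%:~R * theta).
  have a1 : `|m%:R * psi| ^+ 3 <= m%:R ^+ 3 * r1 ^+ 3.
    rewrite -exprMn; apply: lerXn2r; rewrite ?nnegrE ?normr_ge0//.
      by apply: mulr_ge0.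
    by rewrite normrM ger0_norm ?ler0n// ler_wpM2l.
  have a2 : `|(sgn m)%:~R * theta| ^+ 3 <= r2 ^+ 3.
    apply: lerXn2r; rewrite ?nnegrE ?normr_ge0//.
    apply: le_trans ht; rewrite -(ler_pXn2r (n := 2)) ?nnegrE//.
    by rewrite !real_normK ?num_real// eps_sqr_le.
  rewrite /phase; lra.
have -> : \sum_(m <- iota 1 M) expR (- (t * m%:R)) * (8 * (m%:R ^+ 3 * r1 ^+ 3) + 8 * r2 ^+ 3)
  = 8 * r1 ^+ 3 * (\sum_(m <- iota 1 M) m%:R ^+ 3 * expR (- (t * m%:R)))
    + 8 * r2 ^+ 3 * (\sum_(m <- iota 1 M) expR (- (t * m%:R))).
  by rewrite !mulr_sumr -big_split; apply: eq_bigr => m _ /=; ring.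
have i1 : 0 <= 8 * r1 ^+ 3 by rewrite mulr_ge0// exprn_ge0.
have i2 : 0 <= 8 * r2 ^+ 3 by rewrite mulr_ge0// exprn_ge0.
have -> : (8 * K3 + 8 * (512 * K0)) * (L ^+ 3 / s)
  = 8 * r1 ^+ 3 * (K3 * s ^+ 8) + 8 * r2 ^+ 3 * (K0 * s ^+ 2) by field; rewrite gt_eqF.
by rewrite lerD// ler_wpM2l.
Qed.

(** Inside the wide box the transform differs from the real product of the [gauss_factor] by the
    cubic errors of [gauss_error] and by the phase of [mean_pd], which accounts for the final [+ 8].
    That product is nonnegative, and bounded below on the natural box. Outside, only the minor arc
    bound is used. *)
Lemma centre_pointwise (psi theta : R) : `|psi| <= pi -> `|theta| <= pi ->
  expR (- (2 * K2 + 2 * K0)) * box (1 / s ^+ 3) (1 / s) psi theta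
    - (8 * K3 + 8 * (512 * K0) + 8) * (L ^+ 3 / s) * box r1 r2 psi theta - E
  <= complex.Re (cis (- dotp psi theta (n%:Z, 0))
                 * cf (prob t) (parts N alpha beta M) psi theta).
Proof.
move=> hp ht; have L0 : 0 < L by exact: lt_le_trans ltr01 L1.
have E0 : 0 <= E by exact: expR_ge0.
set z := cis _ * _.
have zB : normc z <= box r1 r2 psi theta + E.
  rewrite /z ComplexField.Normc.normcM normc_cis mul1r.
  exact: (cf_parts_box N alpha beta hN ha hb hneq L s t M L1 s0 Ls t0 ts sM).
have Rez : - normc z <= complex.Re z.
  by have := Re_le_normc z; rewrite ler_norml => /andP[].
have [/andP[bp bt]|nb] := boolP ((`|psi| <= r1) && (`|theta| <= r2)); last first.
  have b0 : box r1 r2 psi theta = 0 by rewrite /box (negbTE nb).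
  have b1 : box (1 / s ^+ 3) (1 / s) psi theta = 0.
    rewrite /box; case: andP => // -[h1 h2]; move: nb; apply: contraNeq => _.
    apply/andP; split.
      by apply: le_trans h1 _; rewrite ler_pM2r ?invr_gt0 ?exprn_gt0.
    apply: le_trans h2 _; rewrite mulrA ler_pM2r ?invr_gt0//.
    by have := L1; lra.
  by rewrite b0 b1 !mulr0 subr0 sub0r; rewrite b0 add0r in zB; lra.
have -> : box r1 r2 psi theta = 1 by rewrite /box bp bt.
rewrite mulr1.
set W := \prod_(m <- iota 1 M) (bernoulli_cf (fermi t m) (phi psi theta m)
                           * cis (- (fermi t m * phi psi theta m))).
pose V := \prod_(m <- iota 1 M) gauss_factor psi theta m.
have V01 m : 0 <= gauss_factor psi theta m <= 1.
  by have := gauss_small psi theta m bp bt; rewrite /gauss_factor => /andP[]; lra.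
have V0 : expR (- (2 * K2 + 2 * K0)) * box (1 / s ^+ 3) (1 / s) psi theta <= V.
  rewrite /box; case: andP => [[h1 h2]|_]; first by rewrite mulr1; exact: gauss_prod_ge.
  by rewrite mulr0; apply: prodr_ge0 => m _; have /andP[] := V01 m.
have f1 m : normc (bernoulli_cf (fermi t m) (phi psi theta m)
                           * cis (- (fermi t m * phi psi theta m))) <= 1.
  rewrite ComplexField.Normc.normcM normc_cis mulr1.
  apply: le_trans (normc_bernoulli_cf _ _ (fermi_itv t m)) _.
  have /andP[p0 p1] := fermi_itv t m.
  by rewrite expR_le1 oppr_le0 mulr_ge0 ?vers_ge0// mulr_ge0// subr_ge0.
have VC : (V%:C)%C = \prod_(m <- iota 1 M) ((gauss_factor psi theta m)%:C)%C.
  by rewrite /V rmorph_prod.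
have D1 : normc (W - V%:C%C) <= (8 * K3 + 8 * (512 * K0)) * (L ^+ 3 / s).
  have g1 m : normc ((gauss_factor psi theta m)%:C)%C <= 1.
    by rewrite normc_real; have /andP[v0 v1] := V01 m; rewrite ger0_norm.
  have P := normc_prod_sub _ (iota 1 M)
    (fun m => bernoulli_cf (fermi t m) (phi psi theta m) * cis (- (fermi t m * phi psi theta m)))
    (fun m => ((gauss_factor psi theta m)%:C)%C) f1 g1.
  rewrite VC; apply: le_trans P _.
  apply: le_trans (gauss_error psi theta bp bt).
  by apply: ler_sum => m _; apply: normc_bernoulli_taylor; exact: fermi_itv.
have W1 : normc W <= 1.
  by rewrite normc_prod; apply: prodr_ile1 => m; rewrite normc_ge0 f1.
have zE : z - V%:C%C = (W - V%:C%C) + W * (cis (mean_pd t M * theta) - 1).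
  by rewrite /z cf_centred -/W; ring.
have D2 : normc (W * (cis (mean_pd t M * theta) - 1)) <= 8 * (L ^+ 3 / s).
  rewrite ComplexField.Normc.normcM.
  apply: (@le_trans _ _ (1 * (1 * r2))).
    apply: ler_pM => //; try exact: normc_ge0.
    apply: le_trans (normc_cis_sub1 _) _; rewrite normrM.
    by apply: ler_pM => //; exact: mean_pd_le.
  rewrite !mul1r ler_pM2l// ler_pM2r ?invr_gt0//.
  by rewrite -[leLHS]expr1; exact: ler_weXn2l.
have D3 : normc (z - V%:C%C) <= (8 * K3 + 8 * (512 * K0) + 8) * (L ^+ 3 / s).
  by rewrite zE mulrDl; apply: le_trans (le_normcD _ _) _; exact: lerD.
have ReV : complex.Re z = V + complex.Re (z - V%:C%C).
  by rewrite -{1}(subrK (V%:C%C) z) ReD addrC.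
have := Re_le_normc (z - V%:C%C); rewrite ler_norml => /andP[h _].
rewrite ReV; lra.
Qed.

Lemma mass_centre_ge :
  expR (- (2 * K2 + 2 * K0)) * (1 / s ^+ 3 * (1 / s) / 100)
    - (8 * K3 + 8 * (512 * K0) + 8) * (L ^+ 3 / s) * (r1 * r2) - E
  <= mass N alpha beta t M (n%:Z, 0).
Proof.
have [h1 h2 hr] := arc_radii N hN L s L1 s0 Ls.
have L0 : 0 < L by exact: lt_le_trans ltr01 L1.
have pi2 := @pi_ge2 R.
have s1 : 1 <= s by move: hr; rewrite ler_pdivrMr//; have := L1; lra.
have h3 : 0 < 1 / s ^+ 3 <= pi.
  rewrite divr_gt0 ?exprn_gt0//=; apply: (@le_trans _ _ 1); last by lra.
  by rewrite ler_pdivrMr ?exprn_gt0// mul1r exprn_ege1.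
have h4 : 0 < 1 / s <= pi.
  rewrite divr_gt0//=; apply: (@le_trans _ _ 1); last by lra.
  by rewrite ler_pdivrMr// mul1r.
apply: (mass_ge _ _ _ _ _ _ _ _ _ _ h1 h2 h3 h4 (expR_ge0 _) _ centre_pointwise).
apply: mulr_ge0; last by apply: divr_ge0; [apply: exprn_ge0|]; exact: ltW.
have S0 : 0 <= K0 * s ^+ 2.
  by apply: le_trans sum0; apply: sumr_ge0 => m _; exact: expR_ge0.
have S3 : 0 <= K3 * s ^+ 8.
  by apply: le_trans sum3; apply: sumr_ge0 => m _; rewrite mulr_ge0 ?expR_ge0 ?exprn_ge0.
rewrite pmulr_lge0 ?exprn_gt0// in S0; rewrite pmulr_lge0 ?exprn_gt0// in S3.
lra.
Qed.

End CentreBound.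
End Centre.

(* Hofbauer's proof of the Basel problem: [1 / sin x ^ 2] is the mean of
   [1 / sin (x / 2) ^ 2] and [1 / cos (x / 2) ^ 2] up to a factor 2. *)
Section Basel.
Context {R : realType}.
Implicit Types x y : R.

Definition odd_angle (n k : nat) : R := (2 * k%:R + 1) * pi / (4 * 2 ^+ n).

Definition csc_sum (n : nat) : R := \sum_(k < 2 ^ n) (sin (odd_angle n k) ^+ 2)^-1.

Lemma odd_angle_itv n k : (k < 2 ^ n)%N -> 0 < odd_angle n k < pi / 2.
Proof.
move=> kn; have pi0 := @pi_gt0 R; have p2 : 0 < 2 ^+ n :> R by rewrite exprn_gt0.
have k0 := ler0n R k; rewrite /odd_angle; apply/andP; split.
  by rewrite divr_gt0 ?mulr_gt0//; lra.
have h : k%:R + 1 <= 2 ^+ n :> R by rewrite natr1 -natrX ler_nat.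
have -> : pi / 2 = (2 * 2 ^+ n) * pi / (4 * 2 ^+ n) :> R.
  by move: pi => q; field; rewrite gt_eqF.
by rewrite ltr_pM2r ?invr_gt0 ?mulr_gt0// ltr_pM2r//; lra.
Qed.

Lemma csc_double y : sin y != 0 -> cos y != 0 ->
  (sin y ^+ 2)^-1 + (cos y ^+ 2)^-1 = 4 * (sin (y *+ 2) ^+ 2)^-1.
Proof.
move=> s0 c0; rewrite sin_mulr2n -mulr_natl; have := cos2Dsin2 y.
set c := cos y in c0 *; set s := sin y in s0 *; move=> h.
have -> : (s ^+ 2)^-1 + (c ^+ 2)^-1 = (c ^+ 2 + s ^+ 2) / (c * s) ^+ 2.
  by field; rewrite s0 c0.
by rewrite h; field; rewrite s0 c0.
Qed.

(** The angles of level [n + 1] come in pairs [y] and [pi / 2 - y], with [2 y] an angle of level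
    [n]; reversing the upper half of the sum exhibits the pairs for [csc_double]. *)
Lemma csc_sumS n : csc_sum n.+1 = 4 * csc_sum n.
Proof.
have pi0 := @pi_gt0 R.
pose F k : R := (sin (odd_angle n.+1 k) ^+ 2)^-1.
rewrite /csc_sum mulr_sumr -(big_mkord xpredT F) expnS mul2n -addnn.
rewrite (big_cat_nat (n := 2 ^ n)) ?leq_addr//=.
rewrite -[in X in _ + X](add0n (2 ^ n)%N) big_addn addnK add0n.
rewrite [X in _ + X]big_nat_rev /= !big_mkord -big_split /=; apply: eq_bigr => k _.
have /andP[x0 x1] := odd_angle_itv n k (ltn_ord k).
set y := odd_angle n k / 2.
have y0 : 0 < y by rewrite /y; lra.
have y1 : y < pi / 2 by rewrite /y; lra.
have e1 : odd_angle n.+1 k = y.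
  rewrite /y /odd_angle exprS; move: pi => q; have p2 : 2 ^+ n != 0 :> R by rewrite expf_neq0.
  by field.
have e2 : odd_angle n.+1 (0 + 2 ^ n - k.+1 + 2 ^ n)%N = pi / 2 - y.
  have h : (0 + 2 ^ n - k.+1 + 2 ^ n)%:R = 2 * 2 ^+ n - k%:R - 1 :> R.
    rewrite add0n natrD natrB ?ltn_ord// natrX -natr1; ring.
  rewrite /odd_angle h /y /odd_angle exprS; move: pi => q.
  have p2 : 2 ^+ n != 0 :> R by rewrite expf_neq0.
  by field.
have sh : sin (pi / 2 - y) = cos y by rewrite addrC sinDpihalf cosN.
have yy : y *+ 2 = odd_angle n k by rewrite mulr2n -splitr.
rewrite /F e1 e2 sh csc_double ?yy//.
- by rewrite gt_eqF// sin_gt0_pihalf// y0.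
- by rewrite gt_eqF// cos_gt0_pihalf// y1 andbT; lra.
Qed.

Lemma csc_sumE n : csc_sum n = 2 * 4 ^+ n.
Proof.
elim: n => [|n IH]; last by rewrite csc_sumS IH exprS; ring.
rewrite /csc_sum big_ord1 expr0 mulr1 /odd_angle mulr0 add0r mul1r expr0 mulr1.
have := cos2Dsin2 (pi / 4 : R).
have -> : cos (pi / 4) = sin (pi / 4) :> R.
  rewrite -cosBpihalf -cosN; congr cos; move: pi => q; by field.
move=> h; have -> : sin (pi / 4) ^+ 2 = 1 / 2 :> R by lra.
by field.
Qed.

Lemma csc_bounds x : 0 < x < pi / 2 ->
  (x ^+ 2)^-1 <= (sin x ^+ 2)^-1 <= (x ^+ 2)^-1 + 2.
Proof.
move=> /andP[x0 x1]; have x2 : x < 2 by have := @pihalf_lt2 R; lra.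
have s0 : 0 < sin x by rewrite sin_gt0_pihalf// x0.
have sx := sin_le _ (ltW x0); have sg := sin_ge _ (ltW x0).
apply/andP; split.
  by rewrite lef_pV2 ?posrE ?exprn_gt0// lerXn2r ?nnegrE// ltW.
pose u := x ^+ 2 / 6.
have u0 : 0 <= u by rewrite divr_ge0 ?sqr_ge0.
have u1 : u <= 2 / 3 by rewrite /u; nra.
have su : x * (1 - u) <= sin x by have -> : x * (1 - u) = x - x ^+ 3 / 6 by rewrite /u; ring.
have xu : 0 < x * (1 - u) by rewrite mulr_gt0//; lra.
apply: (@le_trans _ _ ((x * (1 - u)) ^+ 2)^-1).
  by rewrite lef_pV2 ?posrE ?exprn_gt0// lerXn2r ?nnegrE// ltW.
have -> : (x ^+ 2)^-1 + 2 = (1 + 12 * u) / x ^+ 2 by rewrite /u; field; rewrite gt_eqF.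
rewrite exprMn invfM mulrC ler_pM2r ?invr_gt0 ?exprn_gt0//.
have v0 : 0 < (1 - u) ^+ 2 by rewrite exprn_gt0//; lra.
rewrite -[(_ ^+ 2)^-1]mul1r ler_pdivrMr//.
(* The quadratic factors as [(2 - 3 u) (5 - 4 u)], nonnegative for [u <= 2 / 3]. *)
have -> : (1 + 12 * u) * (1 - u) ^+ 2 = 1 + u * (10 - 23 * u + 12 * u ^+ 2) by ring.
by rewrite lerDl mulr_ge0//; nra.
Qed.

Definition odd_sum (n : nat) : R := \sum_(k < n) ((2 * k%:R + 1) ^+ 2)^-1.

(** Replacing each [1 / sin ^ 2] in [csc_sum] by [1 / x ^ 2] costs at most 2 per term, against a sum
    that grows like [4 ^ n] with [2 ^ n] terms. *)
Lemma odd_sum_bounds n : `|odd_sum (2 ^ n) - pi ^+ 2 / 8| <= 2 / 2 ^+ n.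
Proof.
have pi0 := @pi_gt0 R; have p2 : 0 < 2 ^+ n :> R by rewrite exprn_gt0.
have E : \sum_(k < 2 ^ n) (odd_angle n k ^+ 2)^-1
    = 16 * (2 ^+ n) ^+ 2 / pi ^+ 2 * odd_sum (2 ^ n).
  rewrite /odd_sum mulr_sumr; apply: eq_bigr => k _; rewrite /odd_angle.
  have k0 : 2 * k%:R + 1 != 0 :> R by rewrite gt_eqF//; have := ler0n R k; lra.
  have pn : pi != 0 :> R by rewrite gt_eqF.
  move: pi pn => q qn; field; by rewrite k0 qn gt_eqF.
have U : \sum_(k < 2 ^ n) (odd_angle n k ^+ 2)^-1 <= csc_sum n.
  by apply: ler_sum => k _; have /andP[] := csc_bounds _ (odd_angle_itv n k (ltn_ord k)).
have Lo : csc_sum n <= \sum_(k < 2 ^ n) (odd_angle n k ^+ 2)^-1 + 2 * 2 ^+ n.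
  apply: (@le_trans _ _ (\sum_(k < 2 ^ n) ((odd_angle n k ^+ 2)^-1 + 2))).
    by apply: ler_sum => k _; have /andP[] := csc_bounds _ (odd_angle_itv n k (ltn_ord k)).
  by rewrite big_split /= sumr_const card_ord -natrX mulr_natr.
rewrite csc_sumE E in U Lo.
have f4 : 4 ^+ n = (2 ^+ n) ^+ 2 :> R by rewrite -exprM mulnC exprM; congr (_ ^+ n); ring.
rewrite f4 in U Lo; set a := 2 ^+ n in p2 U Lo *; set O := odd_sum _ in U Lo *.
have pp : 0 < pi ^+ 2 :> R by rewrite exprn_gt0.
have pi16 : pi ^+ 2 <= 16 :> R.
  have : pi < 4 :> R by have := @pihalf_lt2 R; lra.
  nra.
have c0 : 0 < pi ^+ 2 / (16 * a ^+ 2) :> R by rewrite divr_gt0// mulr_gt0// exprn_gt0.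
have U' : O <= pi ^+ 2 / 8.
  have := ler_wpM2l (ltW c0) U; move: pp; move: (pi ^+ 2) => q q0.
  have -> : q / (16 * a ^+ 2) * (16 * a ^+ 2 / q * O) = O by field; rewrite !gt_eqF.
  by have -> : q / (16 * a ^+ 2) * (2 * a ^+ 2) = q / 8 by field; rewrite gt_eqF.
have L' : pi ^+ 2 / 8 <= O + pi ^+ 2 / (8 * a).
  have := ler_wpM2l (ltW c0) Lo; move: pp; move: (pi ^+ 2) => q q0.
  have -> : q / (16 * a ^+ 2) * (16 * a ^+ 2 / q * O + 2 * a) = O + q / (8 * a).
    by field; rewrite !gt_eqF.
  by have -> : q / (16 * a ^+ 2) * (2 * a ^+ 2) = q / 8 by field; rewrite gt_eqF.
have B : pi ^+ 2 / (8 * a) <= 2 / a.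
  have -> : pi ^+ 2 / (8 * a) = pi ^+ 2 / 8 / a :> R by rewrite invfM mulrA.
  by rewrite ler_pM2r ?invr_gt0//; lra.
have a0 : 0 < 2 / a by rewrite divr_gt0.
by rewrite ler_norml; apply/andP; split; lra.
Qed.

Definition zeta2_sum (n : nat) : R := \sum_(k < n) (k.+1%:R ^+ 2)^-1.

Definition eta2_sum (n : nat) : R := \sum_(k < n) (-1) ^+ k * (k.+1%:R ^+ 2)^-1.

Lemma sum_even_odd (F : nat -> R) n :
  \sum_(k < n.*2) F k = \sum_(k < n) F k.*2 + \sum_(k < n) F k.*2.+1.
Proof.
elim: n => [|n IH]; first by rewrite !big_ord0 addr0.
by rewrite doubleS !big_ord_recr /= IH; ring.
Qed.

Lemma zeta2_sum_double n : zeta2_sum n.*2 = odd_sum n + zeta2_sum n / 4.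
Proof.
rewrite /zeta2_sum (sum_even_odd (fun k => (k.+1%:R ^+ 2)^-1)) mulr_suml.
congr (_ + _); apply: eq_bigr => k _.
  by rewrite -natr1 -mul2n natrM.
by rewrite -doubleS -mul2n natrM exprMn invfM mulrC; congr (_ * _); field.
Qed.

Lemma eta2_sum_double n : eta2_sum n.*2 = odd_sum n - zeta2_sum n / 4.
Proof.
rewrite /eta2_sum (sum_even_odd (fun k => (-1) ^+ k * (k.+1%:R ^+ 2)^-1)) mulr_suml -sumrN.
congr (_ + _); apply: eq_bigr => k _.
  by rewrite -natr1 -mul2n natrM exprM sqrrN expr1n expr1n mul1r.
rewrite exprS -[X in (-1) ^+ X]mul2n exprM sqrrN expr1n expr1n mulr1 mulN1r.
by rewrite -doubleS -mul2n natrM exprMn invfM mulrC; congr (- (_ * _)); field.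
Qed.

(** Separating even and odd terms gives a recursion contracting by 4, whose fixed point is
    [pi ^ 2 / 6] because [pi ^ 2 / 8 = (3 / 4) pi ^ 2 / 6]. *)
Lemma zeta2_sum_bounds n : `|zeta2_sum (2 ^ n) - pi ^+ 2 / 6| <= 8 / 2 ^+ n.
Proof.
have pi4 : pi < 4 :> R by have := @pihalf_lt2 R; lra.
have pi2 := @pi_ge2 R; have p4 : 4 <= (pi : R) ^+ 2 <= 16 by apply/andP; split; nra.
elim: n => [|n IH].
  rewrite expn0 /zeta2_sum big_ord1 expr1n expr0 invr1 mulr1.
  by move: p4 => /andP[]; rewrite ler_norml => h1 h2; apply/andP; split; lra.
rewrite expnS mul2n zeta2_sum_double.
have h := odd_sum_bounds n; rewrite [2 ^+ n.+1]exprS.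
have -> : 8 / (2 * 2 ^+ n) = 2 / 2 ^+ n + 8 / 2 ^+ n / 4 :> R by field; rewrite expf_neq0.
have -> : odd_sum (2 ^ n) + zeta2_sum (2 ^ n) / 4 - pi ^+ 2 / 6
  = (odd_sum (2 ^ n) - pi ^+ 2 / 8) + (zeta2_sum (2 ^ n) - pi ^+ 2 / 6) / 4.
  by move: (pi ^+ 2) => q; field.
apply: le_trans (ler_normD _ _) _; apply: lerD => //.
by rewrite normrM [`|4^-1|]gtr0_norm// ler_pM2r.
Qed.

Lemma eta2_sum_bounds n : `|eta2_sum (2 ^ n).*2 - pi ^+ 2 / 12| <= 4 / 2 ^+ n.
Proof.
have h1 := odd_sum_bounds n; have h2 := zeta2_sum_bounds n.
rewrite eta2_sum_double.
have -> : odd_sum (2 ^ n) - zeta2_sum (2 ^ n) / 4 - pi ^+ 2 / 12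
  = (odd_sum (2 ^ n) - pi ^+ 2 / 8) - (zeta2_sum (2 ^ n) - pi ^+ 2 / 6) / 4.
  by move: (pi ^+ 2) => q; field.
have -> : 4 / 2 ^+ n = 2 / 2 ^+ n + 8 / 2 ^+ n / 4 :> R by field; rewrite expf_neq0.
apply: le_trans (ler_normB _ _) _; apply: lerD => //.
by rewrite normrM [`|4^-1|]gtr0_norm// ler_pM2r.
Qed.

End Basel.

(** * Existence and size of the saddle point *)

Section Saddle.
Context {R : realType}.
Implicit Types (t y s : R) (M K : nat).

Definition geo_moment y M : R := \sum_(m <- iota 1 M) m%:R * expR (- (y * m%:R)).

Lemma iota1S M : iota 1 M.+1 = iota 1 M ++ [:: M.+1].
Proof. by rewrite -(addn1 M) iotaD add1n addn1. Qed.

Lemma geo_moment_ge0 y M : 0 <= geo_moment y M.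
Proof. by apply: sumr_ge0 => m _; rewrite mulr_ge0 ?expR_ge0. Qed.

Lemma geo_momentE y M (z := expR (- y)) : (1 - z) ^+ 2 * geo_moment y M
  = z - M.+1%:R * z ^+ M.+1 + M%:R * z ^+ M.+2.
Proof.
have E m : expR (- (y * m%:R)) = z ^+ m by rewrite -expRM_natr mulNr.
elim: M => [|M IH].
  by rewrite /geo_moment big_nil mulr0 mul1r expr1 mul0r addr0 subrr.
rewrite /geo_moment iota1S big_cat big_seq1 /= mulrDr [X in X + _]IH E -!natr1 !exprS; ring.
Qed.

Lemma sinh_ge x : 0 <= x -> 2 * x <= expR x - expR (- x) :> R.
Proof.
move=> x0; rewrite -subr_ge0.
have -> : (0 : R) = expR 0 - expR (- 0) - 2 * 0 by rewrite oppr0 subrr mulr0 subr0.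
apply: (ge0_of_derive (fun x => expR x - expR (- x) - 2 * x) (fun x => expR x + expR (- x) - 2)) => //.
  move=> z; apply: is_derive_eq; rewrite /GRing.scale /=; by ring.
by move=> z _; have := expR_ge1Dx z; have := expR_ge1Dx (- z); lra.
Qed.

(** The full series is [z / (1 - z) ^ 2 = 1 / (2 sinh (y / 2)) ^ 2] with [z = exp (- y)], and
    [2 sinh (y / 2) >= y]. *)
Lemma geo_moment_le y M : 0 < y -> y ^+ 2 * geo_moment y M <= 1.
Proof.
move=> y0; have U0 := geo_moment_ge0 y M; have := geo_momentE y M => /=.
set z := expR (- y) => E; have z0 : 0 < z by exact: expR_gt0.
have H : (1 - z) ^+ 2 * geo_moment y M <= z.
  rewrite E -addrA gerDl.
  have z1 : z <= 1 by rewrite expR_le1 oppr_le0 ltW.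
  have p0 : 0 <= z ^+ M.+1 by rewrite exprn_ge0// ltW.
  rewrite [z ^+ M.+2]exprS -natr1; have := ler0n R M.
  set a := M%:R; set b := z ^+ M.+1 in p0 * => a0.
  have : a * (z * b) <= a * b by rewrite ler_wpM2l// ler_piMl.
  by lra.
have S : y <= expR (y / 2) - expR (- (y / 2)).
  have h : 0 <= y / 2 by rewrite divr_ge0// ltW.
  by have := sinh_ge _ h; lra.
have zE : (1 - z) ^+ 2 = z * (expR (y / 2) - expR (- (y / 2))) ^+ 2.
  have -> : z = expR (- (y / 2)) ^+ 2 by rewrite -expRM_natl /z; congr expR; field.
  rewrite -exprMn mulrBr -!expRD; congr ((_ - _) ^+ 2).
    by rewrite addNr expR0.
  by rewrite -expRM_natl; congr expR; field.
have S2 : y ^+ 2 <= (expR (y / 2) - expR (- (y / 2))) ^+ 2.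
  by apply: lerXn2r => //; rewrite nnegrE; [exact: ltW|apply: le_trans S; exact: ltW].
rewrite -(ler_pM2l z0) mulr1 mulrA; apply: le_trans H; rewrite zE.
by rewrite ler_wpM2r// ler_pM2l.
Qed.

Lemma geo_moment_ge y M : 0 < y ->
  1 - y - M.+1%:R * expR (- (y * M.+1%:R)) <= y ^+ 2 * geo_moment y M.
Proof.
move=> y0; have U0 := geo_moment_ge0 y M; have := geo_momentE y M => /=.
have -> : expR (- (y * M.+1%:R)) = expR (- y) ^+ M.+1 by rewrite -expRM_natr mulNr.
set z := expR (- y) => E; have z0 : 0 < z by exact: expR_gt0.
have z1 : z <= 1 by rewrite expR_le1 oppr_le0 ltW.
have zy : 1 - y <= z by exact: expR_ge1Dx.
apply: (@le_trans _ _ ((1 - z) ^+ 2 * geo_moment y M)).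
  rewrite E; have : 0 <= M%:R * z ^+ M.+2 by rewrite mulr_ge0// exprn_ge0// ltW.
  by lra.
rewrite ler_wpM2r//; apply: lerXn2r; rewrite ?nnegrE ?subr_ge0//; first exact: ltW.
by lra.
Qed.

Lemma fermi_expansion (x : R) K : 0 < x ->
  x / (1 + x) = \sum_(k < K) (-1) ^+ k * x ^+ k.+1 + (-1) ^+ K * (x ^+ K.+1 / (1 + x)).
Proof.
move=> x0; have xn : 1 + x != 0 by rewrite gt_eqF// addr_gt0.
elim: K => [|K IH]; first by rewrite big_ord0 add0r mul1r expr1.
by rewrite big_ord_recr /= IH -addrA; congr (_ + _); rewrite [(-1) ^+ K.+1]exprS [x ^+ K.+2]exprS; field.
Qed.

Lemma mean_size_expansion t M K : 0 < t ->
  `|mean_size t M - \sum_(k < K) (-1) ^+ k * geo_moment (k.+1%:R * t) M|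
  <= geo_moment (K.+1%:R * t) M.
Proof.
move=> t0; have E (k m : nat) : expR (- (t * m%:R)) ^+ k = expR (- (k%:R * t * m%:R)).
  by rewrite -expRM_natl mulrN mulrA.
have -> : \sum_(k < K) (-1) ^+ k * geo_moment (k.+1%:R * t) M
  = \sum_(m <- iota 1 M) m%:R * \sum_(k < K) (-1) ^+ k * expR (- (t * m%:R)) ^+ k.+1.
  under [RHS]eq_bigr do rewrite mulr_sumr.
  rewrite exchange_big /=; apply: eq_bigr => k _; rewrite mulr_sumr.
  by apply: eq_bigr => m _; rewrite E; ring.
rewrite /mean_size -sumrB; apply: le_trans (ler_norm_sum _ _ _) _.
apply: ler_sum => m _; rewrite -mulrBr normrM ger0_norm// ler_wpM2l//.
have x0 := expR_gt0 (- (t * m%:R)).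
rewrite /fermi (fermi_expansion _ K x0) addrAC subrr add0r normrM normrX normrN1 expr1n mul1r.
rewrite -E ger0_norm; last by rewrite divr_ge0 ?exprn_ge0 ?addr_ge0 ?ltW.
by rewrite ler_pdivrMr ?addr_gt0// ler_peMr ?exprn_ge0 ?ltW// ltrDl.
Qed.

(** The alternating expansion of [fermi] writes the mean size through moments of geometric series at
    [(k + 1) t], each about [1 / ((k + 1) t) ^ 2]. [K] stays fixed while [t] tends to 0; the last
    term bounds the truncation. *)
Lemma mean_size_asymp t M K : 0 < t ->
  `|t ^+ 2 * mean_size t M - eta2_sum K|
  <= K%:R * (K%:R * t + M.+1%:R * expR (- (t * M.+1%:R))) + 1 / K.+1%:R ^+ 2.
Proof.
move=> t0; have t2 : 0 < t ^+ 2 by rewrite exprn_gt0.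
pose g k := (k.+1%:R * t) ^+ 2 * geo_moment (k.+1%:R * t) M.
have kt k : 0 < k.+1%:R * t by rewrite mulr_gt0.
have g1 k : g k <= 1 by exact: geo_moment_le.
have gE k : t ^+ 2 * geo_moment (k.+1%:R * t) M = g k / k.+1%:R ^+ 2.
  have kn : k.+1%:R != 0 :> R by rewrite pnatr_eq0.
  by rewrite /g; move: kn; move: (geo_moment _ _) => u kn; field.
set e := M.+1%:R * _.
have ge k : (k < K)%N -> 1 - (K%:R * t + e) <= g k.
  move=> kK; apply: le_trans (geo_moment_ge _ M (kt k)); rewrite opprD addrA.
  apply: lerB.
    by rewrite lerB// ler_pM2r// ler_nat.
  have tM : 0 <= t * M.+1%:R by rewrite mulr_ge0// ltW.
  by rewrite ler_wpM2l// ler_expR lerN2 -mulrA ler_peMl ?ler1n.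
have A : `|t ^+ 2 * mean_size t M - \sum_(k < K) (-1) ^+ k * (g k / k.+1%:R ^+ 2)|
    <= 1 / K.+1%:R ^+ 2.
  have := mean_size_expansion t M K t0; rewrite -(ler_pM2l t2) gE => h.
  apply: (@le_trans _ _ (g K / K.+1%:R ^+ 2)); last first.
    by rewrite ler_pM2r ?invr_gt0 ?exprn_gt0.
  have E2 : \sum_(k < K) (-1) ^+ k * (g k / k.+1%:R ^+ 2)
      = t ^+ 2 * \sum_(k < K) (-1) ^+ k * geo_moment (k.+1%:R * t) M.
    by rewrite mulr_sumr; apply: eq_bigr => k _; rewrite -gE mulrCA.
  by apply: le_trans h; rewrite E2 -mulrBr normrM (gtr0_norm t2).
have B : `|\sum_(k < K) (-1) ^+ k * (g k / k.+1%:R ^+ 2) - eta2_sum K| <= K%:R * (K%:R * t + e).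
  rewrite /eta2_sum -sumrB; apply: le_trans (ler_norm_sum _ _ _) _.
  apply: (@le_trans _ _ (\sum_(k < K) (K%:R * t + e))); last first.
    by rewrite sumr_const card_ord [leRHS]mulr_natl.
  apply: ler_sum => k _.
  have -> : (-1) ^+ k * (g k / k.+1%:R ^+ 2) - (-1) ^+ k * (k.+1%:R ^+ 2)^-1
    = (-1) ^+ k * ((g k - 1) / k.+1%:R ^+ 2) by ring.
  rewrite normrM normrX normrN1 expr1n mul1r normrM distrC.
  have gk : 0 <= 1 - g k by rewrite subr_ge0.
  rewrite (ger0_norm gk) gtr0_norm ?invr_gt0 ?exprn_gt0//.
  apply: (@le_trans _ _ (1 - g k)); last by have := ge k (ltn_ord k); lra.
  have k1 : 1 <= k.+1%:R ^+ 2 :> R by rewrite exprn_ege1// ler1n.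
  by rewrite ler_pdivrMr ?exprn_gt0// ler_peMr.
apply: le_trans (ler_distD (\sum_(k < K) (-1) ^+ k * (g k / k.+1%:R ^+ 2)) _ _) _.
by rewrite addrC; apply: lerD.
Qed.

Lemma continuous_fermi m : continuous (fun t : R => fermi t m).
Proof.
move=> t; have c : {for t, continuous (fun t : R => expR (- (t * m%:R)))}.
  apply: continuous_comp; last exact: continuous_expR.
  apply: continuousN; apply: continuousM; [exact: id|exact: cst_continuous].
rewrite /fermi; apply: cvgM; first exact: c.
apply: cvgV; first by rewrite gt_eqF// addr_gt0 ?expR_gt0.
by apply: cvgD; [exact: cvg_cst|exact: c].
Qed.

Lemma continuous_mean_size M : continuous (fun t : R => mean_size t M).
Proof.
elim: M => [|M IH] t.
  by rewrite /mean_size; under eq_fun do rewrite big_nil; exact: cst_continuous.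
have -> : (fun t : R => mean_size t M.+1)
    = (fun t => mean_size t M) \+ (fun t => M.+1%:R * fermi t M.+1).
  by apply/funext => u; rewrite /mean_size iota1S big_cat big_seq1.
apply: cvgD; first exact: IH.
by apply: cvgM; [exact: cvg_cst|exact: continuous_fermi].
Qed.

Lemma sum_iota1 M : \sum_(m <- iota 1 M) (m%:R : R) = M%:R * (M%:R + 1) / 2.
Proof.
elim: M => [|M IH]; first by rewrite big_nil mul0r mul0r.
by rewrite iota1S big_cat big_seq1 /= IH -natr1; field.
Qed.

Lemma saddle_exists s n M : 1 <= s -> s ^+ 4 = n%:R -> 6 * s ^+ 2 <= M%:R ->
  exists t, [/\ 0 < t, t * s ^+ 2 <= 1, 1 <= 6 * (t * s ^+ 2) & mean_size t M = n%:R].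
Proof.
move=> s1 sn sM; have s0 : 0 < s by exact: lt_le_trans ltr01 s1.
have S2 : 0 < s ^+ 2 by rewrite exprn_gt0.
have S21 : 1 <= s ^+ 2 by rewrite exprn_ege1.
pose a := 1 / (6 * s ^+ 2); pose b := 1 / s ^+ 2.
have a0 : 0 < a by rewrite divr_gt0// mulr_gt0.
have b0 : 0 < b by rewrite divr_gt0.
have ab : a <= b by rewrite /a /b ler_pM2l// lef_pV2 ?posrE ?mulr_gt0//; lra.
have fb : mean_size b M <= n%:R.
  rewrite -sn; have h := geo_moment_le b M b0.
  have : mean_size b M <= geo_moment b M.
    by apply: ler_sum => m _; rewrite ler_wpM2l// fermi_le.
  move: h; have -> : b ^+ 2 = (s ^+ 4)^-1 by rewrite /b; field; rewrite gt_eqF.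
  by rewrite mulrC ler_pdivrMr ?exprn_gt0// mul1r => h1 h2; exact: le_trans h2 h1.
(* For the parts up to [6 s ^ 2] the exponent is at most 1, so [fermi] is at least
   [(1 / 4) / (1 + 1 / 4) = 1 / 5]; their sum alone already exceeds [n]. *)
have fa : n%:R <= mean_size a M.
  rewrite -sn; pose X := Num.trunc (6 * s ^+ 2).
  have y0 : 0 <= 6 * s ^+ 2 by rewrite mulr_ge0// ltW.
  have /andP[X1 X2'] := trunc_itv y0; rewrite -/X in X1 X2'.
  have X2 : 6 * s ^+ 2 < X%:R + 1 by rewrite natr1.
  have XM : (X <= M)%N by rewrite -(ler_nat R); exact: le_trans X1 sM.
  rewrite /mean_size -(subnKC XM) iotaD big_cat /=.
  rewrite -[leLHS]addr0 lerD//; last first.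
    apply: sumr_ge0 => m _; rewrite mulr_ge0//.
    by have /andP[] := fermi_itv a m.
  apply: (@le_trans _ _ (\sum_(m <- iota 1 X) m%:R / 5)).
    rewrite -mulr_suml sum_iota1.
    have -> : s ^+ 4 = s ^+ 2 * s ^+ 2 by ring.
    by move: X1 X2 S21; set u := s ^+ 2; set v := X%:R; nra.
  rewrite big_seq [leRHS]big_seq; apply: ler_sum => m; rewrite mem_iota => /andP[_ mX].
  rewrite ler_wpM2l// /fermi.
  have am : a * m%:R <= 1.
    rewrite /a mulrAC ler_pdivrMr ?mulr_gt0// !mul1r; apply: le_trans X1.
    by rewrite ler_nat; clear -mX; lia.
  have : 1 / 4 <= expR (- (a * m%:R)).
    by apply: le_trans expRN1_ge _; rewrite ler_expR lerN2.
  set x := expR _ => x4; rewrite ler_pdivlMr; lra.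
have [t] : exists2 c, c \in `[a, b] & mean_size c M = n%:R.
  apply: (IVT (f := fun t => mean_size t M) ab).
    by apply: continuous_subspaceT; exact: continuous_mean_size.
  by rewrite ge_min le_max fa fb orbT.
rewrite in_itv /= => /andP[at' tb] tn; exists t; split => //.
- exact: lt_le_trans at'.
- by move: tb; rewrite /b ler_pdivlMr.
- by move: at'; rewrite /a ler_pdivrMr ?mulr_gt0//; lra.
Qed.

End Saddle.

(** * Solving the approximate recurrence *)

Section GaussianRecursion.
Context {R : realType}.

Lemma expRN_lin (z : R) : `|z| <= 1 / 2 -> `|expR (- z) - (1 - z)| <= 2 * z ^+ 2.
Proof.
rewrite ler_norml => /andP[z1 z2]; have h1 := expR_ge1Dx (- z).
rewrite ger0_norm; last by rewrite subr_ge0.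
have [z0|z0] := leP 0 z.
  by have := expRN_le _ z0; have := sqr_ge0 z; lra.
have h2 := expR_ge1Dx z; have e0 := expR_gt0 z.
have -> : expR (- z) = (expR z)^-1 by rewrite expRN.
rewrite lerBlDr -[(expR z)^-1]div1r ler_pdivrMr//.
have : (1 - z + 2 * z ^+ 2) * (1 + z) <= (2 * z ^+ 2 + (1 - z)) * expR z.
  by rewrite [2 * _ + _]addrC ler_wpM2l//; nra.
apply: le_trans; have -> : (1 - z + 2 * z ^+ 2) * (1 + z) = 1 + z ^+ 2 * (1 + 2 * z) by ring.
by rewrite lerDl mulr_ge0 ?sqr_ge0//; lra.
Qed.

Lemma expRN_le2 (z : R) : `|z| <= 1 / 2 -> expR (- z) <= 2.
Proof.
move=> hz; have := expRN_lin _ hz; move: hz; rewrite !ler_norml => /andP[z1 z2] /andP[_ h].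
have : z ^+ 2 <= 1 / 4 by nra.
lra.
Qed.

Definition gauss (t : R) (N c : nat) : R := expR (- (t * N%:R * c%:R ^+ 2 / 2)).

(** Linearising the exponential gives the recurrence assumed of [P], with [P c] in place of [P c.+1]
    on the right. *)
Lemma gauss_step (t : R) (N c : nat) :
  gauss t N c.+2 = gauss t N c * expR (- (2 * (t * (N%:R * c.+1%:R)))).
Proof. by rewrite /gauss -expRD; congr expR; rewrite -!natr1; field. Qed.

Lemma gauss_itv (t : R) (N c : nat) : 0 <= t -> 0 <= gauss t N c <= 1.
Proof.
by move=> t0; rewrite expR_ge0 expR_le1 oppr_le0 divr_ge0// !mulr_ge0// exprn_ge0.
Qed.

(** The natural order of [P] is [u ^ 80]; the widened arcs cost two powers. One step in [c] gains
    [u ^ 19], and the recurrence holds up to two such gains. The window [c <= u ^ (- 21)] is [1 / u]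
    times the natural width. *)
Variables (N : nat) (u t A C1 : R) (P : nat -> R).
Hypotheses (u0 : 0 < u) (u1 : u <= 1) (t0 : 0 < t) (tu : t <= u ^+ 40).
Hypothesis Nu : 4 * N%:R * u ^+ 19 <= 1.
Hypotheses (P_le : forall c, `|P c| <= A * u ^+ 78).
Hypothesis P_step : forall c, `|P c.+1 - P c| <= A * u ^+ 97.
Hypothesis P_rec : forall c : nat, c.+1%:R * u ^+ 21 <= 1 ->
  `|P c - P c.+2 - 2 * (t * (N%:R * c.+1%:R)) * P c.+1| <= C1 * u ^+ 116.

Lemma expn_antimono (i j : nat) : (i <= j)%N -> u ^+ j <= u ^+ i.
Proof. by move=> ij; rewrite ler_wiXn2l// ltW. Qed.

Lemma slope_le (c : nat) : c%:R * u ^+ 21 <= 1 -> 0 <= t * (N%:R * c%:R) <= N%:R * u ^+ 19.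
Proof.
move=> cu; apply/andP; split; first by rewrite !mulr_ge0// ltW.
have U19 : 0 <= u ^+ 19 by rewrite exprn_ge0// ltW.
apply: (@le_trans _ _ (u ^+ 40 * (N%:R * c%:R))).
  by rewrite ler_wpM2r// mulr_ge0.
have -> : u ^+ 40 = u ^+ 19 * u ^+ 21 by rewrite -exprD.
have -> : u ^+ 19 * u ^+ 21 * (N%:R * c%:R) = N%:R * u ^+ 19 * (c%:R * u ^+ 21) by ring.
by rewrite ler_piMr// mulr_ge0.
Qed.

Lemma const_ge0 : 0 <= A.
Proof.
have := le_trans (normr_ge0 _) (P_le 0); rewrite pmulr_lge0//; exact: exprn_gt0.
Qed.

Definition gauss_err_const : R := C1 + 2 * N%:R * A + 8 * N%:R ^+ 2 * A.

(** Induction in steps of two. The multiplier [1 - 2 y] lies in [[0, 1]], so errors accumulate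
    additively: that of the recurrence, that of replacing [P d.+1] by [P d], and that of linearising
    the exponential. The start [c = 0] is exact, and [c = 1] gives the first summand. *)
Lemma gauss_approx (c : nat) : c.-1%:R * u ^+ 21 <= 1 ->
  `|P c - P 0 * gauss t N c| <= (A + N%:R * A) * u ^+ 97 + c%:R * (gauss_err_const * u ^+ 116).
Proof.
have A0 := const_ge0; have U n : 0 <= u ^+ n by rewrite exprn_ge0// ltW.
have N0 := ler0n R N.
have C10 : 0 <= C1 * u ^+ 116.
  by apply: le_trans (P_rec 0 _); rewrite ?normr_ge0// mul1r -(expr0 u) expn_antimono.
have B0 : 0 <= gauss_err_const * u ^+ 116.
  rewrite /gauss_err_const !mulrDl; by repeat first [done|apply: addr_ge0|apply: mulr_ge0|apply: exprn_ge0].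
set B := gauss_err_const * _ in B0 *; set S := (A + N%:R * A) * u ^+ 97.
have S0 : 0 <= S by rewrite mulr_ge0// addr_ge0// mulr_ge0.
have base0 : `|P 0 - P 0 * gauss t N 0| <= S + 0%:R * B.
  by rewrite /gauss expr0n mulr0 mul0r oppr0 expR0 mulr1 subrr normr0 mul0r addr0.
have base1 : `|P 1 - P 0 * gauss t N 1| <= S + 1%:R * B.
  have -> : P 1%N - P 0%N * gauss t N 1 = (P 1%N - P 0%N) + P 0%N * (1 - gauss t N 1) by ring.
  apply: le_trans (ler_normD _ _) _; rewrite /S mulrDl -addrA.
  apply: lerD; first exact: P_step.
  rewrite mul1r -[leLHS]addr0; apply: lerD => //; rewrite normrM.
  have /andP[g0 g1] := gauss_itv t N 1 (ltW t0).
  have g1' : 0 <= 1 - gauss t N 1 by rewrite subr_ge0.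
  rewrite (ger0_norm g1').
  have gl : 1 - gauss t N 1 <= N%:R * u ^+ 19.
    have := expR_ge1Dx (- (t * N%:R * 1 ^+ 2 / 2)); rewrite -/(gauss t N 1) expr1n mulr1 => h.
    have : t * N%:R <= u ^+ 19 * N%:R.
      by rewrite ler_wpM2r//; apply: le_trans tu (expn_antimono _ _ _).
    have : 0 <= t * N%:R by rewrite mulr_ge0// ltW.
    by move: h; rewrite [N%:R * u ^+ 19]mulrC; lra.
  apply: (@le_trans _ _ (A * u ^+ 78 * (N%:R * u ^+ 19))).
    by apply: ler_pM => //; exact: P_le.
  have -> : u ^+ 97 = u ^+ 78 * u ^+ 19 by rewrite -exprD.
  by rewrite le_eqVlt; apply/orP; left; apply/eqP; ring.
(* Two consecutive values are carried along, because the recurrence links [d] with [d + 2]. *)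
suff H : forall d, (d.-1%:R * u ^+ 21 <= 1 -> `|P d - P 0 * gauss t N d| <= S + d%:R * B)
    /\ (d%:R * u ^+ 21 <= 1 -> `|P d.+1 - P 0 * gauss t N d.+1| <= S + d.+1%:R * B).
  by have [] := H c.
elim=> [|d [IH1 IH2]]; first by split.
split => // hd.
have hd' : d.-1%:R * u ^+ 21 <= 1.
  apply: le_trans hd; rewrite ler_wpM2r// ler_nat; exact: leq_trans (leq_pred _) (leqnSn _).
have Dd := IH1 hd'.
set y := t * (N%:R * d.+1%:R).
have /andP[y0 y1] : 0 <= y <= N%:R * u ^+ 19 by exact: slope_le.
have y2 : 2 * y <= 1 / 2 by have := Nu; lra.
have rec := P_rec d hd; rewrite -/y in rec.
have stp := P_step d.
have lin : `|expR (- (2 * y)) - (1 - 2 * y)| <= 2 * (2 * y) ^+ 2.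
  by apply: expRN_lin; rewrite ger0_norm//; lra.
have -> : P d.+2 - P 0%N * gauss t N d.+2 =
   (1 - 2 * y) * (P d - P 0%N * gauss t N d)
   - (P d - P d.+2 - 2 * y * P d.+1)
   - 2 * y * (P d.+1 - P d)
   - P 0%N * gauss t N d * (expR (- (2 * y)) - (1 - 2 * y)).
  by rewrite gauss_step -/y; ring.
have e1 : `|(1 - 2 * y) * (P d - P 0%N * gauss t N d)| <= S + d%:R * B.
  rewrite normrM; apply: le_trans Dd.
  by rewrite ler_piMl// ger0_norm; lra.
have e3 : `|2 * y * (P d.+1 - P d)| <= 2 * N%:R * A * u ^+ 116.
  rewrite normrM ger0_norm; last by rewrite mulr_ge0.
  apply: (@le_trans _ _ (2 * (N%:R * u ^+ 19) * (A * u ^+ 97))).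
    by apply: ler_pM; [rewrite mulr_ge0|exact: normr_ge0|rewrite ler_pM2l|exact: stp].
  have -> : u ^+ 116 = u ^+ 19 * u ^+ 97 by rewrite -exprD.
  by rewrite le_eqVlt; apply/orP; left; apply/eqP; ring.
have e4 : `|P 0%N * gauss t N d * (expR (- (2 * y)) - (1 - 2 * y))| <= 8 * N%:R ^+ 2 * A * u ^+ 116.
  rewrite normrM; apply: (@le_trans _ _ (A * u ^+ 78 * (2 * (2 * y) ^+ 2))).
    apply: ler_pM => //; rewrite normrM -[leRHS]mulr1; apply: ler_pM => //.
    by have /andP[g0 g1] := gauss_itv t N d (ltW t0); rewrite ger0_norm.
  have yy : y ^+ 2 <= (N%:R * u ^+ 19) ^+ 2.
    by apply: lerXn2r; rewrite ?nnegrE// mulr_ge0.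
  have -> : 2 * (2 * y) ^+ 2 = 8 * y ^+ 2 by ring.
  apply: (@le_trans _ _ (A * u ^+ 78 * (8 * (N%:R * u ^+ 19) ^+ 2))).
    by apply: ler_wpM2l; [rewrite mulr_ge0|apply: ler_wpM2l].
  have -> : u ^+ 116 = u ^+ 78 * (u ^+ 19 * u ^+ 19) by rewrite -!exprD.
  by rewrite le_eqVlt; apply/orP; left; apply/eqP; ring.
apply: le_trans (ler_normB _ _) _.
apply: le_trans (lerD (le_trans (ler_normB _ _) (lerD (le_trans (ler_normB _ _) (lerD e1 rec)) e3)) e4) _.
have -> : d.+2%:R = d%:R + 1 + 1 :> R by rewrite !natr1.
have -> : B = C1 * u ^+ 116 + 2 * N%:R * A * u ^+ 116 + 8 * N%:R ^+ 2 * A * u ^+ 116.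
  by rewrite /B /gauss_err_const !mulrDl.
have X0 : 0 <= C1 * u ^+ 116 + 2 * N%:R * A * u ^+ 116 + 8 * N%:R ^+ 2 * A * u ^+ 116.
  by repeat first [done|apply: addr_ge0|apply: mulr_ge0|apply: exprn_ge0].
move: X0; move XE : (_ + _ + _) => X X0.
have -> : (d%:R + 1 + 1) * X = d%:R * X + X + X by ring.
rewrite -!addrA; do 2 rewrite lerD2l.
lra.
Qed.

Lemma gauss_approx_unif (c : nat) : c.-1%:R * u ^+ 21 <= 1 ->
  `|P c - P 0 * gauss t N c| <= (A + N%:R * A + 2 * gauss_err_const) * u ^+ 95.
Proof.
move=> hc; apply: le_trans (gauss_approx c hc) _.
have A0 := const_ge0; have U n : 0 <= u ^+ n by rewrite exprn_ge0// ltW.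
have B0 : 0 <= gauss_err_const * u ^+ 95.
  have C10 : 0 <= C1 * u ^+ 95.
    rewrite mulr_ge0//; have := le_trans (normr_ge0 _) (P_rec 0 _).
    rewrite mul1r -(expr0 u) => /(_ (expn_antimono 0 21 isT)).
    by rewrite pmulr_lge0// exprn_gt0.
  rewrite /gauss_err_const !mulrDl; by repeat first [done|apply: addr_ge0|apply: mulr_ge0|apply: exprn_ge0].
rewrite [leRHS]mulrDl; apply: lerD.
  by rewrite ler_wpM2l ?addr_ge0 ?mulr_ge0// expn_antimono.
have cu : c%:R * u ^+ 21 <= 2.
  have c1 : c%:R <= c.-1%:R + 1 :> R by rewrite natr1 ler_nat leqSpred.
  have := ler_wpM2r (U 21%N) c1; rewrite mulrDl mul1r.
  have : u ^+ 21 <= u ^+ 0 by exact: expn_antimono.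
  by rewrite expr0; move: hc; lra.
have -> : u ^+ 116 = u ^+ 21 * u ^+ 95 by rewrite -exprD.
have -> : c%:R * (gauss_err_const * (u ^+ 21 * u ^+ 95))
  = c%:R * u ^+ 21 * (gauss_err_const * u ^+ 95) by ring.
by rewrite -[2 * _ * _]mulrA ler_wpM2r.
Qed.

End GaussianRecursion.

(** * Tails of the parity difference *)

Section Chernoff.
Context {R : realType}.
Variables (N alpha beta : nat).
Hypotheses (ha : (1 <= alpha <= N)%N) (hb : (1 <= beta <= N)%N).

Lemma mass_ge0 (t : R) M v : 0 <= mass N alpha beta t M v.
Proof.
rewrite /mass; elim: (parts _ _ _ _) v => [|x l IH] v; first exact: ler0n.
have /andP[p0 p1] := prob_itv t x; rewrite wconv_cons /binop.
by apply: addr_ge0; apply: mulr_ge0; rewrite ?subr_ge0.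
Qed.

Lemma mass_le_expR (t lam : R) M (v : int * int) : mass N alpha beta t M v
  <= expR (- (lam * v.2%:~R))
     * \prod_(x <- parts N alpha beta M) (1 - prob t x + prob t x * expR (lam * x.2%:~R)).
Proof.
rewrite /mass; elim: (parts _ _ _ _) v => [|x l IH] v.
  rewrite big_nil mulr1 /= /delta; case: eqP => [->|_]; last exact: expR_ge0.
  by rewrite /= mulr0 oppr0 expR0.
have /andP[p0 p1] := prob_itv t x; have q0 : 0 <= 1 - prob t x by rewrite subr_ge0.
rewrite wconv_cons /binop big_cons.
apply: le_trans (lerD (ler_wpM2l q0 (IH v)) (ler_wpM2l p0 (IH (v - x)))) _.
have -> : expR (- (lam * (v - x).2%:~R)) = expR (- (lam * v.2%:~R)) * expR (lam * x.2%:~R).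
  by rewrite -expRD /= rmorphB /=; congr expR; ring.
by rewrite le_eqVlt; apply/orP; left; apply/eqP; ring.
Qed.

(** Exponential Markov inequality. The linear term of the cumulant is [lam] times [mean_pd], bounded
    by 1; the quadratic one is controlled by the total weight, at most [1 / t]. *)
Lemma mass_tail (t lam : R) J (v : int * int) : 0 < t -> `|lam| <= 1 / 2 ->
  mass N alpha beta t (N * J) v
  <= expR (- (lam * v.2%:~R) + (`|lam| + 2 * lam ^+ 2 * (1 / t))).
Proof.
move=> t0 l2; apply: le_trans (mass_le_expR t lam _ v) _.
rewrite expRD ler_pM2l ?expR_gt0//.
apply: (@le_trans _ _ (\prod_(x <- parts N alpha beta (N * J))
    expR (prob t x * (expR (lam * x.2%:~R) - 1)))).
  apply: ler_prod => x _; have /andP[p0 p1] := prob_itv t x; apply/andP; split.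
    by rewrite addr_ge0 ?subr_ge0// mulr_ge0 ?expR_ge0.
  have -> : 1 - prob t x + prob t x * expR (lam * x.2%:~R)
    = 1 + prob t x * (expR (lam * x.2%:~R) - 1) by ring.
  exact: expR_ge1Dx.
rewrite -expR_sum ler_expR /parts big_map.
apply: (@le_trans _ _ (\sum_(m <- iota 1 (N * J))
    (lam * ((eps N alpha beta m)%:~R * fermi t m) + 2 * lam ^+ 2 * expR (- (t * m%:R))))).
  apply: ler_sum => m _; rewrite prob_fermi /=.
  have /andP[p0 p1] := fermi_itv t m; have pe := fermi_le t m.
  set e := (eps N alpha beta m)%:~R.
  have le2 : (lam * e) ^+ 2 <= lam ^+ 2 by rewrite mulrC; exact: eps_sqr_le.
  have lz : `|- (lam * e)| <= 1 / 2.
    rewrite normrN; apply: le_trans l2; rewrite -(ler_pXn2r (n := 2)) ?nnegrE//.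
    by rewrite !real_normK ?num_real.
  have := expRN_lin _ lz; rewrite opprK sqrrN ler_norml => /andP[_ h].
  have h2 : expR (lam * e) - 1 <= lam * e + 2 * lam ^+ 2 by lra.
  apply: le_trans (ler_wpM2l p0 h2) _; rewrite mulrDr; apply: lerD.
    by rewrite le_eqVlt; apply/orP; left; apply/eqP; ring.
  by rewrite mulrC ler_wpM2l// mulr_ge0 ?sqr_ge0.
rewrite big_split /= -!mulr_sumr; apply: lerD.
  apply: le_trans (ler_norm _) _; rewrite normrM -[leRHS]mulr1.
  by rewrite ler_wpM2l//; exact: mean_pd_le.
apply: ler_wpM2l; first by rewrite mulr_ge0 ?sqr_ge0.
exact: sum_expRN_le.
Qed.

Lemma exp_decay (k : nat) (kap : R) : 0 < kap ->
  exists2 C : R, 0 <= C & forall u, 0 < u -> expR (- (kap * (1 / u) ^+ 2)) <= C * u ^+ (2 * k).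
Proof.
move=> k0; exists (k`!%:R / kap ^+ k) => [|u u0].
  by rewrite divr_ge0// exprn_ge0// ltW.
have y0 : 0 <= kap * (1 / u) ^+ 2 by rewrite mulr_ge0 ?sqr_ge0// ltW.
have := pow_expRN_le _ k y0; set e := expR _ => h.
have uk : 0 < (kap * (1 / u) ^+ 2) ^+ k by rewrite exprn_gt0// mulr_gt0// exprn_gt0// divr_gt0.
move: h; rewrite mulrC -ler_pdivlMr// => h; apply: le_trans h _.
rewrite le_eqVlt; apply/orP; left; apply/eqP.
rewrite exprMn -exprM div1r exprVn invfM invrK mulrA; ring.
Qed.
End Chernoff.

(** * All estimates in powers of [u] *)

Section Scale.
Context {R : realType}.
Variables (N alpha beta : nat).
Hypotheses (hN : N = 2%N \/ (5 <= N)%N).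
Hypotheses (ha : (1 <= alpha <= N)%N) (hb : (1 <= beta <= N)%N).
Hypothesis hneq : alpha <> beta.
Variables (n : nat) (u t CE : R).
Let M := (N * (n + 2))%N.
Hypotheses (u0 : 0 < u) (u1 : u <= 1) (nu : n%:R * u ^+ 80 = 1).
Hypothesis (Nu : 100 * N%:R ^+ 2 * u ^+ 38 <= 1).
Hypotheses (t0 : 0 < t) (tu : t <= u ^+ 40) (tu6 : u ^+ 40 <= 6 * t).
Hypothesis (saddle : mean_size t M = n%:R).
Hypotheses (CE0 : 0 <= CE) (decay : expR (- (arc_rate N * (1 / u) ^+ 2)) <= CE * u ^+ 140).

Local Notation P c := (mass N alpha beta t M (n%:Z, c)).

(** The 64 is the square of the 8 in the radius for [theta], needed for steps in [c]; the same
    constant also serves the sup bound and the shifts in size. *)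
Definition sup_const : R := 64 + 2 * CE.

Let L := 1 / u.
Let s := 1 / u ^+ 20.

Lemma scale_hyps : [/\ 1 <= L, 0 < s, 100 * N%:R ^+ 2 * L ^+ 2 <= s ^+ 2,
  t * s ^+ 2 <= 1 & s ^+ 2 <= M%:R].
Proof.
have U k : 0 < u ^+ k by rewrite exprn_gt0.
have s2 : s ^+ 2 = 1 / u ^+ 40 by rewrite /s expr_div_n expr1n -exprM.
split.
- by rewrite /L ler_pdivlMr// mul1r.
- by rewrite /s divr_gt0.
- rewrite s2 /L expr_div_n expr1n ler_pdivlMr//.
  have -> : u ^+ 40 = u ^+ 38 * u ^+ 2 by rewrite -exprD.
  have -> : 100 * N%:R ^+ 2 * (1 / u ^+ 2) * (u ^+ 38 * u ^+ 2) = 100 * N%:R ^+ 2 * u ^+ 38.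
    by field; rewrite gt_eqF.
  exact: Nu.
- by rewrite s2 mulrA mulr1 ler_pdivrMr// mul1r.
- rewrite s2 ler_pdivrMr//; apply: (@le_trans _ _ (n%:R * u ^+ 80)); first by rewrite nu.
  apply: ler_pM; [exact: ler0n|exact: ltW| |by rewrite ler_wiXn2l// ltW].
  by rewrite ler_nat /M; clear -hN; nia.
Qed.

Lemma scale_radii : L / s ^+ 3 = u ^+ 59 /\ L / s = u ^+ 19.
Proof.
have un : u != 0 by rewrite gt_eqF.
split; rewrite /L /s.
  by rewrite expr_div_n expr1n -exprM !div1r invrK (_ : u ^+ (20 * 3) = u * u ^+ 59) ?mulKf// -exprS.
by rewrite !div1r invrK [u ^+ 20](exprS u 19) mulKf.
Qed.

Lemma P_sup v : `|mass N alpha beta t M v| <= sup_const * u ^+ 78.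
Proof.
have [L1 s0 Ls ts sM] := scale_hyps; have [e1 e2] := scale_radii.
have := mass_sup N alpha beta hN ha hb hneq L s t M L1 s0 Ls t0 ts sM v.
rewrite e1 e2 => h; apply: le_trans h _.
have -> : u ^+ 59 * (8 * u ^+ 19) = 8 * u ^+ 78.
  by have -> : u ^+ 78 = u ^+ 59 * u ^+ 19; [rewrite -exprD | ring].
rewrite /sup_const [leRHS]mulrDl. apply: lerD.
  by rewrite ler_wpM2r ?exprn_ge0 ?ltW//; lra.
apply: le_trans decay _; rewrite -mulrA; apply: (@le_trans _ _ (CE * u ^+ 78)).
  by rewrite ler_wpM2l// ler_wiXn2l// ltW.
have X0 : 0 <= CE * u ^+ 78 by rewrite mulr_ge0// exprn_ge0// ltW.
by lra.
Qed.

Lemma P_step_le (c : int) : `|P (c + 1) - P c| <= sup_const * u ^+ 97.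
Proof.
have [L1 s0 Ls ts sM] := scale_hyps; have [e1 e2] := scale_radii.
have := mass_step2 N alpha beta hN ha hb hneq L s t M L1 s0 Ls t0 ts sM (n%:Z, c + 1).
have -> : (n%:Z, c + 1) - (0, 1) = (n%:Z, c) by congr pair; rewrite /= ?subr0 ?addrK.
rewrite e1 e2 => h; apply: le_trans h _.
have -> : 8 * u ^+ 19 * (u ^+ 59 * (8 * u ^+ 19)) = 64 * u ^+ 97.
  have -> : u ^+ 97 = u ^+ 19 * (u ^+ 59 * u ^+ 19) by rewrite -!exprD.
  ring.
rewrite /sup_const [leRHS]mulrDl lerD2l -mulrA ler_pM2l//; apply: le_trans decay _.
by rewrite ler_wpM2l// ler_wiXn2l// ltW.
Qed.

Lemma P_shift_le (k c : int) :
  `|mass N alpha beta t M (n%:Z - k, c) - P c| <= `|k|%:~R * (sup_const * u ^+ 137).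
Proof.
have [L1 s0 Ls ts sM] := scale_hyps; have [e1 e2] := scale_radii.
have := mass_shift1 N alpha beta hN ha hb hneq L s t M L1 s0 Ls t0 ts sM n%:Z c k.
rewrite e1 e2 => h; apply: le_trans h _.
rewrite ler_wpM2l ?ler0z//.
have -> : u ^+ 59 * (u ^+ 59 * (8 * u ^+ 19)) = 8 * u ^+ 137.
  have -> : u ^+ 137 = u ^+ 59 * (u ^+ 59 * u ^+ 19) by rewrite -!exprD.
  ring.
rewrite /sup_const [leRHS]mulrDl; apply: lerD.
  by rewrite ler_wpM2r ?exprn_ge0 ?ltW//; lra.
rewrite -mulrA ler_pM2l//; apply: le_trans decay _.
by rewrite ler_wpM2l// ler_wiXn2l// ltW.
Qed.

Lemma P_tail (c : int) : 1 <= `|c|%:~R * u ^+ 21 ->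
  P c <= 4 * expR (- (1 / 48 * (1 / u) ^+ 2)).
Proof.
(* The factor 24 balances gain and cost: the linear term gains at least [u ^ (- 2) / 24], the
   quadratic one costs at most [u ^ (- 2) / 48]. *)
move=> hc; pose lam : R := Num.sg c%:~R * (u ^+ 19 / 24).
have U k : 0 < u ^+ k by rewrite exprn_gt0.
have c0 : c != 0 by apply: contraL hc => /eqP ->; rewrite normr0 mul0r ler10.
have al : `|lam| = u ^+ 19 / 24.
  rewrite normrM normr_sg intr_eq0 c0 mul1r ger0_norm// divr_ge0// ltW//.
have u19 : u ^+ 19 <= 1 by rewrite exprn_ile1// ltW.
have l2 : `|lam| <= 1 / 2 by rewrite al; lra.
have := mass_tail N alpha beta ha hb t lam (n + 2) (n%:Z, c) t0 l2 => h.
apply: le_trans h _.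
have e1 : expR (1 : R) <= 4.
  have := @expRN1_ge R; rewrite expRN -[(expR 1)^-1]div1r ler_pdivlMr ?expR_gt0//; lra.
have u2 : (1 / u) ^+ 2 = 1 / u ^+ 2 by rewrite expr_div_n expr1n.
have lc : (1 / u) ^+ 2 / 24 <= lam * c%:~R.
  have -> : lam * c%:~R = `|c|%:~R * (u ^+ 19 / 24) by rewrite /lam intr_norm normrEsg; ring.
  rewrite u2 ler_pdivrMr// ler_pdivrMr//.
  have -> : `|c|%:~R * (u ^+ 19 / 24) * 24 * u ^+ 2 = `|c|%:~R * (u ^+ 19 * u ^+ 2) by field.
  by rewrite -exprD.
have lt : 2 * lam ^+ 2 * (1 / t) <= (1 / u) ^+ 2 / 48.
  rewrite -[lam ^+ 2]real_normK ?num_real// al u2 mulrA mulr1 ler_pdivrMr//.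
  have -> : 2 * (u ^+ 19 / 24) ^+ 2 = u ^+ 38 / 288.
    by rewrite exprMn -exprM; field.
  have -> : 1 / u ^+ 2 / 48 * t = 6 * t / (288 * u ^+ 2) by field; rewrite gt_eqF.
  have i288 : 0 < 288 * u ^+ 2 by apply: mulr_gt0; [lra|exact: U].
  rewrite (ler_pdivlMr _ _ i288).
  have -> : u ^+ 38 / 288 * (288 * u ^+ 2) = u ^+ 38 * u ^+ 2 by field.
  by rewrite -exprD.
rewrite -[leRHS]mulrC; apply: le_trans (ler_wpM2l (expR_ge0 _) e1).
rewrite -expRD ler_expR /=; lra.
Qed.

Lemma shifted_le (X Y z B : R) : `|z| <= 1 / 2 -> `|X - Y| <= B ->
  `|X * expR (- z) - Y * (1 - z)| <= 2 * B + `|Y| * (2 * z ^+ 2).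
Proof.
move=> hz hB; have -> : X * expR (- z) - Y * (1 - z)
  = (X - Y) * expR (- z) + Y * (expR (- z) - (1 - z)) by ring.
apply: le_trans (ler_normD _ _) _; rewrite !normrM; apply: lerD.
  rewrite mulrC; apply: ler_pM => //.
  by rewrite ger0_norm ?expR_ge0//; exact: expRN_le2.
by rewrite ler_wpM2l//; exact: expRN_lin.
Qed.

Definition shift_const : R := 2 * N%:R * sup_const + 2 * N%:R ^+ 2 * sup_const.

Lemma sup_const_ge0 : 0 <= sup_const.
Proof. by rewrite /sup_const; have := CE0; lra. Qed.

Lemma Nu19 : 4 * N%:R * u ^+ 19 <= 1.
Proof.
have x0 : 0 <= N%:R * u ^+ 19 by rewrite mulr_ge0// exprn_ge0// ltW.
have h : (10 * (N%:R * u ^+ 19)) ^+ 2 <= 1 ^+ 2.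
  rewrite expr1n; apply: le_trans Nu.
  have -> : u ^+ 38 = u ^+ 19 * u ^+ 19 by rewrite -exprD.
  by rewrite le_eqVlt; apply/orP; left; apply/eqP; ring.
have x10 : 0 <= 10 * (N%:R * u ^+ 19) by rewrite mulr_ge0.
rewrite ler_pXn2r ?nnegrE// in h.
by rewrite -mulrA; lra.
Qed.

(** Returning to size [n] costs [|k|] steps of order [u ^ 137]; expanding the exponential costs the
    square of [t k], of order [u ^ 38], times the mass. *)
Lemma shift_error (k c : int) : `|k|%:~R * u ^+ 21 <= N%:R ->
  `|mass N alpha beta t M (n%:Z - k, c) * expR (- (t * k%:~R)) - P c * (1 - t * k%:~R)|
  <= shift_const * u ^+ 116.
Proof.
move=> hk; have U m : 0 < u ^+ m by rewrite exprn_gt0.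
have A0 := sup_const_ge0.
have z1 : `|t * k%:~R| <= N%:R * u ^+ 19.
  rewrite normrM (gtr0_norm t0) -intr_norm.
  apply: (@le_trans _ _ (u ^+ 40 * `|k|%:~R)); first by rewrite ler_wpM2r// ler0z.
  have -> : u ^+ 40 = u ^+ 19 * u ^+ 21 by rewrite -exprD.
  by rewrite -mulrA [u ^+ 21 * _]mulrC [N%:R * _]mulrC ler_wpM2l// ltW.
have z2 : `|t * k%:~R| <= 1 / 2.
  by apply: le_trans z1 _; have := Nu19; have := mulr_ge0 (ler0n R N) (ltW (U 19%N)); lra.
have B : `|mass N alpha beta t M (n%:Z - k, c) - P c| <= N%:R * sup_const * u ^+ 116.
  apply: le_trans (P_shift_le k c) _.
  have -> : u ^+ 137 = u ^+ 21 * u ^+ 116 by rewrite -exprD.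
  have -> : `|k|%:~R * (sup_const * (u ^+ 21 * u ^+ 116))
    = `|k|%:~R * u ^+ 21 * (sup_const * u ^+ 116) by ring.
  by rewrite -[leRHS]mulrA ler_wpM2r// mulr_ge0// ltW.
apply: le_trans (shifted_le _ _ _ _ z2 B) _; rewrite /shift_const [leRHS]mulrDl; apply: lerD.
  by rewrite !mulrA.
apply: (@le_trans _ _ (sup_const * u ^+ 78 * (2 * (N%:R * u ^+ 19) ^+ 2))).
  apply: ler_pM => //; first by rewrite mulr_ge0 ?sqr_ge0.
    exact: P_sup.
  rewrite ler_pM2l// -[X in X <= _]real_normK ?num_real//.
  by apply: lerXn2r => //; rewrite nnegrE mulr_ge0// ltW.
have -> : u ^+ 116 = u ^+ 78 * (u ^+ 19 * u ^+ 19) by rewrite -!exprD.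
by rewrite le_eqVlt; apply/orP; left; apply/eqP; ring.
Qed.

Definition rec_const : R := 3 * N%:R * sup_const + 3 * shift_const.

(** To first order the recurrence reads [P(c) - P(c + 2) = t k1 P(c + 1) + t k2 P(c) - t k3 P(c +
    2)]. Here [k3] and [k2 - k1] are at most [N] in absolute value, so they contribute only errors,
    and replacing [P(c)] by [P(c + 1)] doubles the term of [k1 = N (c + 1)]. *)
Lemma P_rec_le (c : nat) : c.+1%:R * u ^+ 21 <= 1 ->
  `|P c%:Z - P c.+2%:Z - 2 * (t * (N%:R * c.+1%:R)) * P c.+1%:Z| <= rec_const * u ^+ 116.
Proof.
move=> hc; have U m : 0 < u ^+ m by rewrite exprn_gt0.
have A0 := sup_const_ge0; have N0 := ler0n R N.
(* The cutoff [N (n + 2)] leaves the spare block that [mass_recurrence] requires. *)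
have hm : n%:Z <= (N * (n + 2))%:Z - N%:Z by clear -hN; nia.
have rec := mass_recurrence N alpha beta hN ha hb hneq t (n + 2) n%:Z c.+1%:Z isT hm.
rewrite -/M in rec.
have c1 : c.+1%:Z - 1 = c%:Z by clear; lia.
have c2 : c.+1%:Z + 1 = c.+2%:Z by clear; lia.
rewrite c1 c2 in rec.
have NC : N%:R * c.+1%:R * u ^+ 21 <= N%:R :> R by rewrite -mulrA ler_piMr.
have u21 : u ^+ 21 <= 1 by rewrite exprn_ile1// ltW.
set k1 : int := N%:Z * c.+1%:Z in rec; set k2 : int := alpha%:Z + N%:Z * c%:Z in rec.
set k3 : int := beta%:Z - N%:Z in rec.
have k1E : k1%:~R = N%:R * c.+1%:R :> R by rewrite /k1 rmorphM /= -!pmulrn.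
have hk1 : `|k1|%:~R * u ^+ 21 <= N%:R.
  by rewrite intr_norm k1E ger0_norm// mulr_ge0.
have k21 : `|k2 - k1|%:~R <= N%:R :> R.
  by rewrite pmulrn ler_int /k1 /k2; clear -ha; lia.
have k2k1 : `|k2| <= `|k1| by rewrite /k1 /k2; clear -ha; nia.
have hk2 : `|k2|%:~R * u ^+ 21 <= N%:R.
  by apply: le_trans hk1; rewrite ler_wpM2r ?(ltW (U _))// ler_int.
have k3N : `|k3|%:~R <= N%:R :> R by rewrite pmulrn ler_int /k3; clear -hb; lia.
have hk3 : `|k3|%:~R * u ^+ 21 <= N%:R.
  by apply: le_trans k3N; rewrite ler_piMr// ler0z.
have e1 := shift_error k1 c.+1%:Z hk1.
have e2 := shift_error k2 c%:Z hk2.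
have e3 := shift_error k3 c.+2%:Z hk3.
set X1 := mass _ _ _ _ _ _ * _ in rec e1; set X2 := mass _ _ _ _ _ _ * _ in rec e2.
set X3 := mass _ _ _ _ _ _ * _ in rec e3.
have T1 : t * k1%:~R <= N%:R * u ^+ 19.
  rewrite k1E; apply: (@le_trans _ _ (u ^+ 40 * (N%:R * c.+1%:R))).
    by rewrite ler_wpM2r// mulr_ge0.
  have -> : u ^+ 40 = u ^+ 19 * u ^+ 21 by rewrite -exprD.
  have -> : u ^+ 19 * u ^+ 21 * (N%:R * c.+1%:R) = u ^+ 19 * (N%:R * c.+1%:R * u ^+ 21) by ring.
  by rewrite [leRHS]mulrC ler_wpM2l// ltW.
have T10 : 0 <= t * k1%:~R by rewrite k1E !mulr_ge0// ltW.
have f1 : `|t * k1%:~R * (P c.+1%:Z - P c%:Z)| <= N%:R * sup_const * u ^+ 116.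
  rewrite normrM (ger0_norm T10).
  have -> : u ^+ 116 = u ^+ 19 * u ^+ 97 by rewrite -exprD.
  apply: (@le_trans _ _ (N%:R * u ^+ 19 * (sup_const * u ^+ 97))).
    apply: ler_pM => //; have := P_step_le c%:Z.
    by have -> : c%:Z + 1 = c.+1%:Z by clear; lia.
  by rewrite le_eqVlt; apply/orP; left; apply/eqP; ring.
have small (k c' : int) : `|k|%:~R <= N%:R :> R ->
    `|t * k%:~R * P c'| <= N%:R * sup_const * u ^+ 116.
  move=> hk; rewrite normrM.
  apply: (@le_trans _ _ (u ^+ 40 * N%:R * (sup_const * u ^+ 78))).
    apply: ler_pM => //; last exact: P_sup.
    by rewrite normrM (gtr0_norm t0) -intr_norm; apply: ler_pM; [exact: ltW|rewrite ler0z|exact: tu|exact: hk].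
  have -> : u ^+ 40 * N%:R * (sup_const * u ^+ 78) = N%:R * sup_const * (u ^+ 40 * u ^+ 78) by ring.
  by rewrite -exprD ler_wpM2l ?mulr_ge0// ler_wiXn2l// ltW.
have f2 := small (k2 - k1) c%:Z k21; have f3 := small k3 c.+2%:Z k3N.
rewrite -k1E.
have -> : P c%:Z - P c.+2%:Z - 2 * (t * k1%:~R) * P c.+1%:Z =
  - (t * k1%:~R * (P c.+1%:Z - P c%:Z)) + t * (k2 - k1)%:~R * P c%:Z - t * k3%:~R * P c.+2%:Z
  - (X1 - P c.+1%:Z * (1 - t * k1%:~R)) - (X2 - P c%:Z * (1 - t * k2%:~R))
  + (X3 - P c.+2%:Z * (1 - t * k3%:~R)).
  have -> : X1 = P c.+1%:Z + X3 - X2 by rewrite -rec; ring.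
  by rewrite rmorphB /=; ring.
have -> : rec_const * u ^+ 116 = 3 * (N%:R * sup_const * u ^+ 116) + 3 * (shift_const * u ^+ 116).
  by rewrite /rec_const; ring.
move: e1 e2 e3 f1 f2 f3.
set a1 := X1 - _; set a2 := X2 - _; set a3 := X3 - _.
set b1 := _ * (P c.+1%:Z - P c%:Z); set b2 := _ * P c%:Z; set b3 := _ * P c.+2%:Z.
set Y1 := shift_const * _; set Y2 := N%:R * sup_const * _.
rewrite !ler_norml => /andP[? ?] /andP[? ?] /andP[? ?] /andP[? ?] /andP[? ?] /andP[? ?].
apply/andP; split; lra.
Qed.

Definition bias_const : R := 2 * N%:R * shift_const + N%:R * rec_const.

(** By reflection [P(- c)] is a mass at [c] with size shifted by [(beta - alpha) c], so the bias is
    about [t (beta - alpha) c P(c)]; [P_rec_le] recognises this product as a difference of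
    neighbours. *)
Lemma bias_le (c : nat) : c.+1%:R * u ^+ 21 <= 1 ->
  `|2 * N%:R * (P c.+1%:Z - P (- c.+1%:Z))
    - (beta%:Z - alpha%:Z)%:~R * (P c%:Z - P c.+2%:Z)| <= bias_const * u ^+ 116.
Proof.
move=> hc; set d : int := beta%:Z - alpha%:Z.
have N0 := ler0n R N.
have dN : `|d%:~R| <= N%:R :> R.
  by rewrite -intr_norm pmulrn ler_int /d; clear -ha hb; lia.
have hk : `|d * c.+1%:Z|%:~R * u ^+ 21 <= N%:R.
  rewrite intr_norm rmorphM /= normrM -pmulrn [`|c.+1%:R|]ger0_norm// -mulrA.
  rewrite -[leRHS]mulr1; apply: ler_pM => //.
  by rewrite mulr_ge0// exprn_ge0// ltW.
have e := shift_error (d * c.+1%:Z) c.+1%:Z hk.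
have r := P_rec_le c hc.
have mr := mass_reflect N alpha beta hN ha hb hneq t (n + 2) n%:Z c.+1%:Z.
rewrite -/M -/d in mr; rewrite -mr in e.
have -> : 2 * N%:R * (P c.+1%:Z - P (- c.+1%:Z)) - d%:~R * (P c%:Z - P c.+2%:Z)
  = - (2 * N%:R * (P (- c.+1%:Z) - P c.+1%:Z * (1 - t * (d * c.+1%:Z)%:~R)))
    - d%:~R * (P c%:Z - P c.+2%:Z - 2 * (t * (N%:R * c.+1%:R)) * P c.+1%:Z).
  by rewrite rmorphM /= -[c.+1%:~R]pmulrn; ring.
apply: le_trans (ler_normB _ _) _; rewrite normrN /bias_const [leRHS]mulrDl; apply: lerD.
  rewrite normrM (ger0_norm (mulr_ge0 (ler0n R 2) N0)) -[leRHS]mulrA.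
  by apply: ler_wpM2l => //; rewrite mulr_ge0.
by rewrite normrM -[leRHS]mulrA; apply: ler_pM.
Qed.

(** The values 6, [2 * 12 ^ 3] and [6 * 12 ^ 4] used here and in [centre_loss] are the moment bounds
    of orders 0, 2 and 3 obtained from [2 / t <= 12 s ^ 2]. *)
Definition centre_floor : R := expR (- (2 * (2 * 12 ^+ 3) + 2 * 6)).
Definition centre_loss : R := 8 * (6 * 12 ^+ 4) + 8 * (512 * 6) + 8.

Lemma centre_ge : (8 * centre_loss + CE) * u <= centre_floor / 200 ->
  centre_floor / 200 * u ^+ 80 <= P 0.
Proof.
move=> hu; have [L1 s0 Ls ts sM] := scale_hyps; have [er1 er2] := scale_radii.
have U k : 0 < u ^+ k by rewrite exprn_gt0.
have s2 : s ^+ 2 = 1 / u ^+ 40 by rewrite /s expr_div_n expr1n -exprM.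
have ts6 : 1 <= 6 * (t * s ^+ 2) by rewrite s2 mulrA mulrA mulr1 ler_pdivlMr// mul1r.
have t2 : 2 / t <= 12 * s ^+ 2.
  rewrite ler_pdivrMr//; lra.
have t20 : 0 <= 2 / t by rewrite divr_ge0// ltW.
have sum0 : \sum_(m <- iota 1 M) expR (- (t * m%:R)) <= 6 * s ^+ 2.
  by apply: le_trans (sum_expRN_le _ _ t0) _; rewrite div1r; lra.
have sum2 : \sum_(m <- iota 1 M) m%:R ^+ 2 * expR (- (t * m%:R)) <= 2 * 12 ^+ 3 * s ^+ 6.
  apply: le_trans (sum_pow_expRN_le _ 2 _ t0) _.
  have -> : 2 * 12 ^+ 3 * s ^+ 6 = (12 * s ^+ 2) ^+ 3 * 2`!%:R.
    have -> : s ^+ 6 = (s ^+ 2) ^+ 3 by rewrite -exprM.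
    have -> : 2`!%:R = 2 :> R by [].
    by rewrite exprMn; ring.
  by rewrite ler_wpM2r//; apply: lerXn2r; rewrite ?nnegrE// mulr_ge0// sqr_ge0.
have sum3 : \sum_(m <- iota 1 M) m%:R ^+ 3 * expR (- (t * m%:R)) <= 6 * 12 ^+ 4 * s ^+ 8.
  apply: le_trans (sum_pow_expRN_le _ 3 _ t0) _.
  have -> : 6 * 12 ^+ 4 * s ^+ 8 = (12 * s ^+ 2) ^+ 4 * 3`!%:R.
    have -> : s ^+ 8 = (s ^+ 2) ^+ 4 by rewrite -exprM.
    have -> : 3`!%:R = 6 :> R by [].
    by rewrite exprMn; ring.
  by rewrite ler_wpM2r//; apply: lerXn2r; rewrite ?nnegrE// mulr_ge0// sqr_ge0.
have := mass_centre_ge N alpha beta hN ha hb hneq L s t 6 (2 * 12 ^+ 3) (6 * 12 ^+ 4)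
  (n + 2) n L1 s0 Ls t0 ts ts6 sM saddle sum0 sum2 sum3.
rewrite -/M -/centre_floor -/centre_loss er1 er2 => H; apply: le_trans H.
have -> : 1 / s ^+ 3 * (1 / s) = u ^+ 80.
  have un : u != 0 by rewrite gt_eqF.
  rewrite /s; have -> : u ^+ 80 = (u ^+ 20) ^+ 3 * u ^+ 20 by rewrite -exprM -exprD.
  by field.
have -> : L ^+ 3 / s = u ^+ 17.
  have un : u != 0 by rewrite gt_eqF.
  rewrite /L /s; have -> : u ^+ 20 = u ^+ 3 * u ^+ 17 by rewrite -exprD.
  by field.
have -> : u ^+ 59 * (8 * u ^+ 19) = 8 * u ^+ 78.
  by have -> : u ^+ 78 = u ^+ 59 * u ^+ 19; [rewrite -exprD | ring].
have dd := decay.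
have d2 : CE * u ^+ 140 <= CE * u ^+ 81 by rewrite ler_wpM2l// ler_wiXn2l// ltW.
have loss0 : 0 <= centre_loss by rewrite /centre_loss; lra.
have d3 : centre_loss * u ^+ 17 * (8 * u ^+ 78) <= 8 * centre_loss * u ^+ 81.
  have -> : centre_loss * u ^+ 17 * (8 * u ^+ 78) = 8 * centre_loss * (u ^+ 17 * u ^+ 78) by ring.
  by rewrite -exprD ler_wpM2l ?mulr_ge0// ler_wiXn2l// ltW.
have d4 : (8 * centre_loss + CE) * u * u ^+ 80 <= centre_floor / 200 * u ^+ 80.
  by rewrite ler_wpM2r// ltW.
have d5 : (8 * centre_loss + CE) * u * u ^+ 80 = 8 * centre_loss * u ^+ 81 + CE * u ^+ 81.
  by rewrite (_ : u ^+ 81 = u * u ^+ 80) -?exprS//; ring.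
rewrite d5 in d4; move: dd; rewrite -/L => dd.
(* One half of the main term is kept, the other absorbs the errors, which are of order [u ^ 81]. *)
have -> : centre_floor * (u ^+ 80 / 100) = centre_floor / 200 * u ^+ 80 + centre_floor / 200 * u ^+ 80.
  by field.
lra.
Qed.

End Scale.

(** * Sums of biases over a window and over all parity differences *)

Section MainEstimate.
Context {R : realType}.
Variables (N alpha beta : nat).
Hypotheses (hN : N = 2%N \/ (5 <= N)%N).
Hypotheses (ha : (1 <= alpha <= N)%N) (hb : (1 <= beta <= N)%N).
Hypothesis hneq : alpha <> beta.

Local Notation gs t c1 c2 := (gauss t N c1.-1 + gauss t N c1 - gauss t N c2 - gauss t N c2.+1).

(** Differences with step two telescope to two boundary terms at each end, whence the four values of
    [P]. *)
Lemma telescope_two_step (b P : nat -> R) (k d e : R) (c1 m : nat) : (1 <= c1)%N ->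
  (forall c, (c1 <= c < c1 + m)%N -> `|k * b c - d * (P c.-1 - P c.+1)| <= e) ->
  `|k * (\sum_(c1 <= c < c1 + m) b c)
    - d * (P c1.-1 + P c1 - P (c1 + m).-1 - P (c1 + m)%N)| <= m%:R * e.
Proof.
move=> h1; elim: m => [|m IH] H.
  rewrite addn0 big_geq// mulr0 mul0r.
  have -> : P c1.-1 + P c1 - P c1.-1 - P c1 = 0 by ring.
  by rewrite mulr0 subrr normr0.
have {}IH := IH (fun c hc => H c ltac:(clear -hc; lia)).
have Hm := H (c1 + m)%N ltac:(clear; lia).
rewrite addnS big_nat_recr ?leq_addr//= -natr1 mulrDl mul1r.
set S := \sum_(_ <= _ < _) _ in IH *.
have -> : k * (S + b (c1 + m)%N) - d * (P c1.-1 + P c1 - P (c1 + m)%N - P (c1 + m).+1)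
  = (k * S - d * (P c1.-1 + P c1 - P (c1 + m).-1 - P (c1 + m)%N))
    + (k * b (c1 + m)%N - d * (P (c1 + m).-1 - P (c1 + m).+1)) by ring.
by apply: le_trans (ler_normD _ _) _; exact: lerD.
Qed.

Definition approx_const (CE : R) : R :=
  sup_const CE + N%:R * sup_const CE
  + 2 * gauss_err_const N (sup_const CE) (rec_const N CE).

Section Fixed.
Variables (n : nat) (u t CE CT : R).
Let M := (N * (n + 2))%N.
Hypotheses (u0 : 0 < u) (u1 : u <= 1) (nu : n%:R * u ^+ 80 = 1).
Hypothesis (Nu : 100 * N%:R ^+ 2 * u ^+ 38 <= 1).
Hypotheses (t0 : 0 < t) (tu : t <= u ^+ 40) (tu6 : u ^+ 40 <= 6 * t).
Hypothesis (saddle : mean_size t M = n%:R).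
Hypotheses (CE0 : 0 <= CE) (decay : expR (- (arc_rate N * (1 / u) ^+ 2)) <= CE * u ^+ 140).
Hypotheses (CT0 : 0 <= CT) (tail : expR (- (1 / 48 * (1 / u) ^+ 2)) <= CT * u ^+ 180).
Hypothesis centre : (8 * centre_loss + CE) * u <= centre_floor / 200.

Local Notation P c := (mass N alpha beta t M (n%:Z, c)).
Let w : R := weight t (n%:Z, 0) / partition_fun N alpha beta t M.
(** Half of the leading size of the total bias: the four boundary Gaussians of the full window add
    up to 2. It is bounded below through [P 0] and [|beta - alpha| >= 1], so errors can be stated
    relative to it. *)
Let Q : R := (beta%:Z - alpha%:Z)%:~R * P 0 / (2 * N%:R).

Lemma N_gt0 : 0 < N%:R :> R.
Proof. by have := natN_ge2 N hN (R := R); lra. Qed.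

Lemma pb_mass (c : nat) : w * (pb alpha beta N n c)%:~R = P c%:Z - P (- c%:Z).
Proof.
have nM : (n <= M)%N by rewrite /M; clear -hN; nia.
rewrite pb_coef !mass_coef -(subnKC nM) !coef_stable// subnKC// /w.
have W (c' : int) : weight t (n%:Z, c') = weight t (n%:Z, 0) by [].
by rewrite !(W c%:Z) !(W (- c%:Z)); ring.
Qed.

Lemma delta_norm : 1 <= `|(beta%:Z - alpha%:Z)%:~R : R| <= N%:R.
Proof.
rewrite -intr_norm pmulrn -[1]/(1%:~R) !ler_int.
by move: hneq => h; clear -ha hb h; lia.
Qed.

Lemma P0_ge : centre_floor / 200 * u ^+ 80 <= P 0.
Proof.
exact: (centre_ge N alpha beta hN ha hb hneq n u t CE u0 u1 nu Nu t0 tu tu6 saddle CE0 decay centre).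
Qed.

Lemma centre_floor_gt0 : 0 < centre_floor / 200 :> R.
Proof. by apply: divr_gt0; [exact: expR_gt0|lra]. Qed.

Lemma Q_ge : centre_floor / 200 / (2 * N%:R) * u ^+ 80 <= `|Q|.
Proof.
have N0 := N_gt0; have /andP[d1 _] := delta_norm; have P0 := P0_ge.
have Pg : 0 <= P 0 by exact: mass_ge0.
rewrite /Q normrM normfV normrM (ger0_norm Pg) [`|2 * _|]gtr0_norm ?mulr_gt0//.
rewrite mulrAC ler_pM2r ?invr_gt0 ?mulr_gt0//; apply: le_trans P0 _.
by rewrite ler_peMl.
Qed.

Lemma Q_neq0 : Q != 0.
Proof.
rewrite -normr_gt0; apply: lt_le_trans Q_ge; apply: mulr_gt0; last exact: exprn_gt0.
by apply: divr_gt0; [exact: centre_floor_gt0|rewrite mulr_gt0// N_gt0].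
Qed.

Definition window_const : R :=
  (bias_const N CE + 4 * N%:R * approx_const CE) * (2 * N%:R / (centre_floor / 200)).

Lemma small_le_Q : u ^+ 95 <= 2 * N%:R / (centre_floor / 200) * (`|Q| * u).
Proof.
have N0 := N_gt0; have f0 := centre_floor_gt0.
have h : u ^+ 80 <= 2 * N%:R / (centre_floor / 200) * `|Q|.
  have := Q_ge; rewrite -(ler_pM2l (_ : 0 < 2 * N%:R / (centre_floor / 200))); last first.
    by rewrite divr_gt0// mulr_gt0.
  rewrite mulrA; have -> : 2 * N%:R / (centre_floor / 200) * (centre_floor / 200 / (2 * N%:R)) = 1 :> R.
    by move: f0; move: (centre_floor / 200) => f f0; field; rewrite !gt_eqF.
  by rewrite mul1r.
apply: (@le_trans _ _ (u ^+ 80 * u)).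
  by rewrite -exprSr ler_wiXn2l// ltW.
by rewrite mulrA ler_wpM2r// ltW.
Qed.

Lemma P_gauss (c : nat) : c.-1%:R * u ^+ 21 <= 1 ->
  `|P c%:Z - P 0 * gauss t N c| <= approx_const CE * u ^+ 95.
Proof.
move=> hc; apply: (gauss_approx_unif N u t (sup_const CE) (rec_const N CE) (fun c => P c%:Z)) => //.
- exact: Nu19.
- by move=> c'; exact: P_sup.
- move=> c'; have -> : c'.+1%:Z = c'%:Z + 1 by clear; lia.
  exact: P_step_le.
- by move=> c' hc'; exact: P_rec_le.
Qed.

(** [bias_le] is summed over at most [u ^ (- 21)] values, turning [u ^ 116] into [u ^ 95]; the four
    boundary masses are then replaced by Gaussians, again up to [u ^ 95], while [Q] has order at
    least [u ^ 80]. *)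
Lemma window_le (c1 c2 : nat) : (1 <= c1 <= c2.+1)%N -> c2%:R * u ^+ 21 <= 1 ->
  `|w * \sum_(c1 <= c < c2.+1) (pb alpha beta N n c)%:~R - Q * gs t c1 c2|
  <= window_const * (`|Q| * u).
Proof.
move=> /andP[h1 h2] hc; have N0 := N_gt0; set d : R := (beta%:Z - alpha%:Z)%:~R.
have U k : 0 < u ^+ k by rewrite exprn_gt0.
have below c : (c <= c2)%N -> c%:R * u ^+ 21 <= 1.
  by move=> cc; apply: le_trans hc; rewrite ler_wpM2r ?(ltW (U _))// ler_nat.
have bias c : (1 <= c <= c2)%N ->
    `|2 * N%:R * (P c%:Z - P (- c%:Z)) - d * (P c.-1%:Z - P c.+1%:Z)| <= bias_const N CE * u ^+ 116.
  case: c => // c hc'; apply: (bias_le N alpha beta hN ha hb hneq n u t CE) => //.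
  exact: below.
have u21 : u ^+ 21 <= 1 by rewrite exprn_ile1// ltW.
have bias0 : 0 <= bias_const N CE.
  have := le_trans (normr_ge0 _) (bias_le N alpha beta hN ha hb hneq n u t CE u0 u1 nu Nu t0 tu CE0 decay 0 _).
  by rewrite mul1r => /(_ u21); rewrite pmulr_lge0.
have ap0 : 0 <= approx_const CE.
  have := le_trans (normr_ge0 _) (P_gauss 0 _).
  by rewrite mul0r => /(_ ler01); rewrite pmulr_lge0.
pose m := (c2.+1 - c1)%N; have E : (c1 + m)%N = c2.+1 by rewrite subnKC.
have rng c : (c1 <= c < c1 + m)%N -> (1 <= c <= c2)%N.
  by rewrite E; clear -h1; lia.
have T := telescope_two_step (fun c => P c%:Z - P (- c%:Z)) (fun c => P c%:Z)
  (2 * N%:R) d (bias_const N CE * u ^+ 116) c1 m h1 (fun c hc' => bias c (rng c hc')).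
rewrite E /= in T.
have -> : w * \sum_(c1 <= c < c2.+1) (pb alpha beta N n c)%:~R
    = \sum_(c1 <= c < c2.+1) (P c%:Z - P (- c%:Z)).
  by rewrite mulr_sumr; apply: eq_bigr => c _; exact: pb_mass.
set S := \sum_(_ <= _ < _) _ in T *.
have {}T : `|2 * N%:R * S - d * (P c1.-1%:Z + P c1%:Z - P c2%:Z - P c2.+1%:Z)|
    <= bias_const N CE * u ^+ 95.
  apply: le_trans T _; have -> : u ^+ 116 = u ^+ 21 * u ^+ 95 by rewrite -exprD.
  have -> : m%:R * (bias_const N CE * (u ^+ 21 * u ^+ 95))
    = m%:R * u ^+ 21 * (bias_const N CE * u ^+ 95) by ring.
  have mu : m%:R * u ^+ 21 <= 1 by apply: below; rewrite /m; clear -h1; lia.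
  by apply: ler_piMl mu; apply: mulr_ge0 => //; exact: ltW.
have le2 : (c1.-1 <= c2)%N by clear -h2; lia.
have g1 := P_gauss c1.-1 (below c1.-2 (leq_trans (leq_pred _) le2)).
have g2 := P_gauss c1 (below c1.-1 le2).
have g3 := P_gauss c2 (below c2.-1 (leq_pred _)).
have g4 := P_gauss c2.+1 (below c2 (leqnn c2)).
have G : `|P c1.-1%:Z + P c1%:Z - P c2%:Z - P c2.+1%:Z - P 0 * gs t c1 c2|
    <= 4 * (approx_const CE * u ^+ 95).
  have -> : P c1.-1%:Z + P c1%:Z - P c2%:Z - P c2.+1%:Z - P 0 * gs t c1 c2
    = (P c1.-1%:Z - P 0 * gauss t N c1.-1) + (P c1%:Z - P 0 * gauss t N c1)
      - (P c2%:Z - P 0 * gauss t N c2) - (P c2.+1%:Z - P 0 * gauss t N c2.+1) by ring.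
  have := lerD (lerD (lerD g1 g2) g3) g4.
  have n1 := ler_normB (P c1.-1%:Z - P 0 * gauss t N c1.-1 + (P c1%:Z - P 0 * gauss t N c1)
    - (P c2%:Z - P 0 * gauss t N c2)) (P c2.+1%:Z - P 0 * gauss t N c2.+1).
  have n2 := ler_normB (P c1.-1%:Z - P 0 * gauss t N c1.-1 + (P c1%:Z - P 0 * gauss t N c1))
    (P c2%:Z - P 0 * gauss t N c2).
  have n3 := ler_normD (P c1.-1%:Z - P 0 * gauss t N c1.-1) (P c1%:Z - P 0 * gauss t N c1).
  by move: n1 n2 n3; lra.
have /andP[_ dN] := delta_norm; rewrite -/d in dN.
have D : `|2 * N%:R * (S - Q * gs t c1 c2)|
    <= (bias_const N CE + 4 * N%:R * approx_const CE) * u ^+ 95.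
  have -> : 2 * N%:R * (S - Q * gs t c1 c2)
    = (2 * N%:R * S - d * (P c1.-1%:Z + P c1%:Z - P c2%:Z - P c2.+1%:Z))
      + d * (P c1.-1%:Z + P c1%:Z - P c2%:Z - P c2.+1%:Z - P 0 * gs t c1 c2).
    by rewrite /Q -/d; field; rewrite gt_eqF.
  apply: le_trans (ler_normD _ _) _; rewrite [leRHS]mulrDl; apply: lerD => //.
  rewrite normrM; have -> : 4 * N%:R * approx_const CE * u ^+ 95 = N%:R * (4 * (approx_const CE * u ^+ 95)) by ring.
  by apply: ler_pM.
rewrite /window_const -mulrA; apply: (@le_trans _ _ ((bias_const N CE + 4 * N%:R * approx_const CE) * u ^+ 95)).
  apply: le_trans D; rewrite normrM [`|2 * _|]gtr0_norm ?mulr_gt0// ler_peMl//.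
  by have := natN_ge2 N hN (R := R); lra.
apply: ler_wpM2l; last exact: small_le_Q.
by rewrite addr_ge0// !mulr_ge0// ltW.
Qed.

Lemma pb0 : (pb alpha beta N n 0)%:~R = 0 :> R.
Proof. by rewrite pb_coef oppr0 subrr. Qed.

Definition total_const : R :=
  window_const + 8 * CT * (2 * N%:R / (centre_floor / 200)) + (N%:R + 48).

Lemma total_le : 2 * u ^+ 21 <= 1 ->
  `|w * \sum_(0 <= c < n.+1) (pb alpha beta N n c)%:~R - 2 * Q| <= total_const * (`|Q| * u).
Proof.
move=> hu; have N0 := N_gt0; have U k : 0 < u ^+ k by rewrite exprn_gt0.
(* The sum is cut at the edge [u ^ (- 21)] of the Gaussian window: [window_le] below it, the tail
   bound above it, and the term [c = 0] vanishes by symmetry. *)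
pose cm := Num.trunc (1 / u ^+ 21).
have y0 : 0 <= 1 / u ^+ 21 by rewrite divr_ge0// ltW.
have /andP[m1 m2'] := trunc_itv y0; rewrite -/cm in m1 m2'.
have m2 : 1 / u ^+ 21 < cm%:R + 1 by rewrite natr1.
have cmu : cm%:R * u ^+ 21 <= 1 by rewrite -ler_pdivlMr.
have cmu2 : 1 <= (cm%:R + 1) * u ^+ 21 by rewrite -ler_pdivrMr// ltW.
have cmh : 1 / 2 <= cm%:R * u ^+ 21 by move: cmu2; rewrite mulrDl mul1r; lra.
have cmn : (cm <= n)%N.
  rewrite -(ler_nat R) -(ler_pM2r (U 80%N)) nu.
  have -> : u ^+ 80 = u ^+ 21 * u ^+ 59 by rewrite -exprD.
  have u59 : u ^+ 59 <= 1 by rewrite exprn_ile1// ltW.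
  rewrite mulrA; apply: le_trans (ler_piMr _ u59) cmu.
  by apply: mulr_ge0 => //; exact: ltW.
rewrite (big_cat_nat (n := cm.+1))//= big_nat_recl//= pb0 add0r.
rewrite -(big_add1 _ _ 0 cm.+1 xpredT (fun c => (pb alpha beta N n c)%:~R)).
have W := window_le 1 cm (ltn0Sn cm) cmu.
have T : `|w * \sum_(cm.+1 <= c < n.+1) (pb alpha beta N n c)%:~R| <= 8 * CT * u ^+ 95.
  rewrite mulr_sumr; apply: le_trans (ler_norm_sum _ _ _) _.
  apply: (@le_trans _ _ (\sum_(cm.+1 <= c < n.+1) (8 * CT * u ^+ 180))).
    rewrite big_nat_cond [leRHS]big_nat_cond; apply: ler_sum => c /andP[/andP[c1 _] _].
    have cu : 1 <= c%:R * u ^+ 21.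
      apply: le_trans cmu2 _; rewrite ler_wpM2r ?(ltW (U _))//.
      by rewrite natr1 ler_nat.
    have b1 : P c%:Z <= 4 * expR (- (1 / 48 * (1 / u) ^+ 2)).
      by apply: (P_tail N alpha beta ha hb n u t) => //; rewrite -pmulrn.
    have b2 : P (- c%:Z) <= 4 * expR (- (1 / 48 * (1 / u) ^+ 2)).
      by apply: (P_tail N alpha beta ha hb n u t) => //; rewrite normrN -pmulrn.
    have p1 : 0 <= P c%:Z by exact: mass_ge0.
    have p2 : 0 <= P (- c%:Z) by exact: mass_ge0.
    rewrite pb_mass; move: tail; set e := expR _ in b1 b2 * => he.
    by rewrite ler_norml; apply/andP; split; lra.
  rewrite sumr_const_nat -[leLHS]mulr_natl.
  apply: (@le_trans _ _ (n%:R * (8 * CT * u ^+ 180))).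
    apply: ler_wpM2r; first by apply: mulr_ge0; [rewrite mulr_ge0|exact: ltW].
    by rewrite ler_nat subSS leq_subr.
  (* At most [n = u ^ (- 80)] terms are left in the tail, which is why the tail bound is stated with
     exponent 180. *)
  have -> : u ^+ 180 = u ^+ 80 * u ^+ 100 by rewrite -exprD.
  have -> : n%:R * (8 * CT * (u ^+ 80 * u ^+ 100)) = n%:R * u ^+ 80 * (8 * CT * u ^+ 100) by ring.
  by rewrite nu mul1r; apply: ler_wpM2l; [rewrite mulr_ge0|apply: ler_wiXn2l => //; exact: ltW].
have G : `|gs t 1 cm - 2| <= (N%:R + 48) * u.
  have /andP[a1 a2] := gauss_itv t N cm (ltW t0).
  have /andP[b1 b2] := gauss_itv t N cm.+1 (ltW t0).
  have /andP[d1 d2] := gauss_itv t N 1 (ltW t0).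
  have g0 : gauss t N 0 = 1 by rewrite /gauss expr0n mulr0 mul0r oppr0 expR0.
  have g1 : 1 - gauss t N 1 <= N%:R * u.
    have := expR_ge1Dx (- (t * N%:R * 1 ^+ 2 / 2)); rewrite -/(gauss t N 1) expr1n mulr1 => h.
    have tN : t * N%:R <= u * N%:R.
      apply: ler_wpM2r => //; apply: le_trans tu _.
      by rewrite -[leRHS]expr1; apply: ler_wiXn2l => //; exact: ltW.
    have : 0 <= t * N%:R by rewrite mulr_ge0// ltW.
    by move: h; rewrite [N%:R * u]mulrC; lra.
  have gd : gauss t N cm.+1 <= gauss t N cm.
    rewrite /gauss ler_expR lerN2 ler_pM2r// ler_pM2l ?mulr_gt0//.
    by apply: lerXn2r; rewrite ?nnegrE// ler_nat.
  (* At the edge the Gaussian exponent is at least [1 / (24 u ^ 2)], so even [exp x >= 1 + x] is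
     enough. *)
  have gm : gauss t N cm <= 24 * u.
    have ex : 1 / (24 * u ^+ 2) <= t * N%:R * cm%:R ^+ 2 / 2.
      have q1 : 1 / 4 <= (cm%:R * u ^+ 21) ^+ 2 by nra.
      have q2 : u ^+ 40 * 2 <= 6 * t * N%:R.
        by apply: ler_pM => //; [exact: ltW|exact: natN_ge2].
      have q3 : u ^+ 40 * 2 * (1 / 4) <= 6 * t * N%:R * (cm%:R * u ^+ 21) ^+ 2.
        by apply: ler_pM => //; rewrite mulr_ge0// ltW.
      rewrite ler_pdivrMr ?mulr_gt0// -(ler_pM2r (U 40%N)) mul1r.
      have -> : t * N%:R * cm%:R ^+ 2 / 2 * (24 * u ^+ 2) * u ^+ 40
        = 2 * (6 * t * N%:R * (cm%:R * u ^+ 21) ^+ 2).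
        have -> : (cm%:R * u ^+ 21) ^+ 2 = cm%:R ^+ 2 * (u ^+ 2 * u ^+ 40).
          by rewrite exprMn -exprM -exprD.
        by field.
      by lra.
    have u2 : 0 < 24 * u ^+ 2 by rewrite mulr_gt0.
    rewrite /gauss expRN -[(expR _)^-1]div1r ler_pdivrMr ?expR_gt0//.
    have h := expR_ge1Dx (t * N%:R * cm%:R ^+ 2 / 2).
    apply: (@le_trans _ _ (24 * u * (1 / (24 * u ^+ 2)))); last first.
      by rewrite ler_wpM2l ?mulr_ge0 ?(ltW u0)//; lra.
    have -> : 24 * u * (1 / (24 * u ^+ 2)) = 1 / u by field; rewrite gt_eqF.
    by rewrite ler_pdivlMr// mul1r.
  rewrite /= g0 ler_norml; apply/andP; split; lra.
have SQ := small_le_Q; have Qn := normr_ge0 Q.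
set S1 := \sum_(1 <= c < cm.+1) _ in W *; set S2 := \sum_(cm.+1 <= c < n.+1) _ in T *.
have -> : w * (S1 + S2) - 2 * Q = (w * S1 - Q * gs t 1 cm) + w * S2 + Q * (gs t 1 cm - 2) by ring.
apply: le_trans (ler_normD _ _) _; rewrite /total_const mulrDl; apply: lerD; last first.
  by rewrite normrM [leRHS]mulrCA; apply: ler_wpM2l.
apply: le_trans (ler_normD _ _) _; rewrite [leRHS]mulrDl; apply: lerD => //.
apply: le_trans T _; rewrite -[leRHS]mulrA; apply: ler_wpM2l; first by rewrite mulr_ge0.
exact: SQ.
Qed.

End Fixed.
End MainEstimate.

(** * The estimates for all large sizes, with uniform constants *)

Section Asymptotics.
Context {R : realType}.
Variables (N alpha beta : nat).
Hypotheses (hN : N = 2%N \/ (5 <= N)%N).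
Hypotheses (ha : (1 <= alpha <= N)%N) (hb : (1 <= beta <= N)%N).
Hypothesis hneq : alpha <> beta.

Local Notation pbn n c := ((pb alpha beta N n c)%:~R : R).

(** [v = w / Q] is the same for every window and for the full sum, so it cancels in the quotient of
    the theorem. *)
Lemma main_estimate : exists C u0 : R, [/\ 0 < u0, u0 <= 1 &
  forall (n : nat) u, 0 < u -> u <= u0 -> n%:R * u ^+ 80 = 1 ->
  exists t v : R, [/\ [/\ 0 < t, t <= u ^+ 40, u ^+ 40 <= 6 * t & mean_size t (N * (n + 2)) = n%:R],
    v != 0,
    forall c1 c2 : nat, (1 <= c1 <= c2.+1)%N -> c2%:R * u ^+ 21 <= 1 ->
      `|v * \sum_(c1 <= c < c2.+1) pbn n c
        - (gauss t N c1.-1 + gauss t N c1 - gauss t N c2 - gauss t N c2.+1)| <= C * u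
    & `|v * \sum_(0 <= c < n.+1) pbn n c - 2| <= C * u]].
Proof.
have N2 := natN_ge2 N hN (R := R).
have N0 : 0 < N%:R :> R by lra.
have rate0 : 0 < arc_rate N :> R by rewrite /arc_rate invr_gt0 !mulr_gt0// exprn_gt0.
have [CE CE0 decay] := exp_decay (R := R) 70 _ rate0.
have [CT CT0 tail] := exp_decay (R := R) 90 (1 / 48) ltac:(by rewrite divr_gt0).
pose K : R := (8 * centre_loss + CE) / (centre_floor / 200).
have f0 := centre_floor_gt0 (R := R).
(* A single bound [D u <= 1] implies all the smallness conditions on [u] at once. *)
pose D : R := 4 + 100 * N%:R ^+ 2 + `|K|.
have K0 := normr_ge0 K; have N20 : 0 <= N%:R ^+ 2 :> R by exact: exprn_ge0.
have D0 : 0 < D by rewrite /D; lra.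
exists (`|window_const N CE| + `|total_const N CE CT|), D^-1.
split; [by rewrite invr_gt0|by rewrite invf_le1//; rewrite /D; lra|].
move=> n u u_gt uD nu.
have Du : D * u <= 1 by rewrite mulrC -ler_pdivlMr// div1r.
have u14 : 4 * u <= 1 by apply: le_trans Du; rewrite ler_wpM2r ?(ltW u_gt)// /D; lra.
have uN : 100 * N%:R ^+ 2 * u <= 1.
  by apply: le_trans Du; rewrite ler_wpM2r ?(ltW u_gt)// /D; lra.
have uK : K * u <= 1.
  by apply: le_trans Du; rewrite ler_wpM2r ?(ltW u_gt)// /D; have := ler_norm K; lra.
have u1 : u <= 1 by lra.
have pw k : u ^+ k.+1 <= u by rewrite -[leRHS]expr1; apply: ler_wiXn2l => //; exact: ltW.
have U k : 0 < u ^+ k by rewrite exprn_gt0.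
have Nu : 100 * N%:R ^+ 2 * u ^+ 38 <= 1.
  by apply: le_trans uN; apply: ler_wpM2l; [rewrite mulr_ge0|exact: pw].
have centre : (8 * centre_loss + CE) * u <= centre_floor / 200.
  have -> : (8 * centre_loss + CE) * u = K * u * (centre_floor / 200).
    by rewrite /K mulrAC mulfVK// lt0r_neq0.
  by apply: ler_piMl uK; exact: ltW.
have u21 : 2 * u ^+ 21 <= 1 by have := pw 20%N; lra.
pose s := (u ^+ 20)^-1.
have s4 : s ^+ 4 = n%:R.
  apply: (mulIf (lt0r_neq0 (U 80%N))); rewrite nu /s -exprVn -exprM -exprMn mulVf ?lt0r_neq0//.
  by rewrite expr1n.
have s1 : 1 <= s by rewrite /s invf_ge1//; apply: le_trans u1; exact: pw.
have s2E : s ^+ 2 * u ^+ 40 = 1.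
  by rewrite /s -exprVn -exprM -exprMn mulVf ?lt0r_neq0// expr1n.
have s3 : 3 <= s ^+ 2.
  rewrite -(ler_pM2r (U 40%N)) s2E; have := pw 39%N; lra.
have sM : 6 * s ^+ 2 <= (N * (n + 2))%:R.
  rewrite natrM natrD -s4.
  have -> : s ^+ 4 = s ^+ 2 * s ^+ 2 by rewrite -exprD.
  move: (s ^+ 2) s3 => S S3.
  have SS : 3 * S <= S * S by rewrite ler_pM2r//; lra.
  have : 2 * (S * S + 2) <= N%:R * (S * S + 2) by rewrite ler_wpM2r//; lra.
  lra.
have [t [t0 ts ts6 saddle]] := saddle_exists s n _ s1 s4 sM.
have tu : t <= u ^+ 40.
  have -> : t = t * s ^+ 2 * u ^+ 40 by rewrite -mulrA s2E mulr1.
  by apply: ler_piMl ts; exact: ltW.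
have tu6 : u ^+ 40 <= 6 * t.
  have -> : 6 * t = 6 * (t * s ^+ 2) * u ^+ 40 by rewrite -mulrA -[t * _ * _]mulrA s2E mulr1.
  by apply: ler_peMl ts6; exact: ltW.
have dec := decay u u_gt; have tl := tail u u_gt.
have Qn := Q_neq0 N alpha beta hN ha hb hneq n u t CE u_gt u1 nu Nu t0 tu tu6 saddle CE0 dec centre.
have W := window_le N alpha beta hN ha hb hneq n u t CE u_gt u1 nu Nu t0 tu tu6 saddle CE0 dec centre.
have T := total_le N alpha beta hN ha hb hneq n u t CE CT u_gt u1 nu Nu t0 tu tu6 saddle CE0 dec
  CT0 tl centre u21.
have w0 : weight t (n%:Z, 0) / partition_fun N alpha beta t (N * (n + 2)) != 0 :> R.
  by rewrite lt0r_neq0// divr_gt0 ?weight_gt0// partition_fun_gt0.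
set w := weight _ _ / _ in W T w0; set Q := _ / (2 * N%:R) in Qn W T.
have scale (X g c : R) : `|w * X - Q * g| <= c * (`|Q| * u) -> `|w / Q * X - g| <= c * u.
  move=> h; have Q0 : 0 < `|Q| by rewrite normr_gt0.
  rewrite -(ler_pM2l Q0) -normrM; have -> : Q * (w / Q * X - g) = w * X - Q * g by field.
  by apply: le_trans h _; rewrite mulrCA.
have B1 := ler_norm (window_const N CE); have B2 := ler_norm (total_const N CE CT).
have B5 := normr_ge0 (window_const N CE); have B6 := normr_ge0 (total_const N CE CT).
exists t, (w / Q); split; first by split.
- by rewrite mulf_neq0// invr_neq0.
- move=> c1 c2 hc hc2; apply: le_trans (scale _ _ _ (W c1 c2 hc hc2)) _.
  by rewrite ler_pM2r//; lra.
- rewrite [2 * Q]mulrC in T; apply: le_trans (scale _ _ _ T) _.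
  by rewrite ler_pM2r//; lra.
Qed.

End Asymptotics.

(** * The Gaussian integral and the saddle point at finite size *)

Section Limits.
Context {R : realType}.

Lemma gauss_integral (k a b : R) : 0 < k -> a <= b ->
  2 * k * \int[lebesgue_measure]_(x in `[a, b]) (x * expR (- (k * x ^+ 2)))
  = expR (- (k * a ^+ 2)) - expR (- (k * b ^+ 2)).
Proof.
(* The fundamental theorem of calculus is applied on a proper interval, so [a = b] is separate. *)
move=> k0; rewrite le_eqVlt => /predU1P[<-|ab].
  by rewrite set_itv1 Rintegral_set1 mulr0 subrr.
pose f (x : R) := x * expR (- (k * x ^+ 2)).
pose F (x : R) := - (2 * k)^-1 * expR (- (k * x ^+ 2)).
have dF (x : R) : is_derive x 1 F (f x).
  have h : is_derive x 1 (fun x => - (k * x ^+ 2)) (- (k * (2 * x))).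
    by apply: is_derive_eq; rewrite /GRing.scale/=; ring.
  have h2 := is_derive1_comp (is_derive_expR _) h.
  have h3 := is_deriveZ (- (2 * k)^-1) h2.
  apply: is_derive_eq; rewrite /f /GRing.scale/=; field.
  by rewrite lt0r_neq0.
have cf (g : R -> R) : (forall x, derivable g x 1) -> continuous g.
  by move=> dg x; apply: differentiable_continuous; exact/derivable1_diffP.
have cF : continuous F by apply: cf => x; have [] := dF x.
have df : continuous f.
  move=> x; apply: cvgM; first exact: cvg_id.
  apply: continuous_cvg; first exact: continuous_expR.
  by apply: cvgN; apply: cvgM; [exact: cvg_cst|exact: exprn_continuous].
have := continuous_FTC2 ab (continuous_subspaceT df) _ _.
move=> /(_ F); rewrite /Rintegral => ->.
- rewrite /= /F; field; exact: lt0r_neq0.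
- split.
  + by move=> x _; have [] := dF x.
  + by apply: cvg_at_right_filter; exact: cF.
  + by apply: cvg_at_left_filter; exact: cF.
- by move=> x _; rewrite derive1E; have /@derive_val := dF x.
Qed.

(** The left square is [t ^ 2 n], that is [t ^ 2] times the mean size, to which [mean_size_asymp]
    applies with [K = 2 ^ (j + 1)]. The constant [1296 = 6 ^ 3 * 3!] comes from
    [(t M1) ^ 3 exp (- t M1) <= 3!] and [u ^ 40 <= 6 t]. *)
Lemma saddle_scaled (N n : nat) (u t : R) (j : nat) : (0 < N)%N ->
  0 < u -> n%:R * u ^+ 80 = 1 ->
  0 < t -> t <= u ^+ 40 -> u ^+ 40 <= 6 * t -> mean_size t (N * (n + 2)) = n%:R ->
  `|(t / u ^+ 40) ^+ 2 - pi ^+ 2 / 12|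
  <= (2 ^ j).*2%:R * ((2 ^ j).*2%:R + 1296) * u ^+ 40 + 5 / 2 ^+ j.
Proof.
move=> N0 u0 nu t0 tu tu6 saddle; have U k : 0 < u ^+ k by rewrite exprn_gt0.
have h1 := eta2_sum_bounds (R := R) j; have := mean_size_asymp t (N * (n + 2)) (2 ^ j).*2 t0.
rewrite saddle; set K := (2 ^ j).*2 in h1 *; set M1 : R := _.+1%:R; set e := expR _ => h2.
have -> : (t / u ^+ 40) ^+ 2 = t ^+ 2 * n%:R.
  have u40 := lt0r_neq0 (U 40%N); apply: (mulIf (lt0r_neq0 (U 80%N))).
  rewrite -[RHS]mulrA nu mulr1 expr_div_n -exprM mulfVK//.
  by rewrite lt0r_neq0.
have M1n : n%:R <= M1.
  by rewrite /M1 ler_nat; clear -N0; nia.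
have M1u : 1 <= M1 * u ^+ 80 by rewrite -nu ler_wpM2r// ltW.
have M10 : 0 < M1 by rewrite /M1 ltr0n.
have e0 : 0 < e by exact: expR_gt0.
have d : M1 * e <= 1296 * u ^+ 40.
  have p := pow_expRN_le (t * M1) 3 (mulr_ge0 (ltW t0) (ltW M10)); rewrite -/e in p.
  have p6 : (t * M1) ^+ 3 * e <= 6 by apply: le_trans p _; rewrite ler_nat.
  have q1 : (u ^+ 40) ^+ 3 <= (6 * t) ^+ 3 by apply: lerXn2r => //; rewrite nnegrE ltW// mulr_gt0.
  have q2 : 1 <= (M1 * u ^+ 80) ^+ 2 by rewrite exprn_ege1.
  apply: (@le_trans _ _ (M1 * e * (M1 * u ^+ 80) ^+ 2)).
    by apply: ler_peMr => //; rewrite mulr_ge0// ltW.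
  have -> : M1 * e * (M1 * u ^+ 80) ^+ 2 = M1 ^+ 3 * e * (u ^+ 40) ^+ 3 * u ^+ 40.
    have -> : (M1 * u ^+ 80) ^+ 2 = M1 ^+ 2 * ((u ^+ 40) ^+ 3 * u ^+ 40).
      by rewrite exprMn -!exprM -exprD.
    by ring.
  rewrite ler_pM2r//; apply: (@le_trans _ _ (M1 ^+ 3 * e * (6 * t) ^+ 3)).
    by apply: ler_wpM2l => //; rewrite mulr_ge0 ?exprn_ge0// ltW.
  have -> : M1 ^+ 3 * e * (6 * t) ^+ 3 = 216 * ((t * M1) ^+ 3 * e) by ring.
  by lra.
have K1 : 2 ^+ j <= K.+1%:R :> R.
  by rewrite -natrX ler_nat /K; clear; lia.
have j0 : 1 <= 2 ^+ j :> R by rewrite exprn_ege1// ler1n.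
have d2 : 1 / K.+1%:R ^+ 2 <= 1 / 2 ^+ j :> R.
  have K0 : 0 < K.+1%:R :> R by rewrite ltr0n.
  have j00 : 0 < 2 ^+ j :> R by rewrite exprn_gt0.
  rewrite !div1r lef_pV2 ?posrE ?exprn_gt0//.
  by apply: le_trans K1 _; rewrite expr2; apply: ler_peMr; [exact: ltW|rewrite ler1n].
have d3 : K%:R * (K%:R * t + M1 * e) <= K%:R * (K%:R + 1296) * u ^+ 40.
  rewrite -[leRHS]mulrA mulrDl; apply: ler_wpM2l => //.
  by apply: lerD => //; apply: ler_wpM2l.
have := le_trans (ler_distD (eta2_sum K) (t ^+ 2 * n%:R) (pi ^+ 2 / 12)) (lerD h2 h1).
move: d2 d3 {h1 h2}; rewrite !div1r.
move: (_ / 12) (_ * (_ + M1 * e)) (_ * u ^+ 40) ((_ ^+ 2)^-1) ((2 ^+ j)^-1) => q A B i k; lra.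
Qed.

End Limits.

(** * Limits of the saddle point and of the Gaussian boundary terms *)

Section Sequences.
Context {R : realType}.

(* Errors are measured in powers of [u = n ^ (- 1 / 80)], where [1 / u] is the
   factor by which the major arcs and the Gaussian window are widened beyond
   their natural size; [u ^ 20 = n ^ (- 1 / 4)]. *)
Definition scale (n : nat) : R := n%:R `^ (- (1 / 80)).

Lemma scale_gt0 n : (0 < n)%N -> 0 < scale n.
Proof. by move=> n0; rewrite powR_gt0// ltr0n. Qed.

Lemma scaleX n k : scale n ^+ k = n%:R `^ (- (k%:R / 80)).
Proof.
rewrite -powR_mulrn ?powR_ge0// /scale -powRrM; congr (_ `^ _).
by rewrite mulNr mulrAC mul1r.
Qed.

Lemma scale_pow80 n : (0 < n)%N -> n%:R * scale n ^+ 80 = 1.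
Proof.
move=> n0; rewrite scaleX mulfV ?pnatr_eq0// powRN powRr1// mulfV// pnatr_eq0.
by rewrite -lt0n.
Qed.

Lemma scale_pow20 n : scale n ^+ 20 = n%:R `^ (- (1 / 4)).
Proof. by rewrite scaleX; congr (_ `^ _); lra. Qed.

Lemma scale_near0 (eps : R) : 0 < eps -> \forall n \near \oo, 0 < scale n <= eps.
Proof.
move=> e0; near=> n.
have n0 : (0 < n)%N by near: n; exact: nbhs_infty_gt.
have u0 := scale_gt0 n n0; rewrite u0/= leNgt; apply/negP => lt.
have E : 0 < eps ^+ 80 by rewrite exprn_gt0.
have h : eps ^+ 80 < scale n ^+ 80 by rewrite ltrXn2r// ltW.
have hn : (eps ^+ 80)^-1 <= n%:R by near: n; exact: nbhs_infty_ger.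
have : 1 <= n%:R * eps ^+ 80 by rewrite -ler_pdivrMr// div1r.
apply/negP; rewrite -ltNge -[ltRHS](scale_pow80 n n0) ltr_pM2l ?ltr0n.
Unshelve. all: by end_near. Qed.

Lemma cvg_near_eq (f g : nat -> R) (l : R) :
  (\forall n \near \oo, f n = g n) -> f @ \oo --> l -> g @ \oo --> l.
Proof. by move=> fg; apply: cvg_trans; exact: near_eq_cvg. Qed.

Variables (N : nat) (t : nat -> R).
Hypothesis N0 : (0 < N)%N.
Hypothesis saddle : \forall n \near \oo, [/\ 0 < t n, t n <= scale n ^+ 40,
  scale n ^+ 40 <= 6 * t n & mean_size (t n) (N * (n + 2)) = n%:R].

Lemma saddle_cvg : (t n / scale n ^+ 40) @[n --> \oo] --> (pi / (2 * Num.sqrt 3) : R).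
Proof.
have P0 := pi_gt0 R; have s3 : 0 < Num.sqrt 3 :> R by rewrite sqrtr_gt0.
have -> : pi / (2 * Num.sqrt 3) = Num.sqrt (pi ^+ 2 / 12) :> R.
  rewrite -[LHS]gtr0_norm; last by rewrite divr_gt0// mulr_gt0.
  rewrite -sqrtr_sqr; congr Num.sqrt; rewrite expr_div_n exprMn sqr_sqrtr//.
  by congr (_ / _); lra.
have sq : ((t n / scale n ^+ 40) ^+ 2) @[n --> \oo] --> (pi ^+ 2 / 12 : R).
  apply/cvgrPdist_le => e e0.
  (* The truncation [j] is fixed first, from [e] alone; only then is [n] taken large enough to beat
     the constant [K] depending on [j]. *)
  have [j hj] : exists j, 5 / 2 ^+ j <= e / 2.
    pose j := (Num.trunc (10 / e)).+1; exists j.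
    have e10 : 0 <= 10 / e by rewrite divr_ge0// ltW.
    have tj : 10 / e < j%:R by have /andP[_] := trunc_itv e10.
    have j2 : j%:R <= 2 ^+ j :> R by rewrite -natrX ler_nat ltnW// ltn_expl.
    have j0 : 0 < 2 ^+ j :> R by rewrite exprn_gt0.
    rewrite ler_pdivrMr//; move: (lt_le_trans tj j2); rewrite ltr_pdivrMr// => h.
    by move: h; rewrite mulrC; lra.
  pose K : R := (2 ^ j).*2%:R * ((2 ^ j).*2%:R + 1296); have KE : (2 ^ j).*2%:R * ((2 ^ j).*2%:R + 1296) = K by [].
  have K0 : 0 <= K by apply: mulr_ge0; [exact: ler0n|apply: addr_ge0; exact: ler0n].
  clearbody K.
  near=> n.
  have n0 : (0 < n)%N by near: n; exact: nbhs_infty_gt.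
  have [t0 tu tu6 ms] : [/\ 0 < t n, t n <= scale n ^+ 40, scale n ^+ 40 <= 6 * t n
    & mean_size (t n) (N * (n + 2)) = n%:R] by near: n.
  have K1 : 0 < 1 + K by lra.
  have ue : 0 < scale n <= e / 2 / (1 + K).
    by near: n; apply: scale_near0; rewrite !divr_gt0//; lra.
  have u1 : 0 < scale n <= 1 by near: n; exact: scale_near0.
  case/andP: ue => u0 ue; case/andP: u1 => _ u1.
  have := saddle_scaled N n (scale n) (t n) j N0 u0 (scale_pow80 n n0) t0 tu tu6 ms.
  rewrite KE distrC => /le_trans; apply.
  have u40 : scale n ^+ 40 <= scale n by rewrite -[leRHS]expr1; apply: ler_wiXn2l => //; exact: ltW.
  have h1 : K * scale n ^+ 40 <= K * scale n by apply: ler_wpM2l.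
  move: ue; rewrite ler_pdivlMr// => ue.
  by move: ue h1; rewrite mulrDr mulr1 [scale n * K]mulrC; lra.
have h := continuous_cvg _ (@sqrt_continuous R _) sq.
apply: cvg_near_eq (h _); near=> n.
have [t0 _ _ _] : [/\ 0 < t n, t n <= scale n ^+ 40, scale n ^+ 40 <= 6 * t n
  & mean_size (t n) (N * (n + 2)) = n%:R] by near: n.
have n0 : (0 < n)%N by near: n; exact: nbhs_infty_gt.
by rewrite /= sqrtr_sqr gtr0_norm// divr_gt0// exprn_gt0// scale_gt0.
Unshelve. all: by end_near. Qed.

(** The Gaussian exponent is [(t / u ^ 40) N (c u ^ 20) ^ 2 / 2], a product of convergent
    factors. *)
Lemma gauss_cvg (c : nat -> nat) (x : R) : ((c n)%:R * scale n ^+ 20) @[n --> \oo] --> x ->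
  gauss (t n) N (c n) @[n --> \oo] --> expR (- (pi * N%:R / (4 * Num.sqrt 3) * x ^+ 2)).
Proof.
move=> cx; pose y n := t n / scale n ^+ 40 * N%:R * ((c n)%:R * scale n ^+ 20) ^+ 2 / 2.
have ycvg : y n @[n --> \oo] --> pi / (2 * Num.sqrt 3) * N%:R * x ^+ 2 / 2.
  apply: cvgM; last exact: cvg_cst.
  apply: cvgM; first by apply: cvgM; [exact: saddle_cvg|exact: cvg_cst].
  have sq : continuous (fun z : R => z ^+ 2) by exact: exprn_continuous.
  have h := continuous_cvg _ (sq _) cx; exact: h.
have -> : pi * N%:R / (4 * Num.sqrt 3) * x ^+ 2 = pi / (2 * Num.sqrt 3) * N%:R * x ^+ 2 / 2 :> R.
  have : Num.sqrt 3 != 0 :> R by rewrite lt0r_neq0// sqrtr_gt0.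
  by move: (Num.sqrt 3) (pi) => s q s0; field.
have ce : continuous (fun z : R => expR (- z)).
  by move=> z; apply: continuous_comp; [exact: opp_continuous|exact: continuous_expR].
have h := continuous_cvg _ (ce _) ycvg.
apply: cvg_near_eq (h _); near=> n.
have n0 : (0 < n)%N by near: n; exact: nbhs_infty_gt.
have u0 := scale_gt0 n n0.
rewrite /= /gauss /y; congr (expR (- (_ / 2))).
have -> : ((c n)%:R * scale n ^+ 20) ^+ 2 = (c n)%:R ^+ 2 * scale n ^+ 40.
  by rewrite exprMn -exprM.
by move: (scale n ^+ 40) (lt0r_neq0 (exprn_gt0 40 u0)) => v v0; field.
Unshelve. all: by end_near. Qed.

End Sequences.

(** * The limit of the quotient *)

Section Limit.
Context {R : realType}.
Local Notation scale := (@scale R).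

(** The real window becomes an integer interval, possibly empty ([c1 = c2.+1]). Since [f 0 = 0], the
    lower end may be taken at least 1, which gives [c1.-1] a meaning; all four boundary points lie
    within one mesh of [a] or [b]. *)
Lemma window_sum (s a b : R) (f : nat -> R) : 0 < s -> 0 <= a -> a <= b -> f 0%N = 0 ->
  exists c1 c2 : nat, [/\ (1 <= c1 <= c2.+1)%N,
    \sum_(c \in [set c : nat | a <= s * c%:R <= b]) f c = \sum_(c1 <= c < c2.+1) f c,
    `|c1.-1%:R * s - a| <= s /\ `|c1%:R * s - a| <= s
    & [/\ `|c2%:R * s - b| <= s, `|c2.+1%:R * s - b| <= s & c2%:R * s <= b]].
Proof.
move=> s0 a0 ab f0; have b0 : 0 <= b / s by rewrite divr_ge0 ?(ltW s0)// (le_trans a0).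
pose c2 := Num.trunc (b / s).
have /andP[] := trunc_itv b0; rewrite -/c2 ler_pdivlMr// ltr_pdivrMr// => l2 r2.
pose p (c : nat) := (0 < c)%N && (a <= s * c%:R).
have pc2 : p c2.+1 by rewrite /p /= mulrC; lra.
have [c1 /andP[c10 ac1] min] := ex_minnP (ex_intro p c2.+1 pc2).
have a1 : c1.-1%:R * s <= a.
  case E : c1.-1 => [|k]; first by rewrite mul0r.
  rewrite leNgt; apply/negP => ak.
  have : p k.+1 by rewrite /p /= mulrC ltW.
  by move=> /min; rewrite -E; clear -c10; lia.
have c1E : c1%:R = c1.-1%:R + 1 :> R by rewrite natr1 prednK.
have c2E : c2.+1%:R = c2%:R + 1 :> R by rewrite natr1.
exists c1, c2; split; first by rewrite c10 min.
- rewrite (fsbigE (index_iota c1 c2.+1)) ?iota_uniq//; first last.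
  + move=> c /= /andP[ac cb]; rewrite mem_index_iota => nc.
    case: (posnP c) => [->//|c0]; exfalso; move: nc; apply/negP; rewrite negbK ltnS.
    rewrite min ?/p ?c0//=; rewrite -ltnS -(ltr_nat R) -(ltr_pM2r s0).
    by apply: le_lt_trans r2; rewrite mulrC.
  + move=> c /=; rewrite mem_index_iota => /andP[h1 h2]; apply/andP; split.
      by apply: le_trans ac1 _; rewrite ler_pM2l// ler_nat.
    by apply: le_trans l2; rewrite mulrC ler_pM2r// ler_nat.
  rewrite big_seq_cond [RHS]big_seq; apply: eq_bigl => c.
  case: (boolP (c \in index_iota c1 c2.+1)) => //=; rewrite mem_index_iota => /andP[h1 h2].
  apply/mem_set/andP; split.
    by apply: le_trans ac1 _; rewrite ler_pM2l// ler_nat.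
  by apply: le_trans l2; rewrite mulrC ler_pM2r// ler_nat.
- move: ac1; rewrite mulrC c1E mulrDl mul1r => ac1.
  by split; rewrite ler_norml; apply/andP; split; lra.
- move: r2; rewrite c2E mulrDl mul1r => r2.
  by split; [| |by []]; rewrite ler_norml; apply/andP; split; lra.
Qed.

Lemma scale_squeeze (f : nat -> R) (l K : R) :
  (\forall n \near \oo, `|f n - l| <= K * scale n) -> f @ \oo --> l.
Proof.
move=> h; apply/cvgrPdist_le => e e0; near=> n.
have K1 : 0 < 1 + `|K| by rewrite ltr_wpDr.
have /andP[s0 se] : 0 < scale n <= e / (1 + `|K|) by near: n; apply: scale_near0; exact: divr_gt0.
have hn : `|f n - l| <= K * scale n by near: n.
rewrite distrC; apply: le_trans hn _; move: se; rewrite ler_pdivlMr// => se.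
by apply: le_trans se; rewrite mulrC ler_pM2l//; have := ler_norm K; lra.
Unshelve. all: by end_near. Qed.

Variables (N alpha beta : nat).
Hypotheses (hN : N = 2%N \/ (5 <= N)%N).
Hypotheses (ha : (1 <= alpha <= N)%N) (hb : (1 <= beta <= N)%N).
Hypothesis hneq : alpha <> beta.

Lemma dcount_sub (n : nat) :
  (dcount alpha beta N (0 : R) n)%:R - (dcount beta alpha N (0 : R) n)%:R
  = \sum_(0 <= c < n.+1) (pb alpha beta N n c)%:~R :> R.
Proof.
have N1 : (1 < N)%N by clear -hN; lia.
have hneq' : beta <> alpha by move=> e; apply: hneq.
rewrite !dcountE// -sumrB; apply: eq_bigr => c _.
by rewrite /pb rmorphB /= -!card_pd.
Qed.

Lemma limit_exists (a b : R) : 0 <= a -> a <= b ->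
  (\sum_(c \in [set c : nat | a <= n%:R `^ (- (1 / 4)) * c%:R <= b]) ((pb alpha beta N n c)%:~R : R))
     / ((dcount alpha beta N (0 : R) n)%:R - (dcount beta alpha N (0 : R) n)%:R) @[n --> \oo]
  --> expR (- (pi * N%:R / (4 * Num.sqrt 3) * a ^+ 2))
    - expR (- (pi * N%:R / (4 * Num.sqrt 3) * b ^+ 2)).
Proof.
move=> a0 ab.
pose X n : R := \sum_(c \in [set c : nat | a <= n%:R `^ (- (1 / 4)) * c%:R <= b]) ((pb alpha beta N n c)%:~R : R).
pose Y n : R := \sum_(0 <= c < n.+1) (pb alpha beta N n c)%:~R.
have N0 : (0 < N)%N by clear -hN; lia.
have [C [u0 [u0_gt u01 H]]] := main_estimate N alpha beta hN ha hb hneq (R := R).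
pose good n := [&& (0 < n)%N, scale n <= u0 & b * scale n <= 1].
pose g t c1 c2 : R := gauss t N c1.-1 + gauss t N c1 - gauss t N c2 - gauss t N c2.+1.
pose spec n (q : (R * R) * (nat * nat)) :=
  let: ((t, v), (c1, c2)) := q in
  [/\ [/\ 0 < t, t <= scale n ^+ 40, scale n ^+ 40 <= 6 * t & mean_size t (N * (n + 2)) = n%:R],
   v != 0, `|v * X n - g t c1 c2| <= C * scale n /\ `|v * Y n - 2| <= C * scale n,
   `|c1.-1%:R * scale n ^+ 20 - a| <= scale n ^+ 20 /\ `|c1%:R * scale n ^+ 20 - a| <= scale n ^+ 20
   & `|c2%:R * scale n ^+ 20 - b| <= scale n ^+ 20 /\ `|c2.+1%:R * scale n ^+ 20 - b| <= scale n ^+ 20].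
(* Choice turns the data obtained for each [n] into sequences; the finitely many sizes that are not
   [good] get a dummy value. *)
have [q Hq] : exists q, forall n, good n -> spec n (q n).
  have [n|q Hq] := @choice _ _ (fun n q => good n -> spec n q); last by exists q.
  case: (boolP (good n)) => [/and3P[n0 nu nb]|_]; last by exists ((0, 0), (0%N, 0%N)).
  have s0 := scale_gt0 (R := R) n n0.
  have [t [v [tP v0 W T]]] := H n (scale n) s0 nu (scale_pow80 n n0).
  have f0 : ((pb alpha beta N n 0)%:~R : R) = 0 by exact: pb0.
  have [c1 [c2 [h1 h2 [h3 h4] [h5 h6 h7]]]] :=
    window_sum (scale n ^+ 20) a b (fun c => (pb alpha beta N n c)%:~R) (exprn_gt0 20 s0) a0 ab f0.
  have c2u : c2%:R * scale n ^+ 21 <= 1.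
    by rewrite exprSr mulrA; apply: le_trans nb; rewrite ler_pM2r.
  exists ((t, v), (c1, c2)) => _; split => //; split => //.
  by rewrite /X -scale_pow20 h2; exact: W.
pose t n := (q n).1.1; pose v n := (q n).1.2; pose c1 n := (q n).2.1; pose c2 n := (q n).2.2.
have b1 : 0 < 1 / (1 + b) by apply: divr_gt0; [exact: ltr01|lra].
have {}Hq : \forall n \near \oo, spec n ((t n, v n), (c1 n, c2 n)).
  near=> n; rewrite /t /v /c1 /c2; have : good n.
    have n0 : (0 < n)%N by near: n; exact: nbhs_infty_gt.
    have /andP[_ h1] : 0 < scale n <= u0 by near: n; exact: scale_near0.
    have /andP[s0 h2] : 0 < scale n <= 1 / (1 + b) by near: n; exact: scale_near0 b1.
    rewrite /good n0 h1 /=; move: h2; rewrite ler_pdivlMr ?mulrDr; lra.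
  by move=> /(Hq n); case: (q n) => [[? ?] [? ?]].
have sad : \forall n \near \oo, [/\ 0 < t n, t n <= scale n ^+ 40,
    scale n ^+ 40 <= 6 * t n & mean_size (t n) (N * (n + 2)) = n%:R].
  by near=> n; have [] : spec n ((t n, v n), (c1 n, c2 n)) by near: n.
have s20 : \forall n \near \oo, scale n ^+ 20 <= 1 * scale n :> R.
  near=> n; have /andP[s0 s1] : 0 < scale n <= 1 by near: n; exact: scale_near0.
  by rewrite mul1r -[leRHS]expr1; apply: ler_wiXn2l => //; exact: ltW.
have G (c : nat -> nat) (x : R) :
    (\forall n \near \oo, `|(c n)%:R * scale n ^+ 20 - x| <= scale n ^+ 20) ->
    gauss (t n) N (c n) @[n --> \oo] --> expR (- (pi * N%:R / (4 * Num.sqrt 3) * x ^+ 2)).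
  move=> hc; apply: gauss_cvg => //; apply: (scale_squeeze _ _ 1); near=> n.
  apply: (@le_trans _ _ (scale n ^+ 20)); near: n; [exact: hc|exact: s20].
set ea := expR (- (_ * a ^+ 2)); set eb := expR (- (_ * b ^+ 2)).
have gc : g (t n) (c1 n) (c2 n) @[n --> \oo] --> ea + ea - eb - eb.
  apply: cvgB; first apply: cvgB; first apply: cvgD.
  - apply: (G (fun n => (c1 n).-1)); near=> n.
    by have [_ _ _ [] //] : spec n ((t n, v n), (c1 n, c2 n)) by near: n.
  - apply: G; near=> n.
    by have [_ _ _ [] //] : spec n ((t n, v n), (c1 n, c2 n)) by near: n.
  - apply: G; near=> n.
    by have [_ _ _ _ [] //] : spec n ((t n, v n), (c1 n, c2 n)) by near: n.
  - apply: (G (fun n => (c2 n).+1)); near=> n.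
    by have [_ _ _ _ [] //] : spec n ((t n, v n), (c1 n, c2 n)) by near: n.
have vX : v n * X n @[n --> \oo] --> ea + ea - eb - eb.
  have d : (v n * X n - g (t n) (c1 n) (c2 n)) @[n --> \oo] --> (0 : R).
    apply: (scale_squeeze _ _ C); near=> n; rewrite subr0.
    by have [_ _ [] //] : spec n ((t n, v n), (c1 n, c2 n)) by near: n.
  rewrite -[_ - eb]add0r; have h := cvgD d gc.
  apply: cvg_near_eq (h _); near=> n.
  by rewrite /= subrK.
have vY : v n * Y n @[n --> \oo] --> (2 : R).
  apply: (scale_squeeze _ _ C); near=> n.
  by have [_ _ [] //] : spec n ((t n, v n), (c1 n, c2 n)) by near: n.
have two0 : (2 : R) != 0 by [].
(* Each end of the window contributes two equal limits, and the full sum has limit 2. *)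
have -> : ea - eb = (ea + ea - eb - eb) / 2 by field.
have h := cvgM vX (cvgV two0 vY).
apply: cvg_near_eq (h _ _); near=> n.
rewrite /= dcount_sub -/(Y n) -/(X n) /=.
have [_ v0 _ _ _] : spec n ((t n, v n), (c1 n, c2 n)) by near: n.
by rewrite invfM mulrACA mulfV// mul1r.
Unshelve. all: by end_near. Qed.

End Limit.

Theorem theorem1p4 (R : realType) (N alpha beta : nat)
  (hN : N = 2%N \/ (5 <= N)%N)
  (halpha : (1 <= alpha <= N)%N) (hbeta : (1 <= beta <= N)%N)
  (hneq : alpha <> beta)
  (a b : R) (ha : 0 <= a) (hab : a <= b) :
  (fun n : nat =>
     (\sum_(c \in [set c : nat | a <= n%:R `^ (- (1 / 4)) * c%:R <= b])
        ((pb alpha beta N n c)%:~R : R))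
     / ((dcount alpha beta N (0 : R) n)%:R - (dcount beta alpha N (0 : R) n)%:R))
    @ \oo -->
  pi * N%:R / (2 * Num.sqrt 3) *
  \int[lebesgue_measure]_(x in `[a, b])
     (x * expR (- (pi * N%:R * x ^+ 2 / (4 * Num.sqrt 3)))).
Proof.
(* [k] is the rate of the Gaussian and the prefactor of the integral is [2 k], so the integral is
   elementary. *)
pose k : R := pi * N%:R / (4 * Num.sqrt 3).
have s0 : 0 < Num.sqrt 3 :> R by rewrite sqrtr_gt0.
have N0 : 0 < N%:R :> R by rewrite ltr0n; clear -hN; lia.
have k0 : 0 < k by rewrite /k divr_gt0 ?mulr_gt0// pi_gt0.
have -> : pi * N%:R / (2 * Num.sqrt 3) = 2 * k :> R.
  by rewrite /k; move: (Num.sqrt 3) (lt0r_neq0 s0) (pi) => s sn q; field.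
have -> : (fun x : R => x * expR (- (pi * N%:R * x ^+ 2 / (4 * Num.sqrt 3))))
  = fun x => x * expR (- (k * x ^+ 2)).
  by apply/funext => x; rewrite /k [in RHS]mulrAC.
rewrite gauss_integral//; exact: limit_exists.
Qed.
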